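(* Let $\phi_k=M^*-M_*+2k-1$ and $M_k=M_*-k+1$, and define $c_0=0$, $c_i=c_{i-1}+\phi_i\ln\!\left(\frac{M_i}{M_i-1}\right)$ for $i=1,\dots,M_*-1$, and $c_{M_*}=\infty$. The distortion exponent achieved by the progressive multi-layer list decoding (LS-LD) scheme with infinitely many layers is $\Delta^*_{ls}(b,\nu)=\nu$ if $b\le\nu/M_*$, and if $c_{k-1}+\frac{\nu}{M_k}<b\le c_k+\frac{\nu}{M_k-1}$ for some $k\in\{1,\dots,M_*\}$, it is $$\Delta^*_{ls}(b,\nu)=\nu+\sum_{i=1}^{k-1}\phi_i+M_k\phi_k\left(1-e^{-\frac{b(1-\kappa^* )-c_{k-1}}{\phi_k}}\right),\qquad \kappa^*=\frac{\phi_k}{b}\,\mathcal W\!\left(\frac{e^{\frac{b-c_{k-1}}{\phi_k}}\,\nu}{M_k\phi_k}\right),$$ where $\mathcal W$ is the principal branch of the Lambert $W$ function (the solution $w$ of $z=we^w$).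
   Context: All logarithms are base 2, $\ln$ is natural. Let $M_t,M_r\ge1$ be integers, $M^*=\max\{M_t,M_r\}$, $M_*=\min\{M_t,M_r\}$. A block $S^m$ of i.i.d. $\mathcal{CN}(0,1)$ source samples is sent over one block of $n$ uses of the MIMO channel $\mathbf Y_i=\sqrt{\rho/M_t}\,\mathbf H\mathbf x_i+\mathbf N_i$, SNR $\rho>0$, $\mathbf H\in\mathbb C^{M_r\times M_t}$ with i.i.d. $\mathcal{CN}(0,1)$ entries constant over the block, $\mathbf N_i\sim\mathcal{CN}(0,\mathbf I)$ i.i.d., with power constraint $\sum_i\mathrm{Tr}\,\mathbb E[\mathbf X_i^H\mathbf X_i]\le nM_t$. The receiver observes also $T^m=\sqrt{\rho_s}\Gamma_cS^m+Z^m$, $\Gamma_c\sim\mathcal{CN}(0,1)$ constant over the block, unit-variance Gaussian noise $Z^m$; $\Gamma=|\Gamma_c|^2$ has density $e^{-\gamma}$. All random quantities are independent; the receiver knows $\mathbf H,\gamma$, the transmitter only their distributions. $b=n/m$; $\rho_s\doteq\rho^\nu$, $\nu\ge0$. The distortion exponent of $\mathbb E[D]$ is $-\lim_{\rho\to\infty}\log\mathbb E[D]/\log\rho$. Let $D_d(R,\gamma)=(\rho_s\gamma+2^R)^{-1}$. LS-LD scheme with $L$ layers and rates $R_l=r_l\log\rho$, $r_l\ge0$, $l=1,\dots,L$: the source is encoded into $L$ Gaussian successive-refinement (Wyner–Ziv) layers, layer $l$ carrying $bR_l/L$ bits per source sample, and layer $l$ is sent with the LD scheme (Gaussian channel codebook,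 list decoding jointly with $T^m$ and previously decoded layers) over its own $n/L$ channel uses; layers are decoded in order. With $\bar R_l=\sum_{i=1}^lR_i$, layer $l$ is in outage if $\log\frac{2^{\frac bL\bar R_l}+\gamma\rho_s}{2^{\frac bL\bar R_{l-1}}+\gamma\rho_s}\ge\frac bL\log\det(\mathbf I+\frac{\rho}{M_*}\mathbf H\mathbf H^H)$. If $N$ is the largest $l$ such that none of layers $1,\dots,l$ is in outage, the distortion is $D_d(\frac bL\bar R_N,\gamma)$; the expected distortion is its expectation over $\mathbf H,\Gamma$. Let $\Delta^L_{ls}(b,\nu)$ be the supremum over $(r_1,\dots,r_L)$ of the resulting distortion exponent; the exponent with infinitely many layers is $\Delta^*_{ls}=\lim_{L\to\infty}\Delta^L_{ls}$. *)

(* Defs.v *)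
From HB Require Import structures.
From mathcomp Require Import all_boot all_order all_algebra.
From mathcomp Require Import all_classical all_reals all_analysis.
From mathcomp Require Import complex.
Set Implicit Arguments. Unset Strict Implicit. Unset Printing Implicit Defensive.
Import Order.TTheory GRing.Theory Num.Theory.
Import numFieldNormedType.Exports.
Local Open Scope classical_set_scope.
Local Open Scope ring_scope.

Section Defs.
Variable R : realType.

Definition log2 (x : R) : R := ln x / ln 2.

Definition lambertW (z : R) : R := xget 0 [set w : R | -1 <= w /\ w * expR w = z].

(** phi_k = M^* - M_* + 2k - 1  and  M_k = M_* - k + 1 (k >= 1, k <= M_* ) *)
Definition phiK (Mhi Mlo k : nat) : R := ((Mhi - Mlo + 2 * k - 1)%N)%:R.
Definition MK (Mlo k : nat) : R := ((Mlo - k + 1)%N)%:R.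

(** c_0 = 0, c_i = c_{i-1} + phi_i ln(M_i/(M_i - 1)); only i <= M_* - 1 is used
    (c_{M_*} = infinity is handled in the statement). *)
Fixpoint cK (Mhi Mlo i : nat) : R :=
  match i with
  | 0 => 0
  | i'.+1 => cK Mhi Mlo i' + phiK Mhi Mlo i * ln (MK Mlo i / (MK Mlo i - 1))
  end.

Definition kappa_star (Mhi Mlo : nat) (b nu : R) (k : nat) : R :=
  phiK Mhi Mlo k / b *
  lambertW (expR ((b - cK Mhi Mlo k.-1) / phiK Mhi Mlo k) * nu
            / (MK Mlo k * phiK Mhi Mlo k)).

Definition Delta_region (Mhi Mlo : nat) (b nu : R) (k : nat) : R :=
  nu + \sum_(1 <= i < k) phiK Mhi Mlo i
  + MK Mlo k * phiK Mhi Mlo k *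
    (1 - expR (- ((b * (1 - kappa_star Mhi Mlo b nu k) - cK Mhi Mlo k.-1)
                  / phiK Mhi Mlo k))).

(** Index set of the real scalar random variables: [Some (i,j,false)] = Re H_ij,
    [Some (i,j,true)] = Im H_ij, [None] = Gamma = |Gamma_c|^2. *)
Definition rv_index (Mr Mt : nat) := option ('I_Mr * 'I_Mt * bool).

Definition rv_family d (T : measurableType d) (Mr Mt : nat)
  (Hre Him : 'I_Mr -> 'I_Mt -> T -> R) (G : T -> R) (k : rv_index Mr Mt) : T -> R :=
  match k with
  | None => G
  | Some (i, j, false) => Hre i j
  | Some (i, j, true) => Him i j
  end.

Definition mutually_independent d (T : measurableType d) (P : probability T R)
  (I : finType) (X : I -> T -> R) : Prop :=
  forall B : I -> set R, (forall i, measurable (B i)) ->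
    P (\bigcap_i (X i @^-1` B i)) = (\prod_(i : I) P (X i @^-1` B i))%E.

(** H has i.i.d. CN(0,1) entries (real and imaginary parts i.i.d. N(0,1/2)),
    Gamma has density e^{-gamma} on [0,oo), all independent. *)
Definition channel_model d (T : measurableType d) (P : probability T R) (Mr Mt : nat)
  (Hre Him : 'I_Mr -> 'I_Mt -> T -> R) (G : T -> R) : Prop :=
  [/\ forall k, measurable_fun setT (rv_family Hre Him G k),
      forall i j (B : set R), measurable B ->
        P (Hre i j @^-1` B) = normal_prob 0 (Num.sqrt (2^-1)) B,
      forall i j (B : set R), measurable B ->
        P (Him i j @^-1` B) = normal_prob 0 (Num.sqrt (2^-1)) B,
      forall (B : set R), measurable B -> P (G @^-1` B) = exponential_prob 1 B
    & mutually_independent P (rv_family Hre Him G)].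

Definition chanH d (T : measurableType d) (Mr Mt : nat)
  (Hre Him : 'I_Mr -> 'I_Mt -> T -> R) (x : T) : 'M[R[i]]_(Mr, Mt) :=
  \matrix_(i, j) (Complex (Hre i j x) (Him i j x)).

Definition logdet (Mr Mt : nat) (rho : R) (H : 'M[R[i]]_(Mr, Mt)) : R :=
  log2 (complex.Re (\det (1%:M + (Complex (rho / (minn Mt Mr)%:R) 0) *: (H *m map_mx conjc H^T)))).

(** cumulative rate  \bar R_l = sum_{i <= l} R_i, with R_i = r_i log rho
    (layers numbered 1..L, r indexed by 'I_L, layer i+1 <-> r i) *)
Definition cumrate (L : nat) (r : 'I_L -> R) (rho : R) (l : nat) : R :=
  \sum_(i < L | (i < l)%N) r i * log2 rho.

Definition outage (L : nat) (b : R) (r : 'I_L -> R) (rho rhos gamma C : R) (l : nat) : bool :=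
  (b / L%:R) * C <=
  log2 ((2 `^ (b / L%:R * cumrate r rho l) + gamma * rhos)
        / (2 `^ (b / L%:R * cumrate r rho l.-1) + gamma * rhos)).

Definition Ndecoded (L : nat) (b : R) (r : 'I_L -> R) (rho rhos gamma C : R) : nat :=
  \max_(l < L.+1 | [forall j : 'I_L, (j < l)%N ==> ~~ outage b r rho rhos gamma C j.+1]) l.

Definition Dd (rhos Rr gamma : R) : R := (rhos * gamma + 2 `^ Rr)^-1.

Definition lsld_distortion (Mr Mt L : nat) (b : R) (r : 'I_L -> R) (rho rhos gamma : R)
  (H : 'M[R[i]]_(Mr, Mt)) : R :=
  let C := logdet rho H in
  Dd rhos (b / L%:R * cumrate r rho (Ndecoded b r rho rhos gamma C)) gamma.

Definition lsld_ED d (T : measurableType d) (P : probability T R) (Mr Mt L : nat)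
  (Hre Him : 'I_Mr -> 'I_Mt -> T -> R) (G : T -> R)
  (b : R) (r : 'I_L -> R) (rhos : R -> R) (rho : R) : R :=
  fine (\int[P]_x (lsld_distortion b r rho (rhos rho) (G x) (chanH Hre Him x))%:E)%E.

Definition has_dist_exponent (f : R -> R) (dexp : R) : Prop :=
  (- log2 (f x) / log2 x) @[x --> +oo] --> dexp.

Definition Delta_L d (T : measurableType d) (P : probability T R) (Mr Mt : nat)
  (Hre Him : 'I_Mr -> 'I_Mt -> T -> R) (G : T -> R)
  (b : R) (rhos : R -> R) (L : nat) : \bar R :=
  ereal_sup [set e : \bar R | exists (r : 'I_L -> R) (dexp : R),
     [/\ e = dexp%:E, (forall i, 0 <= r i)
       & has_dist_exponent (lsld_ED P Hre Him G b r rhos) dexp]].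

End Defs.

(* Main.v *)
Require Import Defs.
From HB Require Import structures.
From mathcomp Require Import all_boot all_order all_algebra all_fingroup.
From mathcomp Require Import all_classical all_reals all_analysis.
From mathcomp Require Import measurable_realfun.
From mathcomp Require Import complex lra zify ring.
Import Order.TTheory GRing.Theory Num.Theory.
Import numFieldNormedType.Exports.
Import ComplexField.Normc.
Set Implicit Arguments. Unset Strict Implicit. Unset Printing Implicit Defensive.
Local Open Scope classical_set_scope.
Local Open Scope ring_scope.

(** Write [X = sqrt(rho/M_* ) H] and [D(X) = det(I + X X^H)].  By Cauchy-Binet, [D(X)] is
    comparable to the largest squared minor of [X].  The probability that
    [D(X) <= rho^s] decays like [rho^(-dmt s)], where [dmt] is the piecewise linear
    function with slopes [phi_k] (the diversity-multiplexing tradeoff).  This is proved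
    without eigenvalue densities: matrices with small minors are covered by few cells of
    constant size, by recursion on the Schur complement of the largest entry; conversely,
    many disjoint cells of constant size on which [D] is small are obtained by building
    matrices of Gaussian integers from their Schur complements.

    Let [y_l = (b/L)(r_1 + ... + r_l)].  Layer [l+1] fails essentially when
    [D(X) <= rho^(r_(l+1))], and the distortion is then [1 / (rhos * Gamma + rho^(y_l))], of
    exponent [max(nu, y_l)].  Hence the distortion exponent is at most each of
    [max(nu, y_l) + dmt(r_(l+1))] and [max(nu, y_L)], and it is [max(nu, y_L)] when this
    is the smallest of them.  To reach [Delta], the rate at level [y] may be at most
    [g(y)], where [dmt(g(y)) = Delta - max(nu, y)]; as layers become infinitely fine, the
    bandwidth needed is the integral of [dy / g(y)] from [0] to [Delta], which is
    [nu/r0 + dmt_time r0] with [r0 = g(nu)].  Setting this equal to [b] gives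
    [Delta = nu + dmt r0]; on each linear piece of [dmt] the equation for [r0] is solved by
    the Lambert function. *)

(** Why counting suffices: a cell of constant size in [X] has probability about rho^(-mn), where [H]
    is m x n, so both directions aim at the count rho^(mn - dmt s). Pivoting on an entry of modulus
    about q leaves q^(2(m+n-1)) choices for the pivot row and column and divides the squared minors
    by q^2. The largest count lets j pivots have the full size rho^(1/2) and the next one the size
    rho^((s-j)/2); this produces the line of [dmt] on [j, j+1]. The exponent max(nu, y) comes from
    Gamma, which is below t with probability about t: for y < nu, making the side term as small as
    rho^y costs rho^(-(nu-y)). Neither the outage events nor the distortion are shown to be
    measurable. Events are enclosed in, or contain, finite unions of boxes, and integrals are
    compared through the simple functions below them. The admissible rate g is nondecreasing, so
    equal shares of bandwidth form an Euler scheme with a one-sided error: the converse holds for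
    every number of layers, and the achieved value is off by O(1/L). *)

(* The sum runs over all maps, not only increasing ones, so each minor is counted [m!]
   times; this avoids ordering the columns. *)
Lemma cauchy_binet (F : comNzRingType) (m p : nat) (A : 'M[F]_(m, p)) (B : 'M[F]_(p, m)) :
  m`!%:R * \det (A *m B) =
  \sum_(g : {ffun 'I_m -> 'I_p}) \det (colsub g A) * \det (rowsub g B).
Proof.
have expand : \det (A *m B) =
    \sum_(g : {ffun 'I_m -> 'I_p}) (\prod_i A i (g i)) * \det (rowsub g B).
  rewrite /determinant.
  under eq_bigr => s _.
    under eq_bigr => i _ do rewrite mxE.
    rewrite bigA_distr_bigA big_distrr /=.
    over.
  rewrite exchange_big /=; apply: eq_bigr => g _.
  rewrite big_distrr /=; apply: eq_bigr => s _.
  rewrite big_split /= mulrCA; congr (_ * (_ * _)).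
  by apply: eq_bigr => i _; rewrite mxE.
(* Replacing [g] by [g] after [t] permutes the rows of [rowsub g B]. Summed over [t], the signed
   products become [\det (colsub g A)], and the left side is counted m! times. *)
have twist (t : 'S_m) : \det (A *m B) =
    \sum_(g : {ffun 'I_m -> 'I_p})
      ((-1) ^+ t * \prod_i (colsub g A) i (t i)) * \det (rowsub g B).
  rewrite expand (reindex_onto (fun g : {ffun 'I_m -> 'I_p} => [ffun i => g (t i)])
    (fun g => [ffun i => g ((t^-1)%g i)])) /=; last first.
    by move=> g _; apply/ffunP => i; rewrite !ffunE permK.
  apply: eq_big => [g|g _].
    by apply/eqP/ffunP => i; rewrite !ffunE permKV.
  have -> : rowsub [ffun i => g (t i)] B = row_perm t (rowsub g B).
    by apply/matrixP => i j; rewrite !mxE ffunE.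
  rewrite row_permE det_mulmx det_perm mulrA [_ * (-1) ^+ _]mulrC.
  by congr (_ * _ * _); apply: eq_bigr => i _; rewrite !mxE ffunE.
rewrite mulr_natl -[in LHS](card_Sn m) -sumr_const.
under eq_bigr => t _ do rewrite (twist t).
rewrite exchange_big /=; apply: eq_bigr => g _.
by rewrite -big_distrl.
Qed.

(** Expanding along a unit column outside the image of [f] deletes that column and the row of the
    same index, with sign +1. Once [f] is onto it is a permutation, and the signs of reordering rows
    and columns cancel. *)
Lemma det_unit_cols (F : comNzRingType) (m k : nat) (f : 'I_k -> 'I_m) (N : 'M[F]_m) :
  injective f ->
  (forall i, i \notin codom f -> forall j, N j i = (j == i)%:R) ->
  \det N = \det (mxsub f f N).
Proof.
elim: m f N => [|m IHm] f N f_inj N_unit.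
  case: k f f_inj N_unit => [|k] f f_inj N_unit; last by case: (f ord0).
  by rewrite !det_mx00.
case: (pickP [pred i | i \notin codom f]) => [i /= i_f|f_surj].
  have lift_f j : {l | f j = lift i l}.
    by case: (unliftP i (f j)) => [l ->|fj]; [exists l | case/negP: i_f; rewrite -fj codom_f].
  pose f' j := sval (lift_f j).
  have ff' j : f j = lift i (f' j) := svalP (lift_f j).
  rewrite (expand_det_col _ i) (bigD1 i) //= big1 ?addr0; last first.
    by move=> j ji; rewrite N_unit // (negbTE ji) mul0r.
  rewrite N_unit // eqxx mul1r /cofactor -signr_odd oddD addbb mul1r.
  rewrite (IHm f').
  - by congr (\det _); apply/matrixP => a b; rewrite !mxE !ff'.
  - by move=> a b ab; apply: f_inj; rewrite !ff' ab.
  move=> j j_f' l; rewrite !mxE N_unit ?(inj_eq lift_inj) //.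
  apply: contra j_f' => /codomP[a]; rewrite ff' => /lift_inj ->.
  exact: codom_f.
have km : k = m.+1.
  transitivity #|codom f|; first by rewrite card_codom // card_ord.
  rewrite -[RHS]card_ord; apply: eq_card => i.
  by have /negbFE := f_surj i; rewrite inE => ->.
subst k.
have -> : mxsub f f N = row_perm (perm f_inj) (col_perm (perm f_inj) N).
  by apply/matrixP => a b; rewrite !mxE !permE.
by rewrite row_permE col_permE !det_mulmx !det_perm odd_permV mulrCA -signr_addb addbb mulr1.
Qed.

(** * Gram determinants and minors *)

Section GramDeterminant.
Variable R : rcfType.
Implicit Types (m n k : nat).

Definition gram_det m n (X : 'M[R[i]]_(m, n)) : R :=
  complex.Re (\det (1%:M + X *m map_mx conjc X^T)).

(** Size 0 is allowed and its minor is 1, so the bound forces [1 <= T]. The columns [g] may repeat,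
    which only adds zero minors. *)
Definition minors_le m n (T : R) (X : 'M[R[i]]_(m, n)) : Prop :=
  forall k (f : 'I_k -> 'I_m) (g : 'I_k -> 'I_n), injective f ->
    normc (\det (mxsub f g X)) ^+ 2 <= T.

Lemma normc_ge0 (z : R[i]) : 0 <= normc z.
Proof. by case: z => a b; rewrite sqrtr_ge0. Qed.

Lemma conjcM_normc (z : R[i]) : z * conjc z = (normc z ^+ 2)%:C%C.
Proof.
case: z => a b; rewrite /normc sqr_sqrtr ?addr_ge0 ?sqr_ge0 // -[LHS]/(Complex _ _).
by rewrite mulrN opprK -!expr2 mulrN [b * a]mulrC addNr.
Qed.

(* Cauchy-Binet applied to [I + X X^H = (I|X)(I|X)^H]. *)
Lemma fact_gram_det m n (X : 'M[R[i]]_(m, n)) :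
  m`!%:R * \det (1%:M + X *m map_mx conjc X^T) =
  (\sum_(g : {ffun 'I_m -> 'I_(m + n)})
      normc (\det (colsub g (row_mx 1%:M X))) ^+ 2)%:C%C.
Proof.
have -> : 1%:M + X *m map_mx conjc X^T =
    row_mx 1%:M X *m map_mx conjc (row_mx 1%:M X)^T.
  by rewrite tr_row_mx map_col_mx mul_row_col trmx1 map_mx1 mulmx1.
rewrite cauchy_binet rmorph_sum /=; apply: eq_bigr => g _.
rewrite -conjcM_normc; congr (_ * _); rewrite -det_map_mx -det_tr.
by congr (\det _); apply/matrixP => i j; rewrite !mxE.
Qed.

Lemma gram_detE m n (X : 'M[R[i]]_(m, n)) :
  m`!%:R * gram_det X =
  \sum_(g : {ffun 'I_m -> 'I_(m + n)})
      normc (\det (colsub g (row_mx 1%:M X))) ^+ 2.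
Proof.
have ReMn (z : R[i]) l : complex.Re (z *+ l) = complex.Re z *+ l.
  by elim: l => [|l IHl]; rewrite ?mulr0n // !mulrS -IHl; case: (z *+ l); case: (z).
have := congr1 (@complex.Re R) (fact_gram_det X).
by rewrite !mulr_natl ReMn => ->.
Qed.

(* Completing a minor of [X] by unit columns gives a maximal minor of [(I|X)]. *)
Lemma gram_det_minors m n (X : 'M[R[i]]_(m, n)) :
  minors_le (m`!%:R * gram_det X) X.
Proof.
move=> k f g f_inj; rewrite gram_detE.
pose h : {ffun 'I_m -> 'I_(m + n)} :=
  [ffun i => if [pick j | f j == i] is Some j then rshift m (g j) else lshift n i].
rewrite (bigD1 h) //=; apply: ler_wpDr; first by apply: sumr_ge0 => ? _; apply: sqr_ge0.
rewrite (det_unit_cols f_inj).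
  rewrite le_eqVlt (_ : mxsub f f _ = mxsub f g X) ?eqxx //.
  apply/matrixP => a b; rewrite [LHS]mxE [LHS]mxE [RHS]mxE ffunE; case: pickP => [j /eqP /f_inj ->|/(_ b)].
    by rewrite row_mxEr.
  by rewrite /= eqxx.
move=> i i_f j; rewrite [LHS]mxE ffunE; case: pickP => [l /eqP fl|_].
  by case/negP: i_f; rewrite -fl codom_f.
by rewrite row_mxEl mxE.
Qed.

Lemma gram_det_ge1 m n (X : 'M[R[i]]_(m, n)) : 1 <= m`!%:R * gram_det X.
Proof.
pose e l (i : 'I_0) : 'I_l := False_rect _ (notF (ltn_ord i)).
have e_inj : injective (e m) by case.
by have := gram_det_minors X (e n) e_inj; rewrite det_mx00 normc1 expr1n.
Qed.
End GramDeterminant.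

(** * Covering matrices with small minors *)

Lemma det_schur1 (F : fieldType) k (a : F) (v : 'rV[F]_k) (u : 'cV_k) (B : 'M[F]_k) :
  a != 0 ->
  \det (block_mx a%:M v u B : 'M[F]_(1 + k)) = a * \det (B - a^-1 *: (u *m v)).
Proof.
move=> a0; have -> : block_mx a%:M v u B =
    block_mx (1%:M : 'M[F]_1) 0 (a^-1 *: u) 1%:M *m
    block_mx a%:M v 0 (B - a^-1 *: (u *m v)).
  rewrite mulmx_block !mul1mx !mul0mx !addr0 -!scalemxAl.
  by rewrite mul_mx_scalar scalerA mulVf // scale1r [_ + (B - _)]addrC subrK.
by rewrite det_mulmx det_lblock det_ublock !det1 !mul1r det_scalar1.
Qed.

Lemma lift0_rshift k (i : 'I_k) : lift ord0 i = rshift 1 i.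
Proof. exact: val_inj. Qed.

Lemma ord0_lshift k : ord0 = lshift k ord0 :> 'I_(1 + k).
Proof. exact: val_inj. Qed.

Section Covering.
Variable R : realType.
Implicit Types (m n k : nat).

Definition schur m n (i0 : 'I_m.+1) (j0 : 'I_n.+1) (X : 'M[R[i]]_(m.+1, n.+1)) :
  'M[R[i]]_(m, n) :=
  \matrix_(i, j) (X (lift i0 i) (lift j0 j) -
                  (X i0 j0)^-1 * (X (lift i0 i) j0 * X i0 (lift j0 j))).

(** Bordering a minor of the Schur complement by the pivot row and column gives a minor of [X],
    equal to the pivot times the former. *)
Lemma minors_le_schur m n i0 j0 (X : 'M[R[i]]_(m.+1, n.+1)) (T : R) :
  X i0 j0 != 0 -> minors_le T X ->
  minors_le (T / normc (X i0 j0) ^+ 2) (schur i0 j0 X).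
Proof.
move=> a0 minX k f g f_inj.
pose f' (l : 'I_k.+1) := if unlift ord0 l is Some l' then lift i0 (f l') else i0.
pose g' (l : 'I_k.+1) := if unlift ord0 l is Some l' then lift j0 (g l') else j0.
have f'_inj : injective f'.
  move=> a b; rewrite /f'.
  case: (unliftP ord0 a) => [a'|] ->; case: (unliftP ord0 b) => [b'|] -> //.
  - by move=> /lift_inj/f_inj ->.
  - by move=> /eqP; rewrite eq_sym (negbTE (neq_lift _ _)).
  - by move=> /eqP; rewrite (negbTE (neq_lift _ _)).
have := minX _ f' g' f'_inj.
have nz : 0 < normc (X i0 j0) ^+ 2.
  rewrite exprn_gt0 // lt_def normc_ge0 andbT.
  by apply: contra a0 => /eqP/eq0_normc ->.
rewrite ler_pdivlMr //.
suff -> : \det (mxsub f' g' X) = X i0 j0 * \det (mxsub f g (schur i0 j0 X)).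
  by rewrite normcM exprMn mulrC.
have -> : mxsub f' g' X = block_mx (X i0 j0)%:M
    (\row_j X i0 (lift j0 (g j))) (\col_i X (lift i0 (f i)) j0)
    (\matrix_(i, j) X (lift i0 (f i)) (lift j0 (g j))).
  apply/matrixP => i j; rewrite [LHS]mxE.
  case: (unliftP ord0 i) => [i'|] ->; case: (unliftP ord0 j) => [j'|] ->;
    rewrite /f' /g' ?liftK ?unlift_none.
  - rewrite (lift0_rshift i') (lift0_rshift j').
    by apply: etrans (esym (block_mxEdr _ _ _ _ _ _)); rewrite mxE.
  - rewrite (lift0_rshift i') (ord0_lshift k).
    by apply: etrans (esym (block_mxEdl _ _ _ _ _ _)); rewrite mxE.
  - rewrite (lift0_rshift j') (ord0_lshift k).
    by apply: etrans (esym (block_mxEur _ _ _ _ _ _)); rewrite mxE.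
  - rewrite (ord0_lshift k).
    by apply: etrans (esym (block_mxEul _ _ _ _ _ _)); rewrite mxE eqxx.
rewrite (det_schur1 _ _ _ a0); apply: (congr1 (fun M => _ * \det M)); apply/matrixP => i j.
by rewrite !mxE big_ord1 !mxE.
Qed.

(** The radius [K] is meant to stay fixed while [beta] grows with the scales of the problem. *)
Definition coverable m n (K beta : R) (Q : 'M[R[i]]_(m, n) -> Prop) :=
  exists s : seq 'M[R[i]]_(m, n), (size s)%:R <= beta /\
    forall X, Q X -> exists2 Y, Y \in s & forall i j, normc (X i j - Y i j) <= K.

Lemma coverable_bigcup m n (A : eqType) (l : seq A) (Q : A -> 'M[R[i]]_(m, n) -> Prop)
    (K beta : R) :
  (forall a, a \in l -> coverable K beta (Q a)) ->
  coverable K ((size l)%:R * beta) (fun X => exists2 a, a \in l & Q a X).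
Proof.
elim: l => [_|a l IHl coverQ].
  by exists [::]; split; [rewrite mul0r | move=> X [a]].
have [|s [s_le sP]] := IHl; first by move=> x xl; apply: coverQ; rewrite inE xl orbT.
have [s' [s'_le s'P]] := coverQ a (mem_head _ _).
exists (s' ++ s); split.
  by rewrite size_cat natrD /= -[(size l).+1]add1n natrD mulrDl mul1r lerD.
move=> X [x]; rewrite inE => /predU1P[->|xl] QX.
  by have [Y Ys' YP] := s'P X QX; exists Y; rewrite // mem_cat Ys'.
have [|Y Ys YP] := sP X; first by exists x.
by exists Y; rewrite // mem_cat Ys orbT.
Qed.

Lemma coverableW m n (K K' beta beta' : R) (Q Q' : 'M[R[i]]_(m, n) -> Prop) :
  K <= K' -> beta <= beta' -> (forall X, Q' X -> Q X) ->
  coverable K beta Q -> coverable K' beta' Q'.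
Proof.
move=> KK' bb' QQ' [s [s_le sP]]; exists s; split; first exact: le_trans bb'.
by move=> X /QQ'/sP[Y Ys YP]; exists Y => // i j; apply: le_trans KK'.
Qed.

Lemma normc_le_ReIm (z : R[i]) : normc z <= `|complex.Re z| + `|complex.Im z|.
Proof.
case: z => a b /=; rewrite -[leRHS]ger0_norm ?addr_ge0 // -sqrtr_sqr ler_sqrt ?sqr_ge0 //.
by rewrite sqrrD -[a ^+ 2]real_normK ?num_real // -[b ^+ 2]real_normK ?num_real // lerD2r lerDl mulrn_wge0 // mulr_ge0.
Qed.

Lemma Re_le_normc (z : R[i]) : `|complex.Re z| <= normc z.
Proof.
by case: z => a b /=; rewrite -sqrtr_sqr ler_sqrt ?addr_ge0 ?sqr_ge0 // lerDl sqr_ge0.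
Qed.

Lemma Im_le_normc (z : R[i]) : `|complex.Im z| <= normc z.
Proof.
by case: z => a b /=; rewrite -sqrtr_sqr ler_sqrt ?addr_ge0 ?sqr_ge0 // lerDr sqr_ge0.
Qed.

(** A square grid of (2c+1)^2 <= 9c^2 points; each coordinate is rounded with error at most 1. *)
Lemma net_disc (c : nat) : (0 < c)%N ->
  exists s : seq R[i], (size s)%:R <= 9 * c%:R ^+ 2 :> R /\
    forall z, normc z <= c%:R -> exists2 w, w \in s & normc (z - w) <= 2.
Proof.
move=> c0; pose l := [seq (k%:R - c%:R : R) | k <- iota 0 (c + c).+1].
have near_l x : `|x| <= c%:R -> exists2 k, k \in l & `|x - k| <= 1.
  move=> x_le; exists ((Num.truncn (x + c%:R))%:R - c%:R).
    apply/mapP; exists (Num.truncn (x + c%:R)) => //.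
    rewrite mem_iota add0n leq0n /= ltnS -(ler_nat R) natrD.
    have xc0 : 0 <= x + c%:R by move: x_le; rewrite ler_norml; lra.
    have := truncn_le (x + c%:R); rewrite xc0 => h.
    by apply: le_trans h _; move: x_le; rewrite ler_norml; lra.
  have xc0 : 0 <= x + c%:R by move: x_le; rewrite ler_norml; lra.
  have /andP[h1 h2] := truncn_itv xc0.
  by move: h2; rewrite -addn1 natrD ler_norml => h2; apply/andP; split; lra.
exists [seq (Complex x y) | x <- l, y <- l]; split.
  rewrite size_allpairs size_map size_iota -natrX -natrM ler_nat; nia.
move=> z z_le.
have [x xl zx] := near_l _ (le_trans (Re_le_normc z) z_le).
have [y yl zy] := near_l _ (le_trans (Im_le_normc z) z_le).
exists (Complex x y); first by apply/allpairsP; exists (x, y).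
apply: le_trans (normc_le_ReIm _) _.
by case: z {z_le} zx zy => a b /=; lra.
Qed.

Lemma net_mx m n (c : nat) : (0 < c)%N ->
  coverable 2 ((9 * c%:R ^+ 2) ^+ (m * n))
    (fun X : 'M[R[i]]_(m, n) => forall i j, normc (X i j) <= c%:R).
Proof.
move=> /net_disc[s [s_le sP]].
exists [seq (\matrix_(i, j) s`_(f (i, j))) | f : {ffun 'I_m * 'I_n -> 'I_(size s)}].
split.
  rewrite size_map -cardE card_ffun card_prod !card_ord natrX.
  by apply: lerXn2r; rewrite ?nnegrE ?ler0n // (le_trans _ s_le) ?ler0n.
move=> X X_le; pose near i j (w : R[i]) := normc (X i j - w) <= 2.
have hasX ij : has (near ij.1 ij.2) s by apply/hasP; exact: sP.
have findX ij : (find (near ij.1 ij.2) s < size s)%N by rewrite -has_find.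
pose f := [ffun ij => Ordinal (findX ij)].
exists (\matrix_(i, j) s`_(f (i, j))); first by apply/mapP; exists f; rewrite ?mem_enum.
by move=> i j; rewrite mxE ffunE /=; exact: (nth_find 0 (hasX (i, j))).
Qed.

(** The exponents belong to two scales, the bound [T] on squared minors and the area c^2 available
    to an entry. With T = rho^s and c = rho^(1/2) the count is of order rho^(ps+e). *)
Definition low_det_covers m n p e : Prop :=
  exists K C : nat, forall (c : nat) (T : R), (0 < c)%N -> 0 < T ->
    coverable K%:R (C%:R * T ^+ p * c%:R ^+ (2 * e))
      (fun X : 'M[R[i]]_(m, n) =>
        (forall i j, normc (X i j) <= c%:R) /\ minors_le T X).

Lemma minors_le_ge1 m n T (X : 'M[R[i]]_(m, n)) : minors_le T X -> 1 <= T.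
Proof.
pose e l (i : 'I_0) : 'I_l := False_rect _ (notF (ltn_ord i)).
have e_inj : injective (e m) by case.
by move=> /(_ 0 (e m) (e n) e_inj); rewrite det_mx00 normc1 expr1n.
Qed.

Lemma minors_le_entry m n T (X : 'M[R[i]]_(m, n)) i j :
  minors_le T X -> normc (X i j) ^+ 2 <= T.
Proof.
move=> /(_ 1 (fun _ => i) (fun _ => j)); rewrite det_mx11 mxE; apply.
by move=> a b _; rewrite !ord1.
Qed.

Lemma exists_max_entry m n (X : 'M[R[i]]_(m.+1, n.+1)) :
  exists ij : 'I_m.+1 * 'I_n.+1, forall i j, normc (X i j) <= normc (X ij.1 ij.2).
Proof.
exists [arg max_(ij > (ord0, ord0) : 'I_m.+1 * 'I_n.+1) normc (X ij.1 ij.2)]%O.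
by case: arg_maxP => // ij _ max_ij i j; apply: (max_ij (i, j)).
Qed.

Lemma normcB (x y : R[i]) : normc (x - y) = normc (y - x).
Proof. by rewrite -normcN opprB. Qed.

(** The pivot dominates [u] and [v], so uv/a has bounded partial derivatives. The bound 5 on the
    pivot keeps |a'| >= |a|/2 and |u'|, |v'| <= 2|a|; the three telescoping terms are then at most
    2, 4 and 16. *)
Lemma normc_quot_perturb (a u v a' u' v' : R[i]) :
  5 <= normc a -> normc u <= normc a -> normc v <= normc a ->
  normc (a - a') <= 2 -> normc (u - u') <= 2 -> normc (v - v') <= 2 ->
  normc (a^-1 * (u * v) - a'^-1 * (u' * v')) <= 22.
Proof.
move=> a5 ua va aa' uu' vv'.
set A := normc a in a5 ua va.
have A0 : 0 < A by lra.
have a'_ge : A / 2 <= normc a'.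
  have := le_normcD (a - a') a'; rewrite subrK -/A; lra.
have u'_le : normc u' <= 2 * A.
  have := le_normcD (u' - u) u; rewrite subrK normcB; lra.
have v'_le : normc v' <= 2 * A.
  have := le_normcD (v' - v) v; rewrite subrK normcB; lra.
have a0 : a != 0 by apply/eqP => a0; move: A0; rewrite /A a0 normc0 ltxx.
have a'0 : a' != 0 by apply/eqP => a'0; move: a'_ge; rewrite a'0 normc0; lra.
have -> : a^-1 * (u * v) - a'^-1 * (u' * v') =
    a^-1 * ((u - u') * v) + (a^-1 * (u' * (v - v')) + a^-1 * a'^-1 * (u' * v') * (a' - a)).
  by field; rewrite a0 a'0.
have iA : normc a^-1 = A^-1 by rewrite normcV.
have ia' : normc a'^-1 <= 2 / A.
  rewrite normcV -[2 / A]invrK invf_div lef_pV2 // posrE; last by lra.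
  by apply: lt_le_trans a'_ge; lra.
have n0 z := normc_ge0 z.
have AV : A^-1 * A = 1 by rewrite mulVf // gt_eqF.
have iA0 : 0 <= A^-1 by rewrite invr_ge0 ltW.
apply: le_trans (le_normcD _ _) _.
have t1 : normc (a^-1 * ((u - u') * v)) <= 2.
  rewrite !normcM iA; apply: (@le_trans _ _ (A^-1 * (2 * A))); last by lra.
  by apply: ler_wpM2l => //; apply: ler_pM.
apply: (@le_trans _ _ (2 + 20)); last by lra.
apply: lerD => //.
apply: le_trans (le_normcD _ _) _.
have t2 : normc (a^-1 * (u' * (v - v'))) <= 4.
  rewrite !normcM iA; apply: (@le_trans _ _ (A^-1 * ((2 * A) * 2))); last by lra.
  by apply: ler_wpM2l => //; apply: ler_pM.
apply: (@le_trans _ _ (4 + 16)); last by lra.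
apply: lerD => //.
rewrite !normcM iA; apply: (@le_trans _ _ ((A^-1 * (2 / A)) * ((2 * A) * (2 * A)) * 2)).
  apply: ler_pM => //; [by rewrite !mulr_ge0 // | | by rewrite normcB].
  apply: ler_pM => //; [by rewrite !mulr_ge0 // | by rewrite !mulr_ge0 // | | ].
    by apply: ler_wpM2l.
  exact: ler_pM.
rewrite (_ : _ * 2 = 16 * (A^-1 * A) ^+ 2); last by ring.
by rewrite AV expr1n mulr1.
Qed.
End Covering.

(** * Covering by recursion on the Schur complement of the largest entry *)

Section CoveringRecursion.
Variable R : realType.
Implicit Types (m n k : nat).

(* With the pivot row and column known up to 2, [X] is determined up to a bounded error by
   its Schur complement, whose minors are those of [X] divided by the pivot. *)
Lemma pivot_cover m n p e (K C : nat) :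
  (forall (c : nat) (T : R), (0 < c)%N -> 0 < T ->
    coverable K%:R (C%:R * T ^+ p * c%:R ^+ (2 * e))
      (fun X : 'M[R[i]]_(m, n) =>
        (forall i j, normc (X i j) <= c%:R) /\ minors_le T X)) ->
  forall i0 j0 (a : R[i]) (T : R) (q := (Num.truncn (normc a)).+3), 0 < T ->
  coverable (K + 22)%:R
    ((9 * q%:R ^+ 2) ^+ (m + n) * (C%:R * (4 * T / q%:R ^+ 2) ^+ p * (2 * q)%:R ^+ (2 * e)))
    (fun X : 'M[R[i]]_(m.+1, n.+1) => [/\ normc (X i0 j0 - a) <= 2, 5 <= normc (X i0 j0),
       forall i j, normc (X i j) <= normc (X i0 j0) & minors_le T X]).
Proof.
move=> IH i0 j0 a T q T0.
have q0 : (0 < q)%N by [].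
have q0R : 0 < q%:R :> R by rewrite ltr0n.
have T''0 : 0 < 4 * T / q%:R ^+ 2 by rewrite divr_gt0 ?exprn_gt0 // mulr_gt0.
have [su [su_le suP]] := @net_mx R m 1 q q0.
have [sv [sv_le svP]] := @net_mx R 1 n q q0.
have q20 : (0 < 2 * q)%N by [].
have [sY [sY_le sYP]] := IH _ _ q20 T''0.
pose mk (u : 'M[R[i]]_(m, 1)) (v : 'M[R[i]]_(1, n)) (Y : 'M[R[i]]_(m, n)) : 'M[R[i]]_(m.+1, n.+1) :=
  \matrix_(i, j) match unlift i0 i, unlift j0 j with
    | Some i', Some j' => Y i' j' + a^-1 * (u i' 0 * v 0 j')
    | Some i', None => u i' 0
    | None, Some j' => v 0 j'
    | None, None => a end.
exists [seq mk w.1 w.2 Y | w <- [seq (u, v) | u <- su, v <- sv], Y <- sY]; split.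
  rewrite !size_allpairs natrM [(size su * _)%:R]natrM.
  apply: ler_pM => //; rewrite ?mulr_ge0 ?ler0n //.
  rewrite exprD; apply: ler_pM => //; rewrite ?ler0n //.
    by rewrite muln1 in su_le.
  by rewrite mul1n in sv_le.
move=> X [Xa X5 Xmax minX].
set b := X i0 j0 in Xa X5 Xmax.
(* The choice of [q] gives |b| <= q <= 2|b|: on one side |b| <= |a| + 2, on the other q <= |a| + 3
   <= |b| + 5, with |b| >= 5. *)
have b_le : normc b <= q%:R.
  have /andP[_ h] := truncn_itv (normc_ge0 a).
  have := le_normcD (b - a) a; rewrite subrK => h'.
  by rewrite /q -addn3 natrD; rewrite -addn1 natrD in h; lra.
have q_le : q%:R <= 2 * normc b.
  have := truncn_le (normc a); rewrite normc_ge0 => h.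
  have := le_normcD (a - b) b; rewrite subrK normcB => h'.
  by rewrite /q -addn3 natrD; lra.
have b0 : b != 0 by apply/eqP => b0; move: X5; rewrite b0 normc0; lra.
have [|u su_u uP] := suP (\matrix_(i, j) X (lift i0 i) j0).
  by move=> i j; rewrite mxE; apply: le_trans (Xmax _ _) b_le.
have [|v sv_v vP] := svP (\matrix_(i, j) X i0 (lift j0 j)).
  by move=> i j; rewrite mxE; apply: le_trans (Xmax _ _) b_le.
have nb0 : 0 < normc b by lra.
(* The Schur complement has entries of modulus at most |b| + |b| <= 2q and squared minors at most
   T/|b|^2 <= 4T/q^2. *)
have [|Y sY_Y YP] := sYP (schur i0 j0 X).
  split=> [i j|].
    rewrite mxE -/b; apply: le_trans (le_normcD _ _) _.
    rewrite normcN !normcM normcV natrM mulr2n mulrDl !mul1r; apply: lerD.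
      exact: le_trans (Xmax _ _) b_le.
    rewrite mulrA; apply: le_trans b_le.
    rewrite -[leRHS]mul1r; apply: ler_pM; rewrite ?mulr_ge0 ?invr_ge0 ?normc_ge0 //.
    by rewrite ler_pdivrMl // mulr1.
  move=> k f g f_inj; apply: le_trans (minors_le_schur b0 minX g f_inj) _.
  rewrite -/b ler_pdivrMr ?exprn_gt0 // mulrAC ler_pdivlMr ?exprn_gt0 //.
  rewrite [leRHS](_ : _ = T * (2 * normc b) ^+ 2); last by ring.
  rewrite ler_pM2l //.
  by apply: lerXn2r; rewrite ?nnegrE ?ler0n // mulr_ge0 // normc_ge0.
exists (mk u v Y).
  apply/allpairsP; exists ((u, v), Y); split=> //=.
  by apply/allpairsP; exists (u, v).
have le22 (x : R) : x <= 2 -> x <= (K + 22)%:R.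
  by rewrite natrD => h; have := ler0n R K; lra.
move=> i j; rewrite [mk _ _ _ i j]mxE.
case: (unliftP i0 i) => [i'|] ->; case: (unliftP j0 j) => [j'|] ->.
- have := YP i' j'; rewrite mxE -/b => hY.
  have := uP i' 0; have := vP 0 j'; rewrite !mxE => hv hu.
  have := normc_quot_perturb X5 (Xmax (lift i0 i') j0) (Xmax i0 (lift j0 j')) Xa hu hv.
  set U := X _ j0; set V := X i0 _; set Z := X _ _ => h22.
  rewrite (_ : _ - _ = (Z - b^-1 * (U * V) - Y i' j') +
    (b^-1 * (U * V) - a^-1 * (u i' 0 * v 0 j'))); last by ring.
  by rewrite natrD; apply: le_trans (le_normcD _ _) _; apply: lerD.
- by apply: le22; have := uP i' 0; rewrite mxE.
- by apply: le22; have := vP 0 j'; rewrite mxE.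
- exact: le22.
Qed.

(** For a pivot of size about q the count is q^(2(m+n)) (T/q^2)^p q^(2e) = T^p q^(2(m+n+e-p)). The
    hypothesis makes this exponent of q nonnegative, so q may be replaced by a multiple of c; the
    c^2 possible values of the pivot account for the successor in the new exponent. *)
Lemma low_det_covers_step m n p e : (p <= m + n + e)%N ->
  low_det_covers R m n p e -> low_det_covers R m.+1 n.+1 p (m + n + e - p).+1.
Proof.
move=> p_le [K [C IH]].
set E := (m + n + e - p)%N.
pose B := (9 ^ (m + n) * C * 4 ^ p * 2 ^ (2 * e) * 6 ^ (2 * E))%N.
pose N := (m.+1 * n.+1)%N.
exists (K + 22)%N, (N * 81 * B + 1)%N => c T c0 T0.
have [T1|T1] := ltP T 1.
  (* For T < 1 no matrix qualifies, because of the empty minor. *)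
  exists [::]; split; first by rewrite /= !mulr_ge0 ?ler0n ?exprn_ge0 ?ler0n // ltW.
  by move=> X [_ /minors_le_ge1]; rewrite leNgt T1.
have c1 : 1 <= c%:R :> R by rewrite ler1n.
have [s [s_le sP]] := @net_disc R c c0.
(* Restricting the centres to this disc gives q <= |w| + 3 <= c + 5 <= 6c, the source of the factor
   6 in [B]. *)
pose s' := [seq w <- s | normc w <= c%:R + 2].
pose beta : R := B%:R * T ^+ p * c%:R ^+ (2 * E).
pose l := [seq (ij, w) | ij <- enum {: 'I_m.+1 * 'I_n.+1}, w <- s'].
have := @coverable_bigcup R m.+1 n.+1 _ l (fun x X =>
   [/\ normc (X x.1.1 x.1.2 - x.2) <= 2, 5 <= normc (X x.1.1 x.1.2),
       forall i j, normc (X i j) <= normc (X x.1.1 x.1.2) & minors_le T X])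
   (K + 22)%:R beta.
case=> [[[i0 j0] a] /= al|S [S_le SP]].
  pose q := (Num.truncn (normc a)).+3.
  apply: (coverableW (lexx _) _ _ (pivot_cover IH i0 j0 a T0)) => //.
  rewrite -/q.
  have a_le : normc a <= c%:R + 2.
    case/allpairsP: al => -[ij w] /= [_ ws' /(congr1 snd) /= ->].
    by move: ws'; rewrite mem_filter => /andP[].
  have q_le : q%:R <= 6 * c%:R :> R.
    have := truncn_le (normc a); rewrite normc_ge0 => h.
    by rewrite /q -addn3 natrD; lra.
  have q0 : 0 < q%:R :> R by rewrite ltr0n.
  rewrite (_ : _ * _ = (9 ^ (m + n) * C * 4 ^ p * 2 ^ (2 * e))%:R * T ^+ p * q%:R ^+ (2 * E)).
    have -> : beta = (9 ^ (m + n) * C * 4 ^ p * 2 ^ (2 * e))%:R * 6 ^+ (2 * E) *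
        T ^+ p * c%:R ^+ (2 * E) by rewrite /beta /B natrM natrX.
    rewrite -!mulrA; apply: ler_wpM2l; first exact: ler0n.
    rewrite mulrCA; apply: ler_wpM2l; first by rewrite exprn_ge0 // ltW.
    rewrite -exprMn; apply: lerXn2r => //; rewrite nnegrE ?ler0n // mulr_ge0 ?ler0n //.
  rewrite !natrM !natrX !exprMn exprVn -!exprM.
  have -> : q%:R ^+ (m + n) * q%:R ^+ (m + n) = q%:R ^+ (2 * E) * q%:R ^+ (2 * p) / q%:R ^+ (2 * e) :> R.
    apply: (canRL (mulfK _)); first by rewrite expf_neq0 // gt_eqF.
    by rewrite -!exprD; congr (_ ^+ _); rewrite /E; lia.
  field; rewrite !expf_neq0 // gt_eqF //.
(* The zero matrix takes care of matrices with all entries below 5, too small for a pivot. *)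
exists (0 :: S); split.
  rewrite /= -addn1 natrD [(_ * B + 1)%:R]natrD -mulrA [leRHS]mulrDl mulrA.
  apply: lerD; last first.
    rewrite mul1r -[leLHS]mulr1; apply: ler_pM => //; exact: exprn_ege1.
  apply: le_trans S_le _.
  rewrite size_allpairs -cardE card_prod !card_ord -/N natrM.
  have s'_le : (size s')%:R <= 9 * c%:R ^+ 2 :> R.
    by apply: le_trans s_le; rewrite ler_nat size_filter count_size.
  apply: (@le_trans _ _ (N%:R * (9 * c%:R ^+ 2) * beta)).
    rewrite ler_wpM2r ?ler_wpM2l //.
    by rewrite /beta !mulr_ge0 ?exprn_ge0 // ltW.
  rewrite /beta [(2 * E.+1)%N]mulnS exprD [(_ * B)%:R]natrM [(N * 81)%:R]natrM.
  set x := T ^+ p; set y := c%:R ^+ (2 * E); set z := c%:R ^+ 2.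
  have x0 : 0 <= x by rewrite exprn_ge0 // ltW.
  have y0 : 0 <= y by rewrite exprn_ge0.
  have z0 : 0 <= z by rewrite exprn_ge0.
  rewrite [leLHS](_ : _ = N%:R * 9 * (B%:R * x * (z * y))); last by ring.
  rewrite [leRHS](_ : _ = N%:R * 81%:R * (B%:R * x * (z * y))); last by ring.
  apply: ler_wpM2r; first by rewrite !mulr_ge0.
  by apply: ler_wpM2l; rewrite ?ler_nat.
move=> X [X_le minX].
have [[i0 j0] /= Xmax] := exists_max_entry X.
have [X5|X5] := leP 5 (normc (X i0 j0)); last first.
  exists 0; first exact: mem_head.
  move=> i j; rewrite mxE subr0; apply: le_trans (Xmax i j) _.
  by rewrite natrD; have := ler0n R K; lra.
have [w ws wP] := sP _ (X_le i0 j0).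
have [|Y YS YP] := SP X; last by exists Y; rewrite // inE YS orbT.
exists ((i0, j0), w) => //.
apply/allpairsP; exists ((i0, j0), w); split; rewrite ?mem_enum //=.
rewrite mem_filter ws andbT.
have := le_normcD (w - X i0 j0) (X i0 j0); rewrite subrK normcB => h.
by have := X_le i0 j0; lra.
Qed.

(* The entries are themselves minors, so [c] may be replaced by about [sqrt T]. *)
Lemma low_det_covers_trade m n p e :
  low_det_covers R m n p e -> low_det_covers R m n (p + e) 0.
Proof.
move=> [K [C IH]]; exists K, (C * 4 ^ e)%N => c T c0 T0.
have [T1|T1] := ltP T 1.
  exists [::]; split; first by rewrite /= !mulr_ge0 ?ler0n ?exprn_ge0 ?ler0n // ltW.
  by move=> X [_ /minors_le_ge1]; rewrite leNgt T1.
pose c' := (Num.truncn (Num.sqrt T)).+1.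
have /andP[h1 h2] := truncn_itv (sqrtr_ge0 T); rewrite -/c' in h2.
have sT1 : 1 <= Num.sqrt T by rewrite -[leLHS]sqrtr1 ler_sqrt // ltW.
have c'_le : c'%:R ^+ 2 <= 4 * T.
  rewrite [leRHS](_ : _ = (2 * Num.sqrt T) ^+ 2); last first.
    by rewrite exprMn sqr_sqrtr ?ltW //; ring.
  apply: lerXn2r; rewrite ?nnegrE ?ler0n ?mulr_ge0 ?sqrtr_ge0 //.
  by rewrite /c' -addn1 natrD; lra.
have c'0 : (0 < c')%N by [].
apply: (coverableW (lexx _) _ _ (IH c' T c'0 T0)).
  rewrite muln0 expr0 mulr1 natrM natrX exprD exprM.
  rewrite [leRHS](_ : _ = C%:R * T ^+ p * (4 * T) ^+ e); last by rewrite exprMn; ring.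
  apply: ler_wpM2l; first by rewrite mulr_ge0 ?exprn_ge0 // ltW.
  by apply: lerXn2r; rewrite ?nnegrE ?exprn_ge0 // mulr_ge0 // ltW.
move=> X [X_le minX]; split=> // i j.
apply: le_trans (ltW h2).
rewrite -[leLHS]ger0_norm ?normc_ge0 // -sqrtr_sqr ler_sqrt ?sqr_ge0 ?(ltW T0) //.
exact: minors_le_entry.
Qed.

Lemma low_det_covers0 m n : minn m n = 0 -> low_det_covers R m n 0 0.
Proof.
move=> mn0; exists 0, 1 => c T _ T0; exists [:: 0]; split.
  by rewrite !expr0 !mulr1.
move=> X _; exists 0; first by rewrite mem_head.
move=> i j; have := ltn_ord i; have := ltn_ord j; lia.
Qed.

(** [j] counts the pivots allowed the whole range of c; what remains after them is controlled by T
    alone. For [j = 0] each step keeps p = m+n-1 and yields e = 2, which the trade adds to p. For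
    larger [j] the step keeps p and raises e from j(j+1) to (j+1)(j+2), since m+n-p = 2j+1. *)
Lemma low_det_covers_rank m n j : (j < minn m n)%N ->
  low_det_covers R m n (m + n - 2 * j - 1) (j * j.+1).
Proof.
have cast m' n' p p' e e' : low_det_covers R m' n' p e -> p = p' -> e = e' ->
  low_det_covers R m' n' p' e' by move=> h <- <-.
elim: j m n => [|j IHj] [|m] [|n] //; rewrite ?minn0 ?min0n // => jmn.
  rewrite mul0n muln0 subn0; elim: m n {jmn} => [|m IHm] n.
    by apply: (cast _ _ _ _ _ _ (low_det_covers_trade
      (low_det_covers_step (leq0n _) (low_det_covers0 (min0n n))))); lia.
  case: n => [|n].
    by apply: (cast _ _ _ _ _ _ (low_det_covers_trade
      (low_det_covers_step (leq0n _) (low_det_covers0 (minn0 m.+1))))); lia.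
  have le : (m.+1 + n.+1 - 1 <= m.+1 + n.+1 + 0)%N by lia.
  by apply: (cast _ _ _ _ _ _ (low_det_covers_trade (low_det_covers_step le (IHm n)))); lia.
have jmn' : (j < minn m n)%N by move: jmn; rewrite minnSS.
have le : (m + n - 2 * j - 1 <= m + n + j * j.+1)%N by lia.
have le2 : (2 * j + 2 <= m + n)%N by lia.
by apply: (cast _ _ _ _ _ _ (low_det_covers_step le (IHj _ _ jmn'))); nia.
Qed.

End CoveringRecursion.

(** * Packing matrices with small Gram determinant *)

Section Packing.
Variable R : realType.
Implicit Types (m n k : nat).

(* A bounded unimodular row operation [L] makes the rows of [X] of size [y i], whence
   [D(X) = O(W^2)]; see [reducible_gram_det]. *)
Definition reducible m n (C W : R) (X : 'M[R[i]]_(m, n)) : Prop :=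
  exists (L : 'M[R[i]]_m) (y : 'I_m -> R),
    [/\ \det L = 1, forall i, 1 <= y i, \prod_i y i <= W,
        forall i j, normc (L i j) <= C & forall i j, normc ((L *m X) i j) <= C * y i].

Lemma normc_sum (I : Type) (r : seq I) (P : pred I) (F : I -> R[i]) :
  normc (\sum_(i <- r | P i) F i) <= \sum_(i <- r | P i) normc (F i).
Proof.
elim/big_ind2: _ => [|x1 x2 y1 y2 h1 h2|//]; first by rewrite normc0.
by apply: le_trans (le_normcD _ _) _; apply: lerD.
Qed.

Lemma normc_prod (I : Type) (r : seq I) (P : pred I) (F : I -> R[i]) :
  normc (\prod_(i <- r | P i) F i) = \prod_(i <- r | P i) normc (F i).
Proof. by elim/big_rec2: _ => [|i x y _ <-]; rewrite ?normc1 ?normcM. Qed.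

Lemma normc_conj (z : R[i]) : normc (conjc z) = normc z.
Proof. by case: z => a b /=; rewrite sqrrN. Qed.

(** Each of the m! Leibniz terms is at most the product of the y_i y_(s i), which is the square of
    the product of the y_i. *)
Lemma normc_det_le m (y : 'I_m -> R) (A : 'M[R[i]]_m) :
  (forall i j, normc (A i j) <= y i * y j) -> normc (\det A) <= m`!%:R * (\prod_i y i) ^+ 2.
Proof.
move=> A_le; apply: le_trans (normc_sum _ _ _) _.
rewrite mulr_natl -[in leRHS](card_Sn m) -sumr_const; apply: ler_sum => s _.
rewrite normcM normc_prod.
have -> : normc ((-1) ^+ s : R[i]) = 1.
  by case: (odd_perm s); rewrite ?expr1 ?normcN normc1.
rewrite mul1r expr2 [X in _ * X](reindex_inj (@perm_inj _ s)) -big_split /=.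
by apply: ler_prod => i _; rewrite normc_ge0 A_le.
Qed.

Lemma Re_normc_le (z : R[i]) : complex.Re z <= normc z.
Proof. exact: le_trans (ler_norm _) (Re_le_normc z). Qed.

(** Conjugating by [L] does not change the determinant and turns I + X X^H into L L^H + (LX)(LX)^H.
    Its entries are O(y_i y_j), where 1 <= y_i absorbs the first term. *)
Lemma reducible_gram_det m n (C W : R) (X : 'M[R[i]]_(m, n)) : 0 <= C ->
  reducible C W X ->
  gram_det X <= m`!%:R * (((m + n)%:R * C ^+ 2) ^+ m * W ^+ 2).
Proof.
move=> C0 [L [y [detL y1 prod_y L_le LX_le]]].
have y0 i : 0 <= y i by apply: le_trans (y1 i).
pose A := L *m (1%:M + X *m map_mx conjc X^T) *m map_mx conjc L^T.
have detA : \det A = \det (1%:M + X *m map_mx conjc X^T).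
  by rewrite !det_mulmx det_map_mx det_tr detL rmorph1 mulr1 mul1r.
have AE : A = L *m map_mx conjc L^T + (L *m X) *m map_mx conjc (L *m X)^T.
  by rewrite /A mulmxDr mulmx1 mulmxDl trmx_mul map_mxM /= !mulmxA.
rewrite /gram_det -detA; apply: le_trans (Re_normc_le _) _.
pose c := Num.sqrt ((m + n)%:R * C ^+ 2).
have c2 : c * c = (m + n)%:R * C ^+ 2 by rewrite -expr2 sqr_sqrtr // mulr_ge0 // sqr_ge0.
have c0 : 0 <= c by rewrite sqrtr_ge0.
apply: le_trans (@normc_det_le m (fun i => c * y i) A _) _; last first.
  apply: ler_wpM2l => //.
  rewrite big_split /= prodr_const card_ord exprMn -exprM mulnC exprM [c ^+ 2]c2.
  apply: ler_wpM2l; first by rewrite exprn_ge0 // mulr_ge0 // sqr_ge0.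
  by apply: lerXn2r => //; rewrite nnegrE ?(le_trans _ prod_y) // prodr_ge0.
move=> i j; rewrite mulrACA c2 AE mxE; apply: le_trans (le_normcD _ _) _.
rewrite natrD !mulrDl; apply: lerD.
  rewrite mxE; apply: le_trans (normc_sum _ _ _) _.
  apply: (@le_trans _ _ (\sum_(k < m) C ^+ 2)).
    apply: ler_sum => k _; rewrite !mxE normcM normc_conj expr2.
    by apply: ler_pM; rewrite ?normc_ge0.
  rewrite sumr_const card_ord -[C ^+ 2 *+ m]mulr_natl -[leLHS]mulr1; apply: ler_wpM2l.
    by rewrite mulr_ge0 // sqr_ge0.
  by rewrite -[1]mulr1; apply: ler_pM.
rewrite mxE; apply: le_trans (normc_sum _ _ _) _.
apply: (@le_trans _ _ (\sum_(k < n) C ^+ 2 * (y i * y j))).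
  apply: ler_sum => k _; rewrite [map_mx _ _ _ _]mxE [trmx _ _ _]mxE normcM normc_conj.
  by rewrite expr2 mulrACA; apply: ler_pM; rewrite ?normc_ge0.
by rewrite sumr_const card_ord -[_ *+ n]mulr_natl mulrA.
Qed.

Definition gauss_int (z : R[i]) : bool :=
  (complex.Re z \is a Num.int) && (complex.Im z \is a Num.int).

Lemma gauss_intD x y : gauss_int x -> gauss_int y -> gauss_int (x + y).
Proof.
by case: x => a b; case: y => c d /andP[/= a1 b1] /andP[/= c1 d1]; rewrite /gauss_int /= !rpredD.
Qed.

Lemma gauss_int0 : gauss_int 0.
Proof. by rewrite /gauss_int /= rpred0. Qed.

Definition gauss_floor (z : R[i]) : R[i] :=
  Complex (Num.floor (complex.Re z))%:~R (Num.floor (complex.Im z))%:~R.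

Lemma gauss_floor_int z : gauss_int (gauss_floor z).
Proof. by rewrite /gauss_int /= !intr_int. Qed.

Lemma gauss_floor_near z : normc (z - gauss_floor z) <= 2.
Proof.
apply: le_trans (normc_le_ReIm _) _; case: z => a b /=.
have /andP[a1 a2] := floor_itv a; have /andP[b1 b2] := floor_itv b.
rewrite intrD in a2; rewrite intrD in b2.
by rewrite ger0_norm ?ger0_norm; lra.
Qed.

Definition int_grid m n (p : nat) : seq 'M[R[i]]_(m, n) :=
  [seq (\matrix_(i, j) Complex (f (i, j)).1%:R (f (i, j)).2%:R) |
     f : {ffun 'I_m * 'I_n -> 'I_p * 'I_p}].

Lemma size_int_grid m n p : size (int_grid m n p) = ((p * p) ^ (m * n))%N.
Proof. by rewrite size_map -cardE card_ffun !card_prod !card_ord. Qed.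

Lemma int_grid_uniq m n p : uniq (int_grid m n p).
Proof.
rewrite map_inj_uniq ?enum_uniq // => f g /matrixP fg; apply/ffunP => -[i j].
have := fg i j; rewrite !mxE => -[/eqP + /eqP]; rewrite !eqr_nat.
by case: (f _) (g _) => a b [c d] /= /eqP/val_inj -> /eqP/val_inj ->.
Qed.

Lemma int_gridP m n p (U : 'M[R[i]]_(m, n)) i j : U \in int_grid m n p ->
  gauss_int (U i j) /\ normc (U i j) <= 2 * p%:R.
Proof.
case/mapP => f _ ->; rewrite mxE; split.
  by rewrite /gauss_int /= !natr_int.
apply: le_trans (normc_le_ReIm _) _ => /=; rewrite !ger0_norm ?ler0n //.
by rewrite mulr2n mulrDl mul1r lerD // ler_nat ltnW.
Qed.

(** Gaussian integer centres make the unit cells at distinct centres disjoint. The bound [B] later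
    keeps the cells in a region where the density of [H] is bounded below. *)
Definition has_packing m n (K C B W : R) (cnt : nat) : Prop :=
  exists s : seq 'M[R[i]]_(m, n),
    [/\ uniq s, size s = cnt,
        forall Y, Y \in s -> forall i j, gauss_int (Y i j) /\ normc (Y i j) <= B
      & forall Y, Y \in s -> forall X : 'M[R[i]]_(m, n), (forall i j, normc (X i j - Y i j) <= K) ->
          reducible C W X].

Lemma has_packing0 m n (K : R) : 0 <= K -> has_packing m n K (1 + K) 0 1 1.
Proof.
move=> K0; exists [:: 0]; split=> //.
  by move=> Y; rewrite inE => /eqP -> i j; rewrite mxE gauss_int0 normc0.
move=> Y; rewrite inE => /eqP -> X X_le; exists 1%:M, (fun=> 1); split.
- by rewrite det1.
- by [].
- by rewrite prodr_const expr1n.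
- by move=> i j; rewrite mxE; case: eqP => _; rewrite ?normc1 ?normc0; lra.
- by move=> i j; rewrite mul1mx; have := X_le i j; rewrite mxE subr0; lra.
Qed.

Lemma block_mx_first m n (Z : 'M[R[i]]_(1 + m, 1 + n)) :
  Z = block_mx (Z ord0 ord0)%:M (\row_j Z ord0 (lift ord0 j))
        (\col_i Z (lift ord0 i) ord0) (\matrix_(i, j) Z (lift ord0 i) (lift ord0 j)).
Proof.
rewrite -[LHS]submxK; congr block_mx; apply/matrixP => i j; rewrite !mxE ?ord1 ?eqxx ?mulr1n;
  by congr (Z _ _); exact: val_inj.
Qed.

(** The telescoping of [normc_quot_perturb] with the size of the pivot replaced by its lower bound
    [p]; the terms are K(2+K), 2K and 4K. *)
Lemma normc_quot_perturb_le (a u v a' u' v' : R[i]) (p K : R) :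
  0 < p -> p <= normc a -> p <= normc a' ->
  normc v <= (2 + K) * p -> normc u' <= 2 * p -> normc v' <= 2 * p ->
  normc (a - a') <= K -> normc (u - u') <= K -> normc (v - v') <= K ->
  normc (a'^-1 * (u' * v') - a^-1 * (u * v)) <= K ^+ 2 + 8 * K.
Proof.
move=> p0 pa pa' v_le u'_le v'_le aa' uu' vv'.
have K0 : 0 <= K := le_trans (normc_ge0 _) aa'.
have a0 : a != 0 by apply/eqP => a0; move: pa; rewrite a0 normc0; lra.
have a'0 : a' != 0 by apply/eqP => a'0; move: pa'; rewrite a'0 normc0; lra.
rewrite normcB.
have -> : a^-1 * (u * v) - a'^-1 * (u' * v') =
    a^-1 * ((u - u') * v) + (a^-1 * (u' * (v - v')) + a^-1 * a'^-1 * (u' * v') * (a' - a)).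
  by field; rewrite a0 a'0.
have ia : normc a^-1 <= p^-1 by rewrite normcV lef_pV2 ?posrE //; apply: lt_le_trans pa.
have ia' : normc a'^-1 <= p^-1 by rewrite normcV lef_pV2 ?posrE //; apply: lt_le_trans pa'.
have n0 z := normc_ge0 z.
have pV : p^-1 * p = 1 by rewrite mulVf // gt_eqF.
apply: le_trans (le_normcD _ _) _.
rewrite (_ : K ^+ 2 + 8 * K = K * (2 + K) + (2 * K + 4 * K)); last by ring.
apply: lerD.
  rewrite !normcM; apply: (@le_trans _ _ (p^-1 * (K * ((2 + K) * p)))).
    by apply: ler_pM; rewrite ?mulr_ge0 ?n0 //; apply: ler_pM; rewrite ?n0.
  rewrite [leLHS](_ : _ = (p^-1 * p) * (K * (2 + K))); last by ring.
  by rewrite pV mul1r.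
apply: le_trans (le_normcD _ _) _; apply: lerD.
  rewrite !normcM; apply: (@le_trans _ _ (p^-1 * ((2 * p) * K))).
    by apply: ler_pM; rewrite ?mulr_ge0 ?n0 //; apply: ler_pM; rewrite ?n0.
  rewrite [leLHS](_ : _ = (p^-1 * p) * (2 * K)); last by ring.
  by rewrite pV mul1r.
rewrite !normcM; apply: (@le_trans _ _ ((p^-1 * p^-1) * ((2 * p) * (2 * p)) * K)).
  apply: ler_pM; rewrite ?mulr_ge0 ?n0 // 1?normcB //.
  by apply: ler_pM; rewrite ?mulr_ge0 ?n0 //; apply: ler_pM; rewrite ?n0.
rewrite [leLHS](_ : _ = (p^-1 * p) ^+ 2 * (4 * K)); last by ring.
  by rewrite pV expr1n mul1r.
Qed.

(* [(a, v; u, B)] is built from the Schur complement [Y] with [B] the integer part of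
   [Y + u v / a]; here [a, u, v] have size at most about [p] and [a] at least [p]. *)
Lemma has_packing_step m n (K C B W : R) (k cnt p : nat) :
  K = k%:R -> 0 <= C -> 0 <= B -> (0 < p)%N ->
  has_packing m n (K ^+ 2 + 9 * K + 2) C B W cnt ->
  has_packing m.+1 n.+1 K (C * (1 + m%:R * (2 + K)) + 2 * K + 3)
    (B + (K + 6) * p%:R) (p%:R * W) ((p * p) ^ (m + n + 1) * cnt).
Proof.
move=> Kk C0 B0 p0 [s [s_uniq s_size s_int sP]].
have K0 : 0 <= K by rewrite Kk.
have p1 : 1 <= p%:R :> R by rewrite ler1n.
(* With this shift every pivot has real part at least (K+1)p, so a pivot moved by K still has
   modulus at least p. An integer K keeps the pivots Gaussian integers. *)
pose a0 : 'M[R[i]]_1 := (Complex (k.+1 * p)%:R 0)%:M.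
pose pivots : seq 'M[R[i]]_1 := [seq a0 + a | a <- int_grid 1 1 p].
pose mk (x : 'M[R[i]]_1 * 'M[R[i]]_(m, 1) * 'M[R[i]]_(1, n) * 'M[R[i]]_(m, n)) :
    'M[R[i]]_(1 + m, 1 + n) :=
  block_mx x.1.1.1 x.1.2 x.1.1.2
    (x.2 + map_mx gauss_floor ((x.1.1.1 0 0)^-1 *: (x.1.1.2 *m x.1.2))).
pose l : seq ('M[R[i]]_1 * 'M[R[i]]_(m, 1) * 'M[R[i]]_(1, n) * 'M[R[i]]_(m, n)) :=
  [seq (x, Y) | x <- [seq (x, v) | x <- [seq (a, u) | a <- pivots, u <- int_grid m 1 p],
                                   v <- int_grid 1 n p], Y <- s].
have lP x : x \in l -> [/\ exists2 a, x.1.1.1 = a0 + a & a \in int_grid 1 1 p,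
    x.1.1.2 \in int_grid m 1 p, x.1.2 \in int_grid 1 n p & x.2 \in s].
  case/allpairsP => -[x1 Y] /= [+ Ys ->] /=.
  case/allpairsP => -[x2 v] /= [+ vg ->] /=.
  case/allpairsP => -[a' u] /= [/mapP[a ag ->] ug ->] /=.
  by split => //; exists a.
have a0E : a0 0 0 = Complex ((k.+1 * p)%:R) 0 by rewrite mxE eqxx.
have pivot_le x : x \in l ->
    [/\ gauss_int (x.1.1.1 0 0), normc (x.1.1.1 0 0) <= (K + 3) * p%:R
      & (K + 1) * p%:R <= complex.Re (x.1.1.1 0 0)].
  case/lP => -[a -> ag] _ _ _; rewrite mxE a0E.
  have [a_int a_le] := int_gridP 0 0 ag.
  have Ra0 : 0 <= complex.Re (a 0 0) by case/mapP: ag => f _ ->; rewrite mxE /=.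
  split.
  - by apply: gauss_intD => //; rewrite /gauss_int /= natr_int rpred0.
  - apply: le_trans (le_normcD _ _) _.
    rewrite [normc (Complex _ _)]/= expr0n addr0 sqrtr_sqr ger0_norm ?ler0n //.
    by rewrite natrM -addn1 natrD -Kk; lra.
  - case: (a 0 0) Ra0 {a_le a_int} => ra ia /= Ra0.
    by rewrite natrM -addn1 natrD -Kk; lra.
have quot_le x i j : x \in l ->
    normc ((x.1.1.1 0 0)^-1 * (x.1.1.2 i 0 * x.1.2 0 j)) <= 4 * p%:R.
  move=> xl; have [_ _ /(le_trans) a_ge] := pivot_le _ xl.
  have {}a_ge := a_ge _ (Re_normc_le _).
  have [_ /int_gridP - /(_ i 0)[_ u_le] /int_gridP - /(_ 0 j)[_ v_le] _] := lP _ xl.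
  have nz : 0 < normc (x.1.1.1 0 0) by apply: lt_le_trans a_ge; nra.
  rewrite !normcM normcV ler_pdivrMl //.
  have : normc (x.1.1.2 i 0) * normc (x.1.2 0 j) <= (2 * p%:R) * (2 * p%:R).
    by apply: ler_pM; rewrite ?normc_ge0.
  nra.
have mk00 x : mk x ord0 ord0 = x.1.1.1 0 0.
  by rewrite /mk (ord0_lshift m) (ord0_lshift n) (@block_mxEul R[i] 1 m 1 n).
have mk0S x j : mk x ord0 (lift ord0 j) = x.1.2 0 j.
  by rewrite /mk (ord0_lshift m) (lift0_rshift j) (@block_mxEur R[i] 1 m 1 n).
have mkS0 x i : mk x (lift ord0 i) ord0 = x.1.1.2 i 0.
  by rewrite /mk (lift0_rshift i) (ord0_lshift n) (@block_mxEdl R[i] 1 m 1 n).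
have mkSS x i j : mk x (lift ord0 i) (lift ord0 j) =
    x.2 i j + gauss_floor ((x.1.1.1 0 0)^-1 * (x.1.1.2 i 0 * x.1.2 0 j)).
  rewrite /mk (lift0_rshift i) (lift0_rshift j) (@block_mxEdr R[i] 1 m 1 n).
  by rewrite [fun_of_matrix (_ + _) _ _]mxE [map_mx _ _ _ _]mxE !mxE big_ord1.
exists (map mk l); split.
- rewrite map_inj_in_uniq.
    rewrite !allpairs_uniq ?int_grid_uniq //; try by move=> [a b] [c d] _ _ /= [-> ->].
    by rewrite map_inj_uniq ?int_grid_uniq //; exact: addrI.
  move=> [[[a u] v] Y] [[[a' u'] v'] Y'] _ _.
  by rewrite /mk /= => /(@eq_block_mx R[i] 1 m 1 n _ _ _ _ _ _ _ _)[-> -> -> /addIr ->].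
- rewrite size_map !size_allpairs size_map !size_int_grid s_size.
  by rewrite !muln1 !mul1n !expnD expn1; ring.
- move=> _ /mapP[x xl ->] i j.
  have [/= _ ug vg Ys] := lP _ xl; have [/= a_int a_le a_ge] := pivot_le _ xl.
  have BK : 2 * p%:R <= B + (K + 6) * p%:R by nra.
  case: (unliftP ord0 i) => [i'|] ->; case: (unliftP ord0 j) => [j'|] ->;
    rewrite ?mk00 ?mk0S ?mkS0 ?mkSS.
  + set z := _ * (_ * _).
    have [Y_int Y_le] := s_int _ Ys i' j'.
    split; first by rewrite gauss_intD // gauss_floor_int.
    apply: le_trans (le_normcD _ _) _; apply: lerD => //.
    have z_le : normc z <= 4 * p%:R by exact: quot_le xl.
    have := gauss_floor_near z.
    have := le_normcD (gauss_floor z - z) z; rewrite subrK normcB => h1 h2.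
    nra.
  + have [? h] := int_gridP i' 0 ug.
    by split=> //; apply: le_trans h _.
  + have [? h] := int_gridP 0 j' vg.
    by split=> //; apply: le_trans h _.
  + split=> //; nra.
- move=> _ /mapP[x xl ->] X X_near.
  have [/= _ ug vg Ys] := lP _ xl; have [/= _ a_le a_ge] := pivot_le _ xl.
  set a' := x.1.1.1 0 0 in a_le a_ge.
  pose a := X ord0 ord0.
  have aa' : normc (a - a') <= K by have := X_near ord0 ord0; rewrite mk00.
  have uu' i : normc (X (lift ord0 i) ord0 - x.1.1.2 i 0) <= K.
    by have := X_near (lift ord0 i) ord0; rewrite mkS0.
  have vv' j : normc (X ord0 (lift ord0 j) - x.1.2 0 j) <= K.
    by have := X_near ord0 (lift ord0 j); rewrite mk0S.
  have BB' i j : normc (X (lift ord0 i) (lift ord0 j) -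
      (x.2 i j + gauss_floor (a'^-1 * (x.1.1.2 i 0 * x.1.2 0 j)))) <= K.
    by have := X_near (lift ord0 i) (lift ord0 j); rewrite mkSS.
  have pR : 0 < p%:R :> R by lra.
  have a'_ge : p%:R <= normc a'.
    by apply: le_trans (Re_normc_le a'); apply: le_trans a_ge; nra.
  have a_geN : p%:R <= normc a.
    have := le_normcD (a' - a) a; rewrite subrK normcB => h.
    have h2 : K * p%:R + p%:R <= normc a' by have := Re_normc_le a'; lra.
    have : K <= K * p%:R by nra.
    lra.
  have Kp : K <= K * p%:R by nra.
  have u_le i : normc (X (lift ord0 i) ord0) <= (2 + K) * p%:R.
    have [_ h] := int_gridP i 0 ug.
    have := le_normcD (X (lift ord0 i) ord0 - x.1.1.2 i 0) (x.1.1.2 i 0).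
    by rewrite subrK; have := uu' i; lra.
  have v_le j : normc (X ord0 (lift ord0 j)) <= (2 + K) * p%:R.
    have [_ h] := int_gridP 0 j vg.
    have := le_normcD (X ord0 (lift ord0 j) - x.1.2 0 j) (x.1.2 0 j).
    by rewrite subrK; have := vv' j; lra.
  have [|L [y [detL y1 y_prod L_le LX_le]]] := sP _ Ys (schur ord0 ord0 X).
    move=> i j; rewrite mxE -/a; set z := a^-1 * _.
    pose z' := a'^-1 * (x.1.1.2 i 0 * x.1.2 0 j).
    (* The radius K^2 + 9K + 2 consists of K for the entry of [X], 2 for the integer part and K^2 +
       8K for the quotient. *)
    rewrite (_ : _ - _ = (X (lift ord0 i) (lift ord0 j) - (x.2 i j + gauss_floor z')) +
      ((gauss_floor z' - z') + (z' - z))); last by ring.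
    apply: le_trans (le_normcD _ _) _.
    rewrite (_ : K ^+ 2 + _ + _ = K + (2 + (K ^+ 2 + 8 * K))); last by ring.
    apply: lerD; first exact: BB'.
    apply: le_trans (le_normcD _ _) _; apply: lerD.
      by rewrite normcB gauss_floor_near.
    have [_ hu] := int_gridP i 0 ug; have [_ hv] := int_gridP 0 j vg.
    exact: (normc_quot_perturb_le pR).
  have na : a != 0 by apply/eqP => a0'; move: a_geN; rewrite a0' normc0; lra.
  pose u : 'M[R[i]]_(m, 1) := \col_i X (lift ord0 i) ord0.
  pose v : 'M[R[i]]_(1, n) := \row_j X ord0 (lift ord0 j).
  pose D : 'M[R[i]]_(m, n) := \matrix_(i, j) X (lift ord0 i) (lift ord0 j).
  have XE := block_mx_first X; rewrite -/a -/u -/v -/D in XE.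
  have schurE : schur ord0 ord0 X = D - a^-1 *: (u *m v).
    by apply/matrixP => i j; rewrite !mxE big_ord1 !mxE.
  (* [L1] clears the first column below the pivot and applies [L] to the Schur complement. The new
     first row has size O(p), which multiplies [W] by p. *)
  pose L1 : 'M[R[i]]_(1 + m) := block_mx 1%:M 0 (- (a^-1 *: (L *m u))) L.
  have L1X : L1 *m X = block_mx a%:M v 0 (L *m schur ord0 ord0 X).
    rewrite schurE {1}XE (@mulmx_block R[i] 1 m 1 m 1 n) !mul1mx !mul0mx !addr0 mulNmx -scalemxAl.
    rewrite mul_mx_scalar scalerA mulVf // scale1r addNr mulmxBr.
    by rewrite mulNmx -scalemxAr -!scalemxAl mulmxA addrC.
  set Z := L *m schur ord0 ord0 X in LX_le L1X.
  have Cm0 : 0 <= C * (m%:R * (2 + K)) by rewrite !mulr_ge0 //; lra.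
  rewrite mulrDr mulr1; exists L1, (fun i => if unlift ord0 i is Some i' then y i' else p%:R); split.
  + by rewrite (@det_lblock R[i] 1 m) det1 mul1r.
  + by move=> i; case: unliftP => [i'|] _.
  + rewrite big_ord_recl unlift_none; apply: ler_wpM2l => //.
    by under eq_bigr do rewrite liftK.
  + move=> i j; case: (unliftP ord0 i) => [i'|] ->; case: (unliftP ord0 j) => [j'|] ->;
      rewrite ?(lift0_rshift i') ?(lift0_rshift j') ?(ord0_lshift m).
    * by rewrite /L1 (@block_mxEdr R[i] 1 m 1 m); apply: le_trans (L_le _ _) _; lra.
    * rewrite /L1 (@block_mxEdl R[i] 1 m 1 m) !mxE normcN normcM normcV.
      rewrite ler_pdivrMl; last by apply: lt_le_trans a_geN.
      apply: le_trans (normc_sum _ _ _) _.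
      apply: (@le_trans _ _ (\sum_(l < m) C * ((2 + K) * p%:R))).
        apply: ler_sum => o _; rewrite normcM mxE.
        by apply: ler_pM; rewrite ?normc_ge0 //; exact: u_le.
      rewrite sumr_const card_ord -[_ *+ m]mulr_natl.
      apply: (@le_trans _ _ (p%:R * (C * (m%:R * (2 + K))))).
        by rewrite le_eqVlt; apply/orP; left; apply/eqP; ring.
      by apply: ler_pM => //; lra.
    * rewrite /L1 (@block_mxEur R[i] 1 m 1 m) mxE normc0.
      by lra.
    * rewrite /L1 (@block_mxEul R[i] 1 m 1 m) mxE eqxx normc1.
      by lra.
  + move=> i j; rewrite L1X.
    case: (unliftP ord0 i) => [i'|] ->; case: (unliftP ord0 j) => [j'|] ->;
      rewrite ?liftK ?unlift_none ?(lift0_rshift i') ?(lift0_rshift j') ?(ord0_lshift n) ?(ord0_lshift m).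
    * rewrite (@block_mxEdr R[i] 1 m 1 n); apply: le_trans (LX_le _ _) _.
      by have := y1 i'; nra.
    * rewrite (@block_mxEdl R[i] 1 m 1 n) mxE normc0.
      by have := y1 i'; nra.
    * rewrite (@block_mxEur R[i] 1 m 1 n) mxE; apply: le_trans (v_le _) _; nra.
    * rewrite (@block_mxEul R[i] 1 m 1 n) mxE eqxx mulr1n.
      have := le_normcD (a - a') a'; rewrite subrK => h; nra.
Qed.

(** There are [j] pivots at scale N, then one at scale q, then a zero Schur complement. The pivot
    row and column of an m x n matrix have m+n-1 entries; over the first [j] stages this adds up to
    j(m+n-j), and the next stage has m+n-2j-1. The radius [k] varies in the induction because each
    Schur complement must tolerate a larger one. *)
Lemma packing m n (k j : nat) : (j < minn m n)%N ->
  exists C B : R, [/\ 0 <= C, 0 <= B & forall N q : nat, (0 < q)%N -> (q <= N)%N ->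
    has_packing m n k%:R C (B * N%:R) (N%:R ^+ j * q%:R)
      (N ^ (2 * (j * (m + n - j))) * q ^ (2 * (m + n - 2 * j - 1)))].
Proof.
have sq l : l%:R ^+ 2 + 9 * l%:R + 2 = (l ^ 2 + 9 * l + 2)%:R :> R.
  by rewrite -natrX -natrM -!natrD.
elim: j m n k => [|j IHj] [|m] [|n] k //; rewrite ?minn0 ?min0n // => jmn.
  have k0 : 0 <= (k ^ 2 + 9 * k + 2)%:R :> R by [].
  exists ((1 + (k ^ 2 + 9 * k + 2)%:R) * (1 + m%:R * (2 + k%:R)) + 2 * k%:R + 3), (0 + (k%:R + 6)).
  split; [by rewrite !addr_ge0 // mulr_ge0 // !addr_ge0 // mulr_ge0 // addr_ge0 | by rewrite !addr_ge0|].
  move=> N q q0 qN.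
  have := @has_packing_step m n k%:R (1 + (k ^ 2 + 9 * k + 2)%:R) 0 1 k 1 q erefl _ (lexx _) q0.
  rewrite sq => /(_ _ (has_packing0 _ _ k0)) [|s [s1 s2 s3 s4]]; first by rewrite addr_ge0.
  exists s; split => //.
  - rewrite s2 muln1 mul0n muln0 expn0 mul1n.
    by rewrite -[(q * q)%N]/(q ^ 2)%N -expnM; congr (_ ^ _)%N; lia.
  - move=> Y Ys i j; have [? h] := s3 Y Ys i j; split => //; apply: le_trans h _.
    by rewrite !add0r; apply: ler_wpM2l; rewrite ?ler_nat // addr_ge0.
  - by move=> Y Ys X XY; have := s4 Y Ys X XY; rewrite expr0 mul1r mulr1.
have jmn' : (j < minn m n)%N by move: jmn; rewrite minnSS.
have [C [B [C0 B0 IH]]] := IHj _ _ (k ^ 2 + 9 * k + 2)%N jmn'.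
exists (C * (1 + m%:R * (2 + k%:R)) + 2 * k%:R + 3), (B + (k%:R + 6)).
split; [by rewrite !addr_ge0 // mulr_ge0 // !addr_ge0 // mulr_ge0 // addr_ge0 | by rewrite !addr_ge0|].
move=> N q q0 qN.
have N0 : (0 < N)%N by apply: leq_trans qN.
have := @has_packing_step m n k%:R C (B * N%:R) (N%:R ^+ j * q%:R) k _ N erefl C0.
rewrite sq => /(_ _ _ N0 (IH N q q0 qN)) [|s [s1 s2 s3 s4]]; first by rewrite mulr_ge0.
exists s; split => //.
- rewrite s2 mulnA; congr (_ * _)%N; last by congr (_ ^ _)%N; lia.
  rewrite -[(N * N)%N]/(N ^ 2)%N -expnM -expnD; congr (_ ^ _)%N.
  have : (2 * j + 2 <= m + n)%N by lia.
  nia.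
- by move=> Y Ys i l; rewrite mulrDl; exact: s3.
- by move=> Y Ys X XY; rewrite exprS -mulrA; exact: s4 XY.
Qed.

End Packing.

(** * The tradeoff function and the layer recursion *)

Section PiecewiseLinear.
Variables (R : realType) (M : nat) (psi : nat -> R).
Implicit Types (s t : R) (j : nat).

(** Projection of [s] to [j, j+1]. It writes a piecewise linear function as a sum over its pieces,
    so that monotonicity and Lipschitz bounds can be checked term by term. *)
Definition clamp j s : R := Num.max j%:R (Num.min j.+1%:R s).

Definition dmt s : R := \sum_(j < M) psi j * (j.+1%:R - clamp j s).

(* [dmt_time s] is the integral of [- dmt'(t) / t] over [t >= s]. *)
Definition dmt_time s : R := \sum_(j < M) psi j * (ln j.+1%:R - ln (clamp j s)).

Lemma clamp_le j s t : s <= t -> clamp j s <= clamp j t.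
Proof.
move=> st; rewrite /clamp ge_max le_max lexx /= le_max; apply/orP; right.
by rewrite le_min !ge_min lexx /= st orbT.
Qed.

Lemma clamp_le_succ j s : clamp j s <= j.+1%:R.
Proof. by rewrite /clamp ge_max ler_nat leqnSn ge_min lexx. Qed.

Lemma clamp_ge j s : j%:R <= clamp j s.
Proof. by rewrite /clamp le_max lexx. Qed.

Lemma clamp_id j s : j%:R <= s -> s <= j.+1%:R -> clamp j s = s.
Proof. by move=> h1 h2; rewrite /clamp (min_idPr h2) (max_idPr h1). Qed.

Lemma clamp_lo j s : s <= j%:R -> clamp j s = j%:R.
Proof.
move=> h; rewrite /clamp; apply/max_idPl; apply: le_trans h.
by rewrite ge_min lexx orbT.
Qed.

Lemma clamp_hi j s : j.+1%:R <= s -> clamp j s = j.+1%:R.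
Proof. by move=> h; rewrite /clamp (min_idPl h); apply/max_idPr; rewrite ler_nat. Qed.

Lemma clamp_lip j s t : s <= t -> clamp j t - clamp j s <= t - s.
Proof.
move=> st; have jj : j%:R <= j.+1%:R :> R by rewrite ler_nat.
have [sj|js] := leP s j%:R; first rewrite (clamp_lo sj).
  have [tj|jt] := leP t j%:R; first by rewrite (clamp_lo tj); lra.
  have [tj|jt'] := leP t j.+1%:R; first by rewrite clamp_id //; lra.
  by rewrite clamp_hi; lra.
have [sj|js'] := leP s j.+1%:R; first rewrite (clamp_id (ltW js) sj).
  have [tj|jt'] := leP t j.+1%:R; first by rewrite clamp_id //; lra.
  by rewrite clamp_hi; lra.
by rewrite !clamp_hi; lra.
Qed.

(** A piece contributes to a difference only if it overlaps [s, t], and its clamped values then lie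
    within [s, t]. *)
Lemma clamp_lt_ge j s t : clamp j s < clamp j t -> s <= clamp j s /\ clamp j t <= t.
Proof.
move=> lt_st; split; rewrite leNgt; apply/negP => h.
  have [sj|js] := leP s j.+1%:R.
    have [js|sj'] := leP j%:R s; first by rewrite clamp_id // ltxx in h.
    by have := clamp_ge j s; lra.
  by move: lt_st; rewrite (clamp_hi (ltW js)) ltNge clamp_le_succ.
have [tj|jt] := leP j%:R t.
  have [jt|tj'] := leP t j.+1%:R; first by rewrite clamp_id // ltxx in h.
  by have := clamp_le_succ j t; lra.
by move: lt_st; rewrite (clamp_lo (ltW jt)) ltNge clamp_ge.
Qed.

Lemma clamp_gt0 j s : 0 < s -> 0 < clamp j s.
Proof.
by move=> s0; rewrite /clamp lt_max lt_min s0 andbT !ltr0n orbT.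
Qed.

Hypothesis psi_gt0 : forall j, (j < M)%N -> 0 < psi j.

Lemma dmtB s t : dmt s - dmt t = \sum_(j < M) psi j * (clamp j t - clamp j s).
Proof. by rewrite /dmt -sumrB; apply: eq_bigr => j _; ring. Qed.

Lemma dmt_anti s t : s <= t -> dmt t <= dmt s.
Proof.
move=> st; rewrite -subr_ge0 dmtB; apply: sumr_ge0 => j _.
by rewrite mulr_ge0 ?subr_ge0 ?clamp_le // ltW // psi_gt0.
Qed.

Lemma dmt_ge0 s : 0 <= dmt s.
Proof.
apply: sumr_ge0 => j _.
by rewrite mulr_ge0 ?subr_ge0 ?clamp_le_succ // ltW // psi_gt0.
Qed.

Lemma dmt_lip s t : s <= t -> dmt s - dmt t <= (\sum_(j < M) psi j) * (t - s).
Proof.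
move=> st; rewrite dmtB mulr_suml; apply: ler_sum => j _.
by apply: ler_wpM2l; rewrite ?clamp_lip // ltW // psi_gt0.
Qed.

Lemma dmt_top s : M%:R <= s -> dmt s = 0.
Proof.
move=> Ms; rewrite /dmt big1 // => j _; rewrite clamp_hi ?subrr ?mulr0 //.
by apply: le_trans Ms; rewrite ler_nat.
Qed.

Lemma dmt_time_top s : M%:R <= s -> dmt_time s = 0.
Proof.
move=> Ms; rewrite /dmt_time big1 // => j _; rewrite clamp_hi ?subrr ?mulr0 //.
by apply: le_trans Ms; rewrite ler_nat.
Qed.

Lemma dmt_lt s t : 0 <= s -> s < t -> t <= M%:R -> dmt t < dmt s.
Proof.
move=> s0 st tM; rewrite -subr_gt0 dmtB.
have /andP[js sj] := truncn_itv s0.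
set j := Num.truncn s in js sj.
have jM : (j < M)%N by rewrite -(ltr_nat R); apply: le_lt_trans js _; lra.
rewrite (bigD1 (Ordinal jM)) //=; apply: ltr_wpDr.
  apply: sumr_ge0 => i _.
  by rewrite mulr_ge0 ?subr_ge0 ?clamp_le ?(ltW st) // ltW // psi_gt0.
rewrite mulr_gt0 ?psi_gt0 // subr_gt0 (clamp_id js (ltW sj)).
have [tj|jt] := leP t j.+1%:R; last by rewrite clamp_hi // ltW.
by rewrite clamp_id //; lra.
Qed.

Lemma dmt_inj s t : 0 <= s -> 0 <= t -> s <= M%:R -> t <= M%:R -> dmt s = dmt t -> s = t.
Proof.
move=> s0 t0 sM tM st; have [h|h|//] := ltgtP s t.
  by have := dmt_lt s0 h tM; rewrite st ltxx.
by have := dmt_lt t0 h sM; rewrite st ltxx.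
Qed.

Lemma ln_sub_le (x y : R) : 0 < x -> 0 < y -> ln y - ln x <= (y - x) / x.
Proof.
move=> x0 y0; rewrite -ln_div ?posrE //.
have yx : 0 < y / x by rewrite divr_gt0.
have -> : (y - x) / x = y / x - 1 by field; rewrite gt_eqF.
by rewrite -[X in ln X](subrKC 1); apply: le_ln1Dx; lra.
Qed.

Lemma dmt_timeB s t :
  dmt_time s - dmt_time t = \sum_(j < M) psi j * (ln (clamp j t) - ln (clamp j s)).
Proof. by rewrite /dmt_time -sumrB; apply: eq_bigr => j _; ring. Qed.

Lemma dmt_continuous : continuous dmt.
Proof.
move=> x; apply/cvgrPdist_le => e e0.
pose Psi := \sum_(j < M) psi j.
have Psi0 : 0 <= Psi by apply: sumr_ge0 => j _; rewrite ltW // psi_gt0.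
near=> t.
have lip : `|dmt x - dmt t| <= Psi * `|x - t|.
  have [xt|tx] := leP x t.
    by rewrite ger0_norm ?subr_ge0 ?dmt_anti // distrC ger0_norm ?subr_ge0 // dmt_lip.
  rewrite distrC ger0_norm ?subr_ge0 ?dmt_anti ?(ltW tx) //.
  by rewrite ger0_norm ?subr_ge0 ?(ltW tx) // dmt_lip // ltW.
apply: le_trans lip _; apply: (@le_trans _ _ ((Psi + 1) * `|x - t|)).
  by apply: ler_wpM2r => //; lra.
rewrite -ler_pdivlMl; last by lra.
near: t; apply: cvgr_dist_le; first exact: cvg_id.
by rewrite mulr_gt0 // invr_gt0; lra.
Unshelve. all: by end_near. Qed.

(** Piece by piece, ln x <= x - 1 compares the integral of 1/x with its value at an endpoint;
    [clamp_lt_ge] replaces the clamped endpoint by [t]. The upper bound below is symmetric, with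
    [s]. *)
Lemma dmt_time_lower s t : 0 < s -> s <= t -> (dmt s - dmt t) / t <= dmt_time s - dmt_time t.
Proof.
move=> s0 st; rewrite dmt_timeB dmtB mulr_suml; apply: ler_sum => j _.
rewrite -mulrA; apply: ler_wpM2l; first by rewrite ltW // psi_gt0.
have t0 : 0 < t by lra.
have [] := ltgtP (clamp j s) (clamp j t); last by move=> ->; rewrite !subrr mul0r.
  move=> h; have [_ ct] := clamp_lt_ge h.
  have cs0 := clamp_gt0 j s0; have ct0 := clamp_gt0 j t0.
  have := ln_sub_le ct0 cs0.
  suff : (clamp j t - clamp j s) / t <= (clamp j t - clamp j s) / clamp j t by lra.
  by apply: ler_wpM2l; [lra | rewrite lef_pV2 ?posrE].
by rewrite ltNge clamp_le.
Qed.

Lemma dmt_time_upper s t : 0 < s -> s <= t -> dmt_time s - dmt_time t <= (dmt s - dmt t) / s.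
Proof.
move=> s0 st; rewrite dmt_timeB dmtB mulr_suml; apply: ler_sum => j _.
rewrite -mulrA; apply: ler_wpM2l; first by rewrite ltW // psi_gt0.
have t0 : 0 < t by lra.
have [] := ltgtP (clamp j s) (clamp j t); last by move=> ->; rewrite !subrr mul0r.
  move=> h; have [cs _] := clamp_lt_ge h.
  have cs0 := clamp_gt0 j s0; have ct0 := clamp_gt0 j t0.
  apply: le_trans (ln_sub_le cs0 ct0) _.
  by apply: ler_wpM2l; [lra | rewrite lef_pV2 ?posrE].
by rewrite ltNge clamp_le.
Qed.

Lemma dmt_surj (r0 v : R) : 0 < r0 -> r0 <= M%:R -> 0 <= v -> v <= dmt r0 ->
  exists r, [/\ r0 <= r, r <= M%:R & dmt r = v].
Proof.
move=> r00 r0M v0 vr0.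
have [||r] := @IVT R dmt r0 M%:R v r0M.
- by apply: continuous_subspaceT; exact: dmt_continuous.
- by rewrite (@dmt_top M%:R) // (min_idPr (dmt_ge0 r0)) (max_idPl (dmt_ge0 r0)) v0.
- by rewrite in_itv /= => /andP[h1 h2] h; exists r.
Qed.

(** * The layer recursion as an Euler scheme *)

Section Layers.
Variables (b nu r0 : R).
Hypothesis (b0 : 0 < b) (nu0 : 0 <= nu) (r00 : 0 < r0) (r0M : r0 <= M%:R).
Let Delta := nu + dmt r0.

Lemma rate_exists : exists g : R -> R, forall y : R, y <= Delta ->
  [/\ r0 <= g y, g y <= M%:R & dmt (g y) = Delta - Num.max nu y].
Proof.
have [r0_gt0 r0_leM nu_ge0] := And3 r00 r0M nu0.
suff ex y : exists r, y <= Delta ->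
    [/\ r0 <= r, r <= M%:R & dmt r = Delta - Num.max nu y].
  by have [g gP] := boolp.choice ex; exists g.
(* Beyond [Delta] nothing is claimed and 0 is a placeholder. *)
have [yD|yD] := leP y Delta; last by exists 0.
have mD : Num.max nu y <= Delta by rewrite ge_max yD andbT /Delta lerDl dmt_ge0.
have [r rP] : exists r, [/\ r0 <= r, r <= M%:R & dmt r = Delta - Num.max nu y].
  apply: dmt_surj => //; first by rewrite subr_ge0.
  have : nu <= Num.max nu y by rewrite le_max lexx.
  by rewrite /Delta; lra.
by exists r.
Qed.

Variable g : R -> R.
Hypothesis gP : forall y : R, y <= Delta ->
  [/\ r0 <= g y, g y <= M%:R & dmt (g y) = Delta - Num.max nu y].

(* [U y] is the integral of [1/g] from [0] to [y]. *)
Let U (y : R) : R := Num.min y nu / r0 + (dmt_time r0 - dmt_time (g y)).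

Lemma rate_mono y y' : y <= y' -> y' <= Delta -> g y <= g y'.
Proof.
move=> yy' y'D; have [h1 h2 h3] := gP y'D; have [h4 h5 h6] := gP (le_trans yy' y'D).
rewrite leNgt; apply/negP => h.
have := dmt_lt (ltW (lt_le_trans r00 h1)) h h5; rewrite h3 h6.
suff : Num.max nu y <= Num.max nu y' by lra.
by rewrite ge_max !le_max lexx yy' orbT.
Qed.

Lemma rate_start y : y <= nu -> g y = r0.
Proof.
have [r0_gt0 r0_leM nu_ge0] := And3 r00 r0M nu0.
move=> ynu; have yD : y <= Delta by have := dmt_ge0 r0; rewrite /Delta; lra.
have [h1 h2 h3] := gP yD; apply: dmt_inj => //; [lra | lra |].
by rewrite h3 (max_idPl ynu) /Delta; lra.
Qed.

(** The increment of [y] splits into a part below [nu], where the rate is constantly [r0], and a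
    part above, which equals the decrease of [dmt (g y)]. As [g] is nondecreasing, 1/g is largest at
    the left end. *)
Lemma time_step_upper y y' : y <= y' -> y' <= Delta -> U y' - U y <= (y' - y) / g y.
Proof.
have [r0_gt0 r0_leM nu_ge0] := And3 r00 r0M nu0.
move=> yy' y'D; have yD := le_trans yy' y'D.
have gg := rate_mono yy' y'D.
have [h1 h2 h3] := gP y'D; have [h4 h5 h6] := gP yD.
have gy0 : 0 < g y by lra.
have hu := dmt_time_upper gy0 gg.
rewrite h3 h6 in hu.
have -> : y' - y = (Num.min y' nu - Num.min y nu) + (Num.max nu y' - Num.max nu y).
  by rewrite ![Num.max nu _]maxC; have := addr_max_min y nu; have := addr_max_min y' nu; lra.
rewrite mulrDl.
suff : (Num.min y' nu - Num.min y nu) / r0 <= (Num.min y' nu - Num.min y nu) / g y.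
  rewrite /U mulrBl; have -> : Num.max nu y' - Num.max nu y =
    Delta - Num.max nu y - (Delta - Num.max nu y') by ring.
  lra.
have [ynu|nuy] := leP y nu; first by rewrite (rate_start ynu).
by rewrite (min_idPr (le_trans (ltW nuy) yy')) subrr !mul0r.
Qed.

Lemma time_step_lower y y' : y <= y' -> y' <= Delta -> (y' - y) / g y' <= U y' - U y.
Proof.
have [r0_gt0 r0_leM nu_ge0] := And3 r00 r0M nu0.
move=> yy' y'D; have yD := le_trans yy' y'D.
have gg := rate_mono yy' y'D.
have [h1 h2 h3] := gP y'D; have [h4 h5 h6] := gP yD.
have gy0 : 0 < g y by lra.
have hu := dmt_time_lower gy0 gg.
rewrite h3 h6 in hu.
have -> : y' - y = (Num.min y' nu - Num.min y nu) + (Num.max nu y' - Num.max nu y).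
  by rewrite ![Num.max nu _]maxC; have := addr_max_min y nu; have := addr_max_min y' nu; lra.
rewrite mulrDl.
suff : (Num.min y' nu - Num.min y nu) / g y' <= (Num.min y' nu - Num.min y nu) / r0.
  rewrite /U [_ / r0]mulrBl; have -> : Num.max nu y' - Num.max nu y =
    Delta - Num.max nu y - (Delta - Num.max nu y') by ring.
  lra.
apply: ler_wpM2l; last by rewrite lef_pV2 ?posrE //; lra.
rewrite subr_ge0 le_min !ge_min lexx yy' orbT //.
Qed.

Lemma time_end : U Delta = nu / r0 + dmt_time r0.
Proof.
have [r0_gt0 r0_leM nu_ge0] := And3 r00 r0M nu0.
have nuD : nu <= Delta by rewrite /Delta lerDl dmt_ge0.
have [h1 h2 h3] := gP (lexx Delta).
have gM : g Delta = M%:R.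
  by apply: dmt_inj => //; [lra | rewrite h3 (max_idPr nuD) dmt_top ?subrr].
rewrite /U gM (@dmt_time_top M%:R) // subr0; congr (_ / _ + _).
exact/min_idPr.
Qed.

(** The exact flow from [y] never slows down, so in time [e] it travels at least [e * r]. It reaches
    [Delta] only at time [nu / r0 + dmt_time r0], hence the step cannot overshoot. *)
Lemma euler_step y r (e : R) : 0 <= r -> y <= Delta -> r <= g y -> 0 < e ->
  U y + e <= nu / r0 + dmt_time r0 ->
  y + e * r <= Delta /\ U (y + e * r) <= U y + e.
Proof.
have [r0_gt0 r0_leM nu_ge0] := And3 r00 r0M nu0.
move=> rp yD rg e0 UE.
have [h1 h2 h3] := gP yD; have gy0 : 0 < g y by lra.
have er : 0 <= e * r by rewrite mulr_ge0 // ltW.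
have erg : e * r / g y <= e by rewrite -mulrA ger_pMr // ler_pdivrMr // mul1r.
have yeD : y + e * r <= Delta.
  rewrite leNgt; apply/negP => h.
  have := time_step_upper yD (lexx _); rewrite time_end => hU.
  have : (Delta - y) / g y < e * r / g y by rewrite ltr_pM2r ?invr_gt0 //; lra.
  lra.
split => //; have : y <= y + e * r by lra.
move=> /time_step_upper /(_ yeD); rewrite [y + _ - y]addrAC subrr add0r; lra.
Qed.

Lemma time_start : U 0 = 0.
Proof. by rewrite /U (min_idPl nu0) mul0r rate_start // subrr addr0. Qed.

(** If no layer satisfies the second alternative, every rate is at most [g (Y l)], and by
    [euler_step] the levels stay behind the flow. The alternative asks for a positive rate because
    [distortion_lower_outage] is proved for such layers. *)
Lemma euler_converse (L : nat) (r : nat -> R) (Y := fun l => \sum_(i < l) b / L%:R * r i) :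
  (0 < L)%N -> (forall l, 0 <= r l) -> b <= nu / r0 + dmt_time r0 ->
  Num.max nu (Y L) <= Delta \/
  exists l, [/\ (l < L)%N, 0 < r l & Num.max nu (Y l) + dmt (r l) <= Delta].
Proof.
move=> L0 rp bU; have [b_gt0 nu_ge0] := conj b0 nu0.
have LR : 0 < L%:R :> R by rewrite ltr0n.
have e0 : 0 < b / L%:R by rewrite divr_gt0.
have bE : L%:R * (b / L%:R) = b by field; rewrite gt_eqF.
have [|no_out] := pselect (exists l, [/\ (l < L)%N, 0 < r l &
  Num.max nu (Y l) + dmt (r l) <= Delta]); first by right.
left; suff inv l : (l <= L)%N -> Y l <= Delta /\ U (Y l) <= l%:R * (b / L%:R).
  have [YD _] := inv L (leqnn L); rewrite ge_max YD andbT /Delta lerDl.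
  exact: dmt_ge0.
elim: l => [_|l IHl lL]; first by rewrite /Y big_ord0 time_start mul0r addr_ge0 // dmt_ge0.
have [YD UY] := IHl (ltnW lL).
have -> : Y l.+1 = Y l + b / L%:R * r l by rewrite /Y big_ord_recr.
have eL : l%:R * (b / L%:R) + b / L%:R <= b.
  rewrite -[leRHS]bE -[X in _ + X]mul1r -mulrDl; apply: ler_wpM2r; first exact: ltW.
  by rewrite natr1 ler_nat.
have rg : r l <= g (Y l).
  have [h1 h2 h3] := gP YD.
  have := rp l; rewrite le_eqVlt => /predU1P[<-|rl0]; first by have := r00; lra.
  rewrite leNgt; apply/negP => h.
  have := dmt_anti (ltW h); rewrite h3.
  have : Delta < Num.max nu (Y l) + dmt (r l).
    by rewrite ltNge; apply/negP => h'; apply: no_out; exists l.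
  lra.
have [|hY hU] := euler_step (rp l) YD rg e0; first by lra.
split => //; rewrite -addn1 natrD mulrDl mul1r; lra.
Qed.

(** Explicit Euler for y' = g(y). A step lags behind the flow by at most (b/L)(g(y') - g(y))/r0, and
    these lags telescope to at most (b/L)(M/r0). A rate of at most M turns this delay into the
    stated distance to [Delta]. *)
Lemma euler_achieve (L : nat) : (0 < L)%N -> nu / r0 + dmt_time r0 = b ->
  exists (r : nat -> R) (Y := fun l => \sum_(i < l) b / L%:R * r i),
    [/\ forall l, (l < L)%N -> r0 <= r l /\ Num.max nu (Y l) + dmt (r l) = Delta,
        Y L <= Delta & Delta - Y L <= b * M%:R ^+ 2 / r0 / L%:R].
Proof.
move=> L0 Ub; have [b_gt0 nu_ge0 r0_gt0] := And3 b0 nu0 r00; have r0_le := r0M.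
have LR : 0 < L%:R :> R by rewrite ltr0n.
have e0 : 0 < b / L%:R by rewrite divr_gt0.
have bE : L%:R * (b / L%:R) = b by field; rewrite gt_eqF.
pose y l := iter l (fun z => z + b / L%:R * g z) 0.
have yS l : y l.+1 = y l + b / L%:R * g (y l) by [].
exists (fun l => g (y l)).
have YE l : \sum_(i < l) b / L%:R * g (y i) = y l.
  by elim: l => [|l IHl]; rewrite ?big_ord0 // big_ord_recr /= IHl.
(* The third bound is the telescoped lag: one unit b/L of time is lost for each increase of [g] by
   r0. *)
have inv l : (l <= L)%N -> [/\ y l <= Delta, U (y l) <= l%:R * (b / L%:R) &
    (l%:R - (g (y l) - r0) / r0) * (b / L%:R) <= U (y l)].
  elim: l => [_|l IHl lL].
    rewrite [y 0]/= time_start rate_start // subrr !mul0r subr0 mul0r; split => //.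
    by rewrite addr_ge0 // dmt_ge0.
  have [yD Uy Uy'] := IHl (ltnW lL).
  have [h1 h2 h3] := gP yD.
  have gy0 : 0 <= g (y l) by lra.
  have eL : l%:R * (b / L%:R) + b / L%:R <= b.
    rewrite -[leRHS]bE -[X in _ + X]mul1r -mulrDl; apply: ler_wpM2r; first exact: ltW.
    by rewrite natr1 ler_nat.
  have [|hY hU] := euler_step gy0 yD (lexx _) e0; first by lra.
  rewrite yS; split => //; first by rewrite -addn1 natrD mulrDl mul1r; lra.
  have yy : y l <= y l + b / L%:R * g (y l) by rewrite lerDl mulr_ge0 // ltW.
  have := time_step_lower yy hY; rewrite [_ + _ - y l]addrAC subrr add0r.
  set g' := g (_ + _); have g'_ge : r0 <= g' by have [] := gP hY.
  have gg' : g (y l) <= g' by exact: rate_mono.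
  have : (1 - (g' - g (y l)) / r0) * (b / L%:R) <= b / L%:R * g (y l) / g'.
    rewrite mulrC -mulrA; apply: ler_wpM2l; first exact: ltW.
    have -> : g (y l) / g' = 1 - (g' - g (y l)) / g' by field; rewrite gt_eqF //; lra.
    rewrite lerD2l lerN2; apply: ler_wpM2l; first by lra.
    by rewrite lef_pV2 ?posrE //; lra.
  rewrite -addn1 natrD => hA hB.
  have -> : (l%:R + 1 - (g' - r0) / r0) * (b / L%:R) =
    (l%:R - (g (y l) - r0) / r0) * (b / L%:R) + (1 - (g' - g (y l)) / r0) * (b / L%:R).
    by ring.
  lra.
split.
- move=> l lL; rewrite YE; have [yD _ _] := inv l (ltnW lL).
  by have [h1 h2 h3] := gP yD; split => //; rewrite h3 addrC subrK.
- by rewrite YE; have [] := inv L (leqnn L).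
rewrite YE; have [yD Uy Uy'] := inv L (leqnn L).
have := time_step_lower yD (lexx _); rewrite time_end Ub.
have [hg1 hg2 _] := gP (lexx Delta); have [hg3 hg4 _] := gP yD => h.
have gD0 : 0 < g Delta by lra.
have MR : 0 < M%:R :> R by lra.
rewrite ler_pdivrMr // in h.
apply: le_trans h _.
apply: (@le_trans _ _ ((b - U (y L)) * M%:R)).
  apply: ler_wpM2l => //; lra.
rewrite [leRHS](_ : _ = (M%:R / r0 * (b / L%:R)) * M%:R); last by field; rewrite !gt_eqF.
apply: ler_wpM2r; first exact: ltW.
have : (g (y L) - r0) / r0 * (b / L%:R) <= M%:R / r0 * (b / L%:R).
  by apply: ler_wpM2r; [exact: ltW | apply: ler_wpM2r; [rewrite invr_ge0 ltW | lra]].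
move: Uy'; rewrite mulrBl bE; lra.
Qed.

End Layers.
End PiecewiseLinear.

(** * The closed form *)

Section ClosedForm.
Variables (R : realType) (Mhi M : nat).
Hypothesis M_le : (M <= Mhi)%N.
Let psi j : R := (Mhi + M - 2 * j - 1)%:R.

(** The pieces of [dmt] are numbered upwards from rate 0, the phi_k downwards from rate [M]; hence
    the reversed index. *)
Lemma phiKE i : (i < M)%N -> phiK R Mhi M i.+1 = psi (M - i.+1).
Proof. by move: M_le => *; rewrite /phiK /psi; congr _%:R; lia. Qed.

Lemma cKE i : cK R Mhi M i =
  \sum_(0 <= l < i) phiK R Mhi M l.+1 * ln (MK R M l.+1 / (MK R M l.+1 - 1)).
Proof. by elim: i => [|i IHi]; [rewrite big_geq | rewrite big_nat_recr //= -IHi]. Qed.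

(** Counted downwards from [M], the pieces above the rate contribute in full, the piece containing
    it contributes [x], and those below it contribute nothing. *)
Lemma sum_region (k : nat) (F : nat -> R) (H : nat -> R) (x : R) : (k < M)%N ->
  (forall i, (i < k)%N -> F (M - i.+1)%N = H i) ->
  F (M - k.+1)%N = x ->
  (forall i, (k < i)%N -> (i < M)%N -> F (M - i.+1)%N = 0) ->
  \sum_(j < M) F j = \sum_(0 <= i < k) H i + x.
Proof.
move=> kM FH Fk F0; rewrite (reindex_inj rev_ord_inj) /=.
rewrite -(big_mkord xpredT (fun i => F (M - i.+1)%N)).
rewrite (@big_cat_nat _ _ _ k.+1 0%N M) //= [X in _ + X]big_nat_cond [X in _ + X]big1 ?addr0.
  rewrite big_nat_recr //= Fk; congr (_ + _).
  by apply: eq_big_nat => i /andP[_ ik]; exact: FH.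
by move=> i /andP[/andP[ki iM] _]; exact: F0.
Qed.

Lemma dmt_region k r : (k < M)%N -> (M - k.+1)%:R <= r -> r <= (M - k)%:R ->
  dmt M psi r = \sum_(1 <= i < k.+1) phiK R Mhi M i + phiK R Mhi M k.+1 * ((M - k)%:R - r).
Proof.
move=> kM r1 r2; have kM' : (M - k.+1).+1 = (M - k)%N by lia.
rewrite (big_addn 0 _ 1) subn1 /=.
apply: (@sum_region k (fun j => psi j * (j.+1%:R - clamp j r))) => // [i ik||i ki iM].
- have iM : (i < M)%N by lia.
  rewrite addn1 phiKE // clamp_lo; last first.
    by apply: le_trans r2 _; rewrite ler_nat; lia.
  by rewrite -natr1 addrAC subrr add0r mulr1.
- by rewrite phiKE // clamp_id ?kM'.
- rewrite clamp_hi ?subrr ?mulr0 //; apply: le_trans r1; rewrite ler_nat; lia.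
Qed.

Lemma dmt_time_region k r : (k < M)%N -> 0 < r -> (M - k.+1)%:R <= r -> r <= (M - k)%:R ->
  dmt_time M psi r = cK R Mhi M k + phiK R Mhi M k.+1 * (ln (M - k)%:R - ln r).
Proof.
move=> kM r0 r1 r2; have kM' : (M - k.+1).+1 = (M - k)%N by lia.
rewrite cKE.
apply: (@sum_region k (fun j => psi j * (ln j.+1%:R - ln (clamp j r)))) => // [i ik||i ki iM].
- have iM : (i < M)%N by lia.
  rewrite phiKE // clamp_lo; last first.
    by apply: le_trans r2 _; rewrite ler_nat; lia.
  have MKE : MK R M i.+1 = (M - i.+1).+1%:R by rewrite /MK addn1.
  rewrite MKE -[X in ln (_ / (X - 1))]natr1 addrK ln_div ?posrE ?ltr0n //; lia.
- by rewrite phiKE // clamp_id ?kM'.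
- rewrite clamp_hi ?subrr ?mulr0 //; apply: le_trans r1; rewrite ler_nat; lia.
Qed.

(** The intermediate value theorem on [0, z] provides a root, so [xget] returns a root and not its
    default; the sign is read off from w e^w = z. *)
Lemma lambertWP (z : R) : 0 <= z -> 0 <= lambertW z /\ lambertW z * expR (lambertW z) = z.
Proof.
move=> z0; suff ex : exists w : R, -1 <= w /\ w * expR w = z.
  have [_ WE] : [set w : R | -1 <= w /\ w * expR w = z] (lambertW z).
    by apply: xgetPex; case: ex => w wP; exists w.
  by split => //; rewrite -(pmulr_lge0 _ (expR_gt0 (lambertW z))) WE.
have cont : {within `[0, z], continuous (fun w : R => w * expR w)}.
  apply: continuous_subspaceT => x; apply: cvgM; first exact: cvg_id.
  exact: continuous_expR.
have [|w] := @IVT R (fun w => w * expR w) 0 z z z0 cont.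
  rewrite mul0r; apply/andP; split.
    by rewrite ge_min z0.
  by rewrite le_max ler_peMr ?orbT // -expR0 ler_expR.
by rewrite in_itv /= => /andP[w0 _] wE; exists w; split => //; lra.
Qed.

(** On the piece [A-1, A] with A = M - k the equation reads nu/r + c + phi ln(A/r) = b. The unknown
    W = nu/(phi r) turns it into W e^W = e^t nu/(A phi) with t = (b-c)/phi, whence r = A e^(W-t).
    The two bounds on [b] place [r] in the piece. *)
Lemma region_rate (b nu : R) (k : nat) : 0 < b -> 0 <= nu -> (k < M)%N ->
  cK R Mhi M k + nu / MK R M k.+1 < b ->
  ((k.+1 < M)%N -> b <= cK R Mhi M k.+1 + nu / (MK R M k.+1 - 1)) ->
  exists r, [/\ 0 < r, r <= M%:R, nu / r + dmt_time M psi r = b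
    & Delta_region Mhi M b nu k.+1 = nu + dmt M psi r].
Proof.
move=> b0 nu0 kM; rewrite [cK R Mhi M k.+1]/= /Delta_region /kappa_star [k.+1.-1]/=.
have MKE : MK R M k.+1 = (M - k)%:R by rewrite /MK; congr _%:R; lia.
have phi0 : 0 < phiK R Mhi M k.+1 by rewrite phiKE // /psi ltr0n; move: M_le; lia.
rewrite MKE; set phi := phiK R Mhi M k.+1 in phi0 *; set c := cK R Mhi M k.
set A : R := (M - k)%:R; have A0 : 0 < A by rewrite /A ltr0n; lia.
have A1 : A - 1 = (M - k.+1)%:R.
  by rewrite /A (_ : (M - k)%N = (M - k.+1).+1) ?natr1 ?addrK //; [rewrite -natr1 addrK|lia].
set t := (b - c) / phi; set z := expR t * nu / (A * phi).
move=> cb bc.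
have z0 : 0 <= z by rewrite /z divr_ge0 ?mulr_ge0 ?expR_ge0 // ltW // mulr_gt0.
have [W0 WE] := lambertWP z0; set W := lambertW z in W0 WE *.
have tE : t * phi = b - c by rewrite /t mulfVK // gt_eqF.
have zA : z * (A * phi) = expR t * nu by rewrite /z mulfVK // gt_eqF // mulr_gt0.
have expE : - ((b * (1 - phi / b * W) - c) / phi) = W - t.
  by rewrite /t; field; rewrite !gt_eqF.
rewrite expE; set r := A * expR (W - t).
have r0 : 0 < r by rewrite mulr_gt0 // expR_gt0.
have nuE : nu = W * phi * r.
  apply: (mulfI (lt0r_neq0 (expR_gt0 t))); rewrite -zA -WE /r.
  rewrite expRB; field; rewrite gt_eqF // expR_gt0 //.
have nur : nu / r = W * phi by rewrite {1}nuE mulfK // gt_eqF.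
(* This is r < A. Otherwise monotonicity of w e^w would give t phi A <= nu, against the lower bound
   on [b]. *)
have Wt : W < t.
  rewrite ltNge; apply/negP => tW.
  have t0 : 0 < t.
    have nuA : 0 <= nu / A by rewrite divr_ge0 // ltW.
    by rewrite /t divr_gt0 //; lra.
  have h1 : t * expR t <= W * expR W.
    by apply: ler_pM; rewrite ?expR_ge0 ?ler_expR // ltW.
  have h2 : nu / A < t * phi by rewrite tE; lra.
  rewrite ltr_pdivrMr // in h2.
  have h3 : W * expR W * (A * phi) = expR t * nu by rewrite WE.
  have : t * expR t * (A * phi) <= expR t * nu.
    by rewrite -h3; apply: ler_wpM2r => //; rewrite mulr_ge0 // ltW.
  rewrite (_ : t * _ * _ = expR t * (t * phi * A)); last by ring.
  by rewrite ler_pM2l ?expR_gt0 // leNgt h2.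
have rA : r <= A.
  by rewrite /r ger_pMr // -expR0 ler_expR; lra.
have lnr : ln r = ln A + (W - t) by rewrite /r lnM ?posrE ?expR_gt0 // expRK.
have rA1 : (M - k.+1)%:R <= r.
  (* The last piece starts at 0, where positivity of [r] is enough; on the others the upper bound on
     [b] excludes r < A - 1. *)
  have [kM1|] := ltnP k.+1 M; last by rewrite -subn_eq0 => /eqP ->; exact: ltW.
  rewrite leNgt; apply/negP => rA1.
  have {}bc := bc kM1.
  have A10 : 0 < A - 1 by rewrite A1; lra.
  have : ln r < ln (A - 1) by rewrite ltr_ln ?posrE // A1.
  have : nu / (A - 1) <= nu / r.
    by apply: ler_wpM2l => //; rewrite lef_pV2 ?posrE // A1 ltW.
  rewrite ln_div ?posrE // in bc; rewrite nur => h1 h2.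
  have : phi * (ln A - ln (A - 1)) < phi * (ln A - ln r) by rewrite ltr_pM2l //; lra.
  by rewrite lnr; lra.
exists r; split => //.
- by apply: le_trans rA _; rewrite /A ler_nat leq_subr.
- by rewrite (@dmt_time_region k r) // -/c -/A -/phi nur lnr; lra.
rewrite (@dmt_region k r) // -/A -/phi; rewrite -addrA; congr (_ + (_ + _)).
by rewrite /r; ring.
Qed.

End ClosedForm.

(** * Probabilities of boxes and outage exponents *)

Section ScalarLaws.
Variable R : realType.
Local Notation mu := (@lebesgue_measure R).
Local Notation sigma := (Num.sqrt (2^-1) : R).

Lemma sigma_neq0 : sigma != 0.
Proof. by rewrite gt_eqF // sqrtr_gt0 invr_gt0. Qed.

Lemma normal_pdf_sigma (x : R) : normal_pdf 0 sigma x = normal_peak sigma * expR (- x ^+ 2).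
Proof.
rewrite normal_pdfE ?sigma_neq0 // /normal_fun subr0 sqr_sqrtr; last by rewrite invr_ge0.
by congr (_ * expR _); field.
Qed.

Lemma normal_peak_sigma_gt0 : 0 < normal_peak sigma.
Proof. exact: normal_peak_gt0 sigma_neq0. Qed.

Lemma normal_peak_sigma_le1 : normal_peak sigma <= 1.
Proof.
rewrite /normal_peak sqr_sqrtr; last by rewrite invr_ge0.
rewrite invf_le1 ?sqrtr_gt0 -?[leLHS]sqrtr1.
  rewrite ler_sqrt; have := @pi_ge2 R; lra.
have := @pi_ge2 R; lra.
Qed.

Lemma normal_prob_itv_le (a c : R) :
  (normal_prob 0 sigma `[a, (a + c)%R] <= (Num.max 0 c)%:E)%E.
Proof.
have mf (D : set R) : measurable_fun D (EFin \o normal_pdf 0 sigma).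
  by apply/measurable_EFinP; apply: measurable_funTS; exact: measurable_normal_pdf.
apply: (@le_trans _ _ (\int[mu]_(x in `[a, (a + c)%R]) cst 1 x)%E).
  apply: ge0_le_integral => //.
  - by move=> x _; rewrite lee_fin normal_pdf_ge0.
  - exact: mf.
  - move=> x _; rewrite lee_fin; apply: le_trans normal_peak_sigma_le1.
    exact: normal_pdf_ub sigma_neq0.
rewrite integral_cst // mul1e [X in (X <= _)%E](lebesgue_measure_itv `[a, (a + c)%R]) /= lte_fin.
case: ifPn => h; last by rewrite lee_fin le_max lexx.
by rewrite -EFinB lee_fin (addrC a) addrK le_max lexx orbT.
Qed.

Lemma normal_prob_itv_ge (B a c : R) : 0 <= c -> - B <= a -> a + c <= B ->
  ((normal_peak sigma * expR (- B ^+ 2) * c)%:E <= normal_prob 0 sigma `[a, (a + c)%R[)%E.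
Proof.
move=> c0 Ba acB.
have mf (D : set R) : measurable_fun D (EFin \o normal_pdf 0 sigma).
  by apply/measurable_EFinP; apply: measurable_funTS; exact: measurable_normal_pdf.
set k := normal_peak sigma * expR (- B ^+ 2).
have k0 : 0 <= k by rewrite mulr_ge0 ?expR_ge0 // ltW // normal_peak_sigma_gt0.
apply: (@le_trans _ _ (\int[mu]_(x in `[a, (a + c)%R[) cst k%:E x)%E).
  rewrite integral_cst // [X in (_ <= _ * X)%E](lebesgue_measure_itv `[a, (a + c)%R[) /= lte_fin.
  case: ifPn => h; first by rewrite -EFinB -EFinM lee_fin (addrC a) addrK.
  have -> : c = 0 by apply/eqP; rewrite eq_le c0 andbT -(lerD2l a) addr0 leNgt.
  by rewrite mulr0 mule0.
apply: ge0_le_integral => //; first exact: mf.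
move=> x; rewrite /= in_itv /= => /andP[ax xac].
rewrite lee_fin normal_pdf_sigma; apply: ler_wpM2l; first by rewrite ltW // normal_peak_sigma_gt0.
rewrite ler_expR lerN2 -[x ^+ 2]real_normK ?num_real // -[B ^+ 2]real_normK ?num_real //.
apply: lerXn2r; rewrite ?nnegrE //.
by rewrite [`|B|]ger0_norm ?ler_norml; [apply/andP; split; lra | lra].
Qed.

Lemma integral_expRN_norm : (\int[mu]_x (expR (- `|x|))%:E = 2%:E)%E.
Proof.
rewrite ge0_symfun_integralT.
- rewrite (_ : (\int[mu]_(x in [set x | (0 <= x)%R]) (expR (- `|x|))%:E = 1)%E) ?mule1 //.
  rewrite -(@integral_exponential_pdf R 1) // integral_mkcond; apply: eq_integral => x _.
  rewrite patchE; have [x0|x0] := leP 0 x.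
    by rewrite mem_set //= ger0_norm // exponential_pdfE // mulN1r mul1r.
  by rewrite memNset /= ?lt0_exponential_pdf //; apply/negP; rewrite -ltNge.
- by move=> x; exact: expR_ge0.
- move=> x; apply: (@continuous_comp _ _ _ (fun x : R => - `|x|) expR); last exact: continuous_expR.
  by apply: (@continuousN _ R^o); exact: norm_continuous.
- by move=> x /=; rewrite normrN.
Qed.

(** From x^2 >= 2|x| - 1 one gets e^(-x^2) <= e^(1-t) e^(-|x|) where |x| > t, and e^(-|x|) has
    integral 2. This crude tail suffices, as [t] will be a positive power of rho up to a
    constant. *)
Lemma normal_prob_tail (t : R) : 
  (normal_prob 0 sigma [set x : R | (t < `|x|)%R] <= (2 * expR (1 - t))%:E)%E.
Proof.
have mD : measurable [set x : R | t < `|x|].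
  rewrite (_ : mkset _ = (fun x => `|x|) @^-1` `]t, +oo[).
    by rewrite -[X in measurable X]setTI; exact: normr_measurable.
  by apply/seteqP; split => x /=; rewrite in_itv /= andbT.
have mexp : measurable_fun setT (fun x : R => expR (- `|x|)).
  apply: (@measurableT_comp _ _ _ _ _ _ expR) => //.
  by apply: measurableT_comp => //; exact: normr_measurable.
have mf (D : set R) : measurable_fun D (EFin \o normal_pdf 0 sigma).
  by apply/measurable_EFinP; apply: measurable_funTS; exact: measurable_normal_pdf.
have mg (D : set R) : measurable_fun D ((cst (expR (1 - t))%:E) \* (EFin \o (fun x : R => expR (- `|x|))))%E.
  by apply: measurable_funTS; apply: measurable_funeM; exact/measurable_EFinP.
apply: (@le_trans _ _ (\int[mu]_(x in [set x : R | (t < `|x|)%R])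
    ((expR (1 - t))%:E * (expR (- `|x|))%:E))%E).
  apply: ge0_le_integral => //.
  - by move=> x _; rewrite lee_fin normal_pdf_ge0.
  - exact: mf.
  - exact: mg.
  - move=> x /= tx; rewrite -EFinM lee_fin normal_pdf_sigma -expRD.
    apply: (@le_trans _ _ (1 * expR (- x ^+ 2))).
      by apply: ler_wpM2r; rewrite ?expR_ge0 // normal_peak_sigma_le1.
    rewrite mul1r ler_expR -[x ^+ 2]real_normK ?num_real //.
    by have := sqr_ge0 (`|x| - 1); nra.
apply: (@le_trans _ _ (\int[mu]_x ((expR (1 - t))%:E * (expR (- `|x|))%:E))%E).
  by apply: ge0_subset_integral => //; exact: mg.
rewrite ge0_integralZl // ?integral_expRN_norm.
- by rewrite -EFinM lee_fin mulrC.
- exact/measurable_EFinP.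
Qed.

Lemma exponential_prob_neg : exponential_prob 1 [set x : R | x < 0] = 0%E.
Proof.
rewrite /exponential_prob integral0_eq // => x /= x0.
by rewrite lt0_exponential_pdf.
Qed.

Lemma exponential_prob_le (t : R) : 0 < t -> (exponential_prob 1 `[0%R, t] <= t%:E)%E.
Proof.
move=> t0; rewrite exponential_prob_itv0c // -EFinB lee_fin mulN1r.
by have := expR_ge1Dx (- t); lra.
Qed.

Lemma exponential_prob_ge (t : R) : 0 < t -> t <= 1 ->
  ((t / 2)%:E <= exponential_prob 1 `[0%R, t])%E.
Proof.
move=> t0 t1; rewrite exponential_prob_itv0c // -EFinB lee_fin mulN1r expRN.
have h := expR_ge1Dx t; have h0 := expR_gt0 t.
have : (expR t)^-1 <= (1 + t)^-1 by rewrite lef_pV2 ?posrE //; lra.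
suff : t / 2 <= 1 - (1 + t)^-1 by lra.
have -> : 1 - (1 + t)^-1 = t / (1 + t) by field; rewrite gt_eqF //; lra.
by apply: ler_wpM2l; [exact: ltW | rewrite lef_pV2 ?posrE //; lra].
Qed.

End ScalarLaws.

(** * From cell counts to probabilities *)

Section Boxes.
Variables (R : realType) (d : measure_display) (T : measurableType d).
Variables (P : probability T R) (Mr Mt : nat).
Variables (Hre Him : 'I_Mr -> 'I_Mt -> T -> R) (G : T -> R).
Hypothesis hmodel : channel_model P Hre Him G.
Local Notation sigma := (Num.sqrt (2^-1) : R).
Local Notation rv := (rv_family Hre Him G).

(** The condition on Gamma is carried along so that every estimate for [H] comes with the factor
    P(Gamma in B); this is the form in which independence is used. *)
Definition box (A : 'I_Mr * 'I_Mt * bool -> set R) (B : set R) : set T :=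
  [set x | (forall k, A k (rv (Some k) x)) /\ B (G x)].

Let box_family A B (k : rv_index Mr Mt) : set R :=
  match k with Some k' => A k' | None => B end.

Lemma boxE A B : box A B = \bigcap_k (rv k @^-1` box_family A B k).
Proof.
apply/seteqP; split => [x [xA xB] [k|] _ /=|x xAB]; [exact: xA | exact: xB | split].
  by move=> k; exact: (xAB (Some k) I).
exact: (xAB None I).
Qed.

Let measurable_rv k (A : set R) : measurable A -> measurable (rv k @^-1` A).
Proof.
case: hmodel => mrv _ _ _ _ mA; rewrite -[X in measurable X]setTI; exact: mrv.
Qed.

Lemma measurable_preG (B : set R) : measurable B -> measurable (G @^-1` B).
Proof. exact: (@measurable_rv None). Qed.

Lemma measurable_box A B : (forall k, measurable (A k)) -> measurable B ->
  measurable (box A B).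
Proof.
move=> mA mB; rewrite boxE; apply: fin_bigcap_measurable => //.
  exact: finite_finset.
by move=> [k|] _; apply: measurable_rv; [exact: mA | exact: mB].
Qed.

Lemma rv_law k (A : set R) : measurable A -> P (rv (Some k) @^-1` A) = normal_prob 0 sigma A.
Proof.
by case: hmodel => _ reH imH _ _; case: k => -[i j] [] /= mA; [exact: imH | exact: reH].
Qed.

Lemma box_prob A B : (forall k, measurable (A k)) -> measurable B ->
  P (box A B) = (P (G @^-1` B) * \prod_k P (rv (Some k) @^-1` A k))%E.
Proof.
move=> mA mB; case: (hmodel) => _ _ _ _ indep.
rewrite boxE indep; last by case.
rewrite (bigD1 None) //=; congr (_ * _)%E.
rewrite (reindex_omap (@Some _) id) /=; last by case.
by apply: eq_bigl => k; rewrite eqxx.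
Qed.

Lemma lee_prod (I : Type) (r : seq I) (f g : I -> \bar R) :
  (forall i, 0 <= f i)%E -> (forall i, f i <= g i)%E ->
  (\prod_(i <- r) f i <= \prod_(i <- r) g i)%E.
Proof.
move=> f0 fg; suff /andP[] : (0 <= \prod_(i <- r) f i <= \prod_(i <- r) g i)%E by [].
elim/big_ind2: _ => [|x1 x2 y1 y2 /andP[h1 h2] /andP[h3 h4]|i _].
- by rewrite lee01 lexx.
- by rewrite mule_ge0 // lee_pmul.
- by rewrite f0 fg.
Qed.

Lemma box_prob_le A B (delta : 'I_Mr * 'I_Mt * bool -> R) :
  (forall k, measurable (A k)) -> measurable B ->
  (forall k, P (rv (Some k) @^-1` A k) <= (delta k)%:E)%E ->
  (P (box A B) <= (\prod_k delta k)%:E * P (G @^-1` B))%E.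
Proof.
move=> mA mB Ad; rewrite box_prob // muleC; apply: lee_wpmul2r => //.
by rewrite -prodEFin; apply: lee_prod.
Qed.

Lemma box_prob_ge A B (delta : R) : 0 <= delta ->
  (forall k, measurable (A k)) -> measurable B ->
  (forall k, delta%:E <= P (rv (Some k) @^-1` A k))%E ->
  ((delta ^+ (Mr * Mt * 2))%:E * P (G @^-1` B) <= P (box A B))%E.
Proof.
move=> d0 mA mB Ad; rewrite box_prob // [leRHS]muleC; apply: lee_wpmul2r => //.
have -> : delta ^+ (Mr * Mt * 2) = \prod_(k : 'I_Mr * 'I_Mt * bool) delta.
  by rewrite prodr_const !card_prod !card_ord card_bool.
by rewrite -prodEFin; apply: lee_prod.
Qed.

Lemma measure_bigsetU_le (I : Type) (r : seq I) (F : I -> set T) :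
  (forall i, measurable (F i)) ->
  (P (\big[setU/set0]_(i <- r) F i) <= \sum_(i <- r) P (F i))%E.
Proof.
move=> mF; elim: r => [|i r IHr]; first by rewrite !big_nil measure0.
rewrite !big_cons; apply: le_trans (measureU2 _ (mF i) _) _.
  exact: bigsetU_measurable.
exact: leeD2l.
Qed.

Lemma measure_bigsetU_disj (I : choiceType) (r : seq I) (F : I -> set T) :
  (forall i, measurable (F i)) -> uniq r ->
  (forall i j, i \in r -> j \in r -> (F i `&` F j) !=set0 -> i = j) ->
  P (\big[setU/set0]_(i <- r) F i) = (\sum_(i <- r) P (F i))%E.
Proof.
move=> mF; elim: r => [|i r IHr]; first by rewrite !big_nil measure0.
rewrite /= => /andP[ir r_uniq] disj.
rewrite !big_cons measureU //.
- congr (_ + _)%E; apply: IHr => // j k jr kr; apply: disj; rewrite inE ?jr ?kr orbT //.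
- exact: bigsetU_measurable.
rewrite -subset0 => x [Fx]; rewrite -bigcup_seq => -[j /= jr Fjx].
have ij : i = j by apply: disj; rewrite ?inE ?eqxx ?jr ?orbT //; exists x.
by move: ir; rewrite ij jr.
Qed.

Lemma lee_sum_cst (I : Type) (r : seq I) (f : I -> \bar R) (x : \bar R) :
  (0 <= x)%E -> (forall i, f i <= x)%E ->
  (\sum_(i <- r) f i <= (size r)%:R%:E * x)%E.
Proof.
move=> x0 fx; elim: r => [|i r IHr]; first by rewrite big_nil mul0e.
rewrite big_cons /= -natr1 addrC EFinD ge0_muleDl // ?mul1e ?lee_fin //.
exact: leeD.
Qed.

(** Unless some real coordinate of [H] exceeds c/(2a), the matrix X = aH has entries of modulus at
    most c and lies in a cell of [low_det_covers_rank]. In [H] the cell is a box of side 2K/a in 2mn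
    real coordinates, with density at most 1 in each. The exponential term bounds the exceptional
    event. *)
Lemma gram_det_le_prob (j : nat) : (j < minn Mr Mt)%N ->
  exists2 kappa : R, 0 <= kappa & forall (a : R) (c : nat) (t : R) (B : set R),
    0 < a -> (0 < c)%N -> 0 < t -> measurable B ->
    exists S : set T, [/\ measurable S,
      forall x, gram_det ((Complex a 0) *: chanH Hre Him x) <= t -> B (G x) -> S x
    & (P S <= (kappa * (t ^+ (Mr + Mt - 2 * j - 1) * c%:R ^+ (2 * (j * j.+1)) *
                        a^-1 ^+ (2 * (Mr * Mt)) + expR (- (c%:R / (2 * a)))))%:E *
              P (G @^-1` B))%E].
Proof.
move=> jmn; have [K [C cov]] := @low_det_covers_rank R Mr Mt j jmn.
set p := (Mr + Mt - 2 * j - 1)%N in cov *; set e := (j * j.+1)%N in cov *.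
pose fct : R := Mr`!%:R.
have fct0 : 0 < fct by rewrite ltr0n fact_gt0.
exists (C%:R * fct ^+ p * (2 * K%:R) ^+ (2 * (Mr * Mt)) + (Mr * Mt * 2)%:R * (2 * expR 1)).
  by rewrite addr_ge0 ?mulr_ge0 ?exprn_ge0 ?mulr_ge0 ?expR_ge0 // ltW.
move=> a c t B a0 c0 t0 mB.
have ft0 : 0 < fct * t by rewrite mulr_gt0.
have [s [s_le sP]] := cov c (fct * t) c0 ft0.
pose A Y (k : 'I_Mr * 'I_Mt * bool) : set R :=
  let y := if k.2 then complex.Im (Y k.1.1 k.1.2) else complex.Re (Y k.1.1 k.1.2) in
  `[(y - K%:R) / a, (y - K%:R) / a + 2 * K%:R / a]%classic.
pose Tl k0 (k : 'I_Mr * 'I_Mt * bool) : set R :=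
  if k == k0 then [set x | c%:R / (2 * a) < `|x|] else setT.
have mA (Y : 'M[R[i]]_(Mr, Mt)) k : measurable (A Y k) by exact: measurable_itv.
have mtail : measurable [set x : R | c%:R / (2 * a) < `|x|].
  rewrite (_ : mkset _ = (fun x => `|x|) @^-1` `]c%:R / (2 * a), +oo[).
    by rewrite -[X in measurable X]setTI; exact: normr_measurable.
  by apply/seteqP; split => x /=; rewrite in_itv /= andbT.
have mTl k0 k : measurable (Tl k0 k) by rewrite /Tl; case: ifP.
exists ((\big[setU/set0]_(Y <- s) box (A Y) B) `|`
        (\big[setU/set0]_(k0 <- enum {: 'I_Mr * 'I_Mt * bool}) box (Tl k0) B)); split.
- apply: measurableU; apply: bigsetU_measurable => ? _; exact: measurable_box.
- move=> x det_le Bx.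
  pose X : 'M[R[i]]_(Mr, Mt) := Complex a 0 *: chanH Hre Him x.
  have XE i l : X i l = Complex (a * Hre i l x) (a * Him i l x).
    by rewrite !mxE -[LHS]/(Complex _ _) !mul0r subr0 addr0.
  have [[k0 big_k0]|small] := pselect (exists k0, c%:R / (2 * a) < `|rv (Some k0) x|).
    right; rewrite -bigcup_seq; exists k0; first by rewrite /= mem_enum.
    by split => // k; rewrite /Tl; case: eqP => [->|].
  have rv_le k : `|rv (Some k) x| <= c%:R / (2 * a).
    by rewrite leNgt; apply/negP => h; apply: small; exists k.
  left; have [|Y Ys YX] := sP X.
    split=> [i l|k f g f_inj].
      apply: le_trans (normc_le_ReIm _) _; rewrite XE /= !normrM (gtr0_norm a0).
      have h1 := rv_le (i, l, false); have h2 := rv_le (i, l, true).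
      rewrite /= in h1 h2.
      rewrite (_ : c%:R = a * (c%:R / (2 * a)) + a * (c%:R / (2 * a))); last first.
        by field; rewrite gt_eqF.
      by apply: lerD; apply: ler_wpM2l => //; exact: ltW.
    apply: le_trans (gram_det_minors X g f_inj) _.
    by apply: ler_wpM2l; first exact: ltW.
  rewrite -bigcup_seq; exists Y; first by [].
  split => // -[[i l] b]; rewrite /A /= in_itv /=.
  have XY := YX i l; rewrite XE in XY.
  have hre := le_trans (Re_le_normc _) XY; have him := le_trans (Im_le_normc _) XY.
  have aE (v y : R) : `|a * v - y| <= K%:R ->
      (y - K%:R) / a <= v <= (y - K%:R) / a + 2 * K%:R / a.
    rewrite -mulrDl ler_pdivrMr // ler_pdivlMr // ler_norml => /andP[h1 h2].
    by apply/andP; split; lra.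
  case: b => /=; apply: aE.
    by move: him; case: (Y i l).
  by move: hre; case: (Y i l).
apply: le_trans (measureU2 _ _ _) _.
- by apply: bigsetU_measurable => ? _; exact: measurable_box.
- by apply: bigsetU_measurable => ? _; exact: measurable_box.
(* The constant is a sum of two, one for the cells and one for the tails; expanding the product
   leaves two nonnegative cross terms, which are dropped. *)
rewrite [X in (_ <= X%:E * _)%E](_ : _ =
    (C%:R * (fct * t) ^+ p * c%:R ^+ (2 * e)) * (2 * K%:R / a) ^+ (Mr * Mt * 2) +
    (Mr * Mt * 2)%:R * (2 * expR (1 - c%:R / (2 * a))) +
    (C%:R * fct ^+ p * (2 * K%:R) ^+ (2 * (Mr * Mt)) * expR (- (c%:R / (2 * a))) +
     (Mr * Mt * 2)%:R * (2 * expR 1) * (t ^+ p * c%:R ^+ (2 * e) * a^-1 ^+ (2 * (Mr * Mt)))));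
  last first.
  by rewrite expRD [(Mr * Mt * 2)%N]mulnC !exprMn; ring.
set q1 := _ * _ ^+ (Mr * Mt * 2); set q2 := (Mr * Mt * 2)%:R * (2 * expR (1 - _)).
apply: (@le_trans _ _ ((q1 + q2)%:E * P (G @^-1` B))%E); last first.
  apply: lee_wpmul2r => //; rewrite lee_fin lerDl.
  have ca : 0 <= c%:R * a^-1 by rewrite mulr_ge0 // invr_ge0 ltW.
  have a10 : 0 <= a^-1 by rewrite invr_ge0 ltW.
  by rewrite !(addr_ge0, mulr_ge0, exprn_ge0, expR_ge0, ler0n) // ltW.
have q10 : 0 <= q1.
  apply: mulr_ge0; last by rewrite exprn_ge0 // divr_ge0 ?mulr_ge0 // ltW.
  by apply: mulr_ge0 => //; apply: mulr_ge0 => //; rewrite exprn_ge0 // ltW.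
have q20 : 0 <= q2 by rewrite !mulr_ge0 ?expR_ge0.
rewrite EFinD ge0_muleDl ?lee_fin //; apply: leeD.
  apply: le_trans (measure_bigsetU_le _ _) _; first by move=> ?; exact: measurable_box.
  apply: le_trans (lee_sum_cst _ (x := ((2 * K%:R / a) ^+ (Mr * Mt * 2))%:E * P (G @^-1` B)) _ _) _.
  - by rewrite mule_ge0 // lee_fin exprn_ge0 // divr_ge0 ?mulr_ge0 // ltW.
  - move=> Y; have -> : (2 * K%:R / a) ^+ (Mr * Mt * 2) =
        \prod_(k : 'I_Mr * 'I_Mt * bool) (2 * K%:R / a).
      by rewrite prodr_const !card_prod !card_ord card_bool.
    apply: box_prob_le => // k; rewrite rv_law //.
    apply: le_trans (normal_prob_itv_le _ _) _; rewrite lee_fin ge_max lexx andbT.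
    by rewrite divr_ge0 ?mulr_ge0 // ltW.
  rewrite muleA -EFinM; apply: lee_wpmul2r => //; rewrite lee_fin.
  by apply: ler_wpM2r => //; rewrite exprn_ge0 // divr_ge0 ?mulr_ge0 // ltW.
apply: le_trans (measure_bigsetU_le _ _) _; first by move=> ?; exact: measurable_box.
apply: le_trans (lee_sum_cst _ (x := (2 * expR (1 - c%:R / (2 * a)))%:E * P (G @^-1` B)) _ _) _.
- by rewrite mule_ge0 // lee_fin mulr_ge0 ?expR_ge0.
- move=> k0; pose dl k : R := if k == k0 then 2 * expR (1 - c%:R / (2 * a)) else 1.
  have -> : 2 * expR (1 - c%:R / (2 * a)) = \prod_k dl k.
    rewrite (bigD1 k0) //= {1}/dl eqxx big1 ?mulr1 // => k kk0.
    by rewrite /dl (negbTE kk0).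
  apply: box_prob_le => // k; rewrite rv_law // /Tl /dl; case: eqP => _.
    exact: normal_prob_tail.
  by rewrite -(rv_law k) // probability_le1 //; exact: measurable_rv.
rewrite muleA -EFinM; apply: lee_wpmul2r => //; rewrite lee_fin.
by rewrite -cardE !card_prod !card_ord card_bool.
Qed.

Lemma lee_sum_cst_ge (I : eqType) (r : seq I) (f : I -> \bar R) (x : \bar R) :
  (0 <= x)%E -> (forall i, i \in r -> x <= f i)%E ->
  ((size r)%:R%:E * x <= \sum_(i <- r) f i)%E.
Proof.
move=> x0; elim: r => [|i r IHr] fx; first by rewrite big_nil mul0e.
rewrite big_cons /= -natr1 addrC EFinD ge0_muleDl // ?mul1e ?lee_fin //.
by apply: leeD; [apply: fx; rewrite mem_head | apply: IHr => j jr; apply: fx; rewrite inE jr orbT].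
Qed.

Lemma cell_scale (a y v : R) : 0 < a ->
  y / a <= v < y / a + a^-1 -> y <= v * a < y + 1.
Proof.
move=> a0; rewrite (_ : y / a + a^-1 = (y + 1) / a); last by rewrite mulrDl mul1r.
by rewrite ler_pdivrMr // ltr_pdivlMr.
Qed.

(** The cells of [packing] have probabilities that add up. Since N <= a, their coordinates in [H]
    stay bounded by [Bd], where the density is at least [kap]. Radius 2 covers a unit cell: an error
    of 1 in the real part and 1 in the imaginary part. *)
Lemma gram_det_le_prob_lower (j : nat) : (j < minn Mr Mt)%N ->
  exists (kappa C : R), [/\ 0 < kappa, 0 < C & forall (a : R) (N q : nat) (B : set R),
    0 < a -> (0 < q)%N -> (q <= N)%N -> N%:R <= a -> 1 <= a -> measurable B ->
    exists S : set T, [/\ measurable S,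
      forall x, S x -> B (G x) /\
        gram_det ((Complex a 0) *: chanH Hre Him x) <= C * (N%:R ^+ j * q%:R) ^+ 2
    & ((kappa * (N%:R ^+ (2 * (j * (Mr + Mt - j))) * q%:R ^+ (2 * (Mr + Mt - 2 * j - 1))
                 * a^-1 ^+ (2 * (Mr * Mt))))%:E * P (G @^-1` B) <= P S)%E]].
Proof.
move=> jmn; have [C [B0 [C0 B00 pack]]] := @packing R Mr Mt 2 j jmn.
pose Bd := B0 + 1.
pose kap := normal_peak sigma * expR (- Bd ^+ 2).
have kap0 : 0 < kap by rewrite mulr_gt0 ?expR_gt0 ?normal_peak_sigma_gt0.
exists (kap ^+ (2 * (Mr * Mt))), (Mr`!%:R * (((Mr + Mt)%:R * C ^+ 2) ^+ Mr) + 1); split.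
- exact: exprn_gt0.
- by rewrite ltr_wpDl // mulr_ge0 // exprn_ge0 // mulr_ge0 // sqr_ge0.
move=> a N q B a0 q0 qN Na a1 mB.
have [s [s_uniq s_size s_int sP]] := pack N q q0 qN.
pose lo (Y : 'M[R[i]]_(Mr, Mt)) (k : 'I_Mr * 'I_Mt * bool) : R :=
  if k.2 then complex.Im (Y k.1.1 k.1.2) else complex.Re (Y k.1.1 k.1.2).
(* Half-open intervals of length 1 in [X], based at integers: distinct centres give disjoint
   boxes. *)
pose A Y (k : 'I_Mr * 'I_Mt * bool) : set R :=
  `[lo Y k / a, lo Y k / a + a^-1[%classic.
have mA Y k : measurable (A Y k) by exact: measurable_itv.
exists (\big[setU/set0]_(Y <- s) box (A Y) B); split.
- by apply: bigsetU_measurable => ? _; exact: measurable_box.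
- move=> x; rewrite -bigcup_seq => -[Y /= Ys [AY Bx]]; split => //.
  pose X : 'M[R[i]]_(Mr, Mt) := Complex a 0 *: chanH Hre Him x.
  have XE i l : X i l = Complex (a * Hre i l x) (a * Him i l x).
    by rewrite !mxE -[LHS]/(Complex _ _) !mul0r subr0 addr0.
  have near k : `|a * rv (Some k) x - lo Y k| <= 1.
    have := AY k; rewrite /A /= in_itv /= => /(cell_scale a0) /andP[h1 h2].
    by rewrite ger0_norm; lra.
  have := sP Y Ys X; case=> [i l|L LP].
    apply: le_trans (normc_le_ReIm _) _; rewrite XE.
    have h1 := near (i, l, false); have h2 := near (i, l, true).
    by move: h1 h2; rewrite /lo /=; case: (Y i l) => y1 y2 /=; lra.
  have := reducible_gram_det C0 (ex_intro _ L LP).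
  move=> h; apply: le_trans h _; rewrite mulrA; apply: ler_wpM2r; first exact: sqr_ge0.
  by rewrite lerDl.
rewrite measure_bigsetU_disj //; [|by move=> Y; exact: measurable_box|]; last first.
  move=> Y Y' Ys Y's [x [[AY _] [AY' _]]]; apply/matrixP => i l.
  have intE (y y' : R) v : y \is a Num.int -> y' \is a Num.int ->
     y / a <= v < y / a + a^-1 -> y' / a <= v < y' / a + a^-1 -> y = y'.
    move=> /intrP[z ->] /intrP[z' ->].
    move=> /(cell_scale a0) /andP[h1 h2] /(cell_scale a0) /andP[h3 h4].
    have zz' : (z < z' + 1)%R by rewrite -(ltr_int R) intrD; lra.
    have z'z : (z' < z + 1)%R by rewrite -(ltr_int R) intrD; lra.
    by congr (_%:~R); clear -zz' z'z; lia.
  have h1 := AY (i, l, false); have h2 := AY (i, l, true).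
  have h3 := AY' (i, l, false); have h4 := AY' (i, l, true).
  rewrite /A /lo /= in_itv /= in h1 h2 h3 h4.
  have [/andP[i1 i2] _] := s_int Y Ys i l; have [/andP[i3 i4] _] := s_int Y' Y's i l.
  have hre := intE _ _ _ i1 i3 h1 h3; have him := intE _ _ _ i2 i4 h2 h4.
  by move: hre him; case: (Y i l) => y1 y2; case: (Y' i l) => y3 y4 /= -> ->.
have a10 : 0 <= a^-1 by rewrite invr_ge0 ltW.
have A_ge Y k : Y \in s -> ((kap * a^-1)%:E <= P (rv (Some k) @^-1` A Y k))%E.
  move=> Ys; rewrite rv_law //; apply: normal_prob_itv_ge => //.
    have [_ YB] := s_int Y Ys k.1.1 k.1.2.
    have loB : `|lo Y k| <= B0 * N%:R.
      by rewrite /lo; case: ifP => _; apply: le_trans YB; rewrite ?Re_le_normc ?Im_le_normc.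
    rewrite ler_pdivlMr // /Bd; move: loB; rewrite ler_norml => /andP[h1 h2].
    by nra.
  have [_ YB] := s_int Y Ys k.1.1 k.1.2.
  have loB : `|lo Y k| <= B0 * N%:R.
    by rewrite /lo; case: ifP => _; apply: le_trans YB; rewrite ?Re_le_normc ?Im_le_normc.
  rewrite (_ : _ / a + _ = (lo Y k + 1) / a); last by rewrite mulrDl mul1r.
  rewrite ler_pdivrMr // /Bd; move: loB; rewrite ler_norml => /andP[h1 h2].
  by nra.
pose x := (((kap * a^-1) ^+ (Mr * Mt * 2))%:E * P (G @^-1` B))%E.
apply: (@le_trans _ _ ((size s)%:R%:E * x)%E); last apply: lee_sum_cst_ge.
- rewrite muleA -EFinM; apply: lee_wpmul2r => //; rewrite lee_fin s_size natrM !natrX.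
  by rewrite le_eqVlt; apply/orP; left; apply/eqP; rewrite [(Mr * Mt * 2)%N]mulnC [(kap * _) ^+ _]exprMn; ring.
- by rewrite mule_ge0 // lee_fin exprn_ge0 // mulr_ge0 // ltW.
move=> Y Ys; apply: box_prob_ge => //; first by rewrite mulr_ge0 // ltW.
by move=> k; exact: A_ge.
Qed.

Lemma G_neg : P (G @^-1` [set x | x < 0]) = 0%E.
Proof.
case: hmodel => _ _ _ GE _; rewrite GE ?exponential_prob_neg //.
rewrite (_ : mkset _ = `]-oo, 0[%classic) //.
Qed.

Lemma G_le t : 0 < t -> (P (G @^-1` `[0%R, t]) <= t%:E)%E.
Proof. by case: hmodel => _ _ _ GE _ t0; rewrite GE //; exact: exponential_prob_le. Qed.

Lemma G_ge t : 0 < t -> t <= 1 -> ((t / 2)%:E <= P (G @^-1` `[0%R, t]))%E.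
Proof. by case: hmodel => _ _ _ GE _ t0 t1; rewrite GE //; exact: exponential_prob_ge. Qed.

End Boxes.

(** * Estimates for large rho and the lines of the tradeoff *)

Section Asymptotics.
Variable R : realType.

Lemma near_ln (K : R) : \forall rho \near +oo, K <= ln rho /\ 1 < rho.
Proof.
near=> rho.
have rho1 : 1 < rho by near: rho; apply: nbhs_pinfty_gt; rewrite num_real.
have rhoK : expR K <= rho by near: rho; apply: nbhs_pinfty_ge; rewrite num_real.
have rho0 : 0 < rho by lra.
by split => //; rewrite -[K]expRK ler_ln ?posrE ?expR_gt0.
Unshelve. all: by end_near. Qed.

Lemma near_cst_le (c e : R) : 0 < e -> \forall rho \near +oo, c <= expR (e * ln rho).
Proof.
move=> e0; apply: filterS (near_ln (c / e)) => rho [h _].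
have := expR_ge1Dx (e * ln rho); rewrite ler_pdivrMr // mulrC in h; lra.
Qed.

Lemma near_exp_le (c e : R) : 0 < e -> \forall rho \near +oo, c * ln rho <= expR (e * ln rho).
Proof.
move=> e0; apply: filterS (near_ln (Num.max 0 (2 * c / e ^+ 2))) => rho [h _].
set l := ln rho in h *.
have l0 : 0 <= l by apply: le_trans h; rewrite le_max lexx.
have lc : 2 * c / e ^+ 2 <= l by apply: le_trans h; rewrite le_max lexx orbT.
have := @expR_ge1Dxn R (e * l) 1 (mulr_ge0 (ltW e0) l0).
rewrite ler_pdivrMr ?exprn_gt0 // in lc.
rewrite (_ : 2`!%:R = 2) // => hx.
have : c * l <= (e * l) ^+ 2 / 2 by nra.
lra.
Qed.

Lemma truncn_ge_half (x : R) : 1 <= x -> x / 2 <= (Num.truncn x)%:R.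
Proof.
move=> x1; have x0 : 0 <= x by lra.
have /andP[h1 h2] := truncn_itv x0.
have t1 : (1 <= Num.truncn x)%N by rewrite truncn_ge_nat.
have : 1 <= (Num.truncn x)%:R :> R by rewrite ler1n.
by rewrite -natr1 in h2; lra.
Qed.

Definition slope (m n j : nat) : R := (m + n - 2 * j - 1)%:R.

Lemma slope_gt0 m n j : (j < minn n m)%N -> 0 < slope m n j.
Proof. by move=> jmn; rewrite ltr0n; lia. Qed.

(** The slopes are the successive differences of (m-i)(n-i), so the sum telescopes and [dmt] equals
    (m-i)(n-i) at an integer i up to [M]. This form matches the exponents of the cell counts. *)
Lemma dmt_line m n j (s : R) : (j < minn n m)%N -> j%:R <= s -> s <= j.+1%:R ->
  dmt (minn n m) (slope m n) s =
  (m * n)%:R - s * (m + n - 2 * j - 1)%:R - (j * j.+1)%:R.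
Proof.
move=> jmn js sj; set M := minn n m in jmn *.
have slopeE i : (i < M)%N -> slope m n i =
    - ((m%:R - i.+1%:R) * (n%:R - i.+1%:R)) - - ((m%:R - i%:R) * (n%:R - i%:R)) :> R.
  move=> iM; have -> : slope m n i = m%:R + n%:R - 2 * i%:R - 1.
    have h : (2 * i + 1 <= m + n)%N by rewrite /M in iM; lia.
    rewrite /slope -subnDA natrB // natrD [(2 * i + 1)%:R]natrD [(2 * i)%:R]natrM; ring.
  by rewrite -natr1; ring.
rewrite /dmt -(big_mkord xpredT (fun i => slope m n i * (i.+1%:R - clamp i s))).
rewrite (@big_cat_nat _ _ _ j.+1 0%N M) //= big_nat_recr //=.
rewrite big_nat_cond big1 ?add0r; last first.
  move=> i /andP[/andP[_ ij] _]; rewrite clamp_hi ?subrr ?mulr0 //.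
  by apply: le_trans js; rewrite ler_nat.
rewrite (@eq_big_nat _ _ _ _ _ _ (fun i => - ((m%:R - i.+1%:R) * (n%:R - i.+1%:R)) -
    - ((m%:R - i%:R) * (n%:R - i%:R)))); last first.
  move=> i /andP[ji iM]; rewrite clamp_lo; last by apply: le_trans sj _; rewrite ler_nat.
  by rewrite -natr1 addrAC subrr add0r mulr1 slopeE // natr1.
rewrite telescope_sumr // clamp_id // slopeE //.
have -> : (m%:R - M%:R) * (n%:R - M%:R) = 0 :> R.
  by rewrite /M /minn; case: ltnP => _; rewrite subrr ?mulr0 ?mul0r.
have -> : (m + n - 2 * j - 1)%:R = slope m n j :> R by [].
by rewrite slopeE // !natrM -natr1; ring.
Qed.

End Asymptotics.

(** * Exponents of the outage probability *)

Section OutageExponent.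
Variables (R : realType) (d : measure_display) (T : measurableType d).
Variables (P : probability T R) (Mr Mt : nat).
Variables (Hre Him : 'I_Mr -> 'I_Mt -> T -> R) (G : T -> R).
Hypothesis hmodel : channel_model P Hre Him G.
Let M := minn Mt Mr.
Hypothesis M_gt0 : (0 < M)%N.

Definition chan_det (rho : R) (x : T) : R :=
  complex.Re (\det (1%:M + (Complex (rho / M%:R) 0) *:
    (chanH Hre Him x *m map_mx conjc (chanH Hre Him x)^T))).

Lemma chan_detE rho x : 0 < rho ->
  chan_det rho x = gram_det (Complex (Num.sqrt (rho / M%:R)) 0 *: chanH Hre Him x).
Proof.
move=> rho0; rewrite /chan_det /gram_det.
set a := Num.sqrt _; have aa : a * a = rho / M%:R.
  by rewrite -expr2 sqr_sqrtr // divr_ge0 // ltW.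
congr (complex.Re (\det (_ + _))).
rewrite linearZ /= map_mxZ -scalemxAl -scalemxAr scalerA; congr (_ *: _).
by rewrite -[RHS]/(Complex _ _) /= !(mul0r, mulr0, oppr0, subr0, addr0) aa.
Qed.

Lemma sqrt_rho (rho : R) : 0 < rho -> Num.sqrt rho = expR (ln rho / 2).
Proof.
move=> rho0; apply/eqP; rewrite -(eqrXn2 (n := 2)) ?sqrtr_ge0 ?expR_ge0 //.
rewrite sqr_sqrtr ?ltW // expr2 -expRD (_ : _ + _ = ln rho) ?lnK ?posrE //; lra.
Qed.

(** Here a is of order rho^(1/2) and c of order rho^(1/2+eta). The tail e^(-c/(2a)) is then below
    rho^(-mn), while c^(2f) exceeds rho^f only by rho^(2 f eta) and a constant. *)
Lemma outage_upper (s e : R) : 0 < e -> 0 <= s ->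
  \forall rho \near +oo, forall B : set R, measurable B -> exists S : set T,
    [/\ measurable S,
      forall x, chan_det rho x <= expR (s * ln rho) -> B (G x) -> S x
    & (P S <= (expR ((e - dmt M (slope R Mr Mt) s) * ln rho))%:E * P (G @^-1` B))%E].
Proof.
move=> e0 s0.
have [Ms|sM] := leP M%:R s.
  apply: filterS (near_ln 0) => rho [l0 rho1] B mB; exists (G @^-1` B); split => //.
    exact: (measurable_preG hmodel).
  rewrite dmt_top // subr0 -[leLHS]mul1e; apply: lee_wpmul2r => //.
  by rewrite lee_fin -expR0 ler_expR mulr_ge0 // ltW.
pose j := Num.truncn s.
have /andP[js sj] := truncn_itv s0; rewrite -/j in js sj.
have jM : (j < M)%N by rewrite -(ltr_nat R); apply: le_lt_trans js sM.
have jM' : (j < minn Mr Mt)%N by rewrite minnC.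
have [kappa kappa0 ub] := gram_det_le_prob hmodel jM'.
rewrite (dmt_line jM js (ltW sj)).
set p := (Mr + Mt - 2 * j - 1)%N in ub *; set f := (j * j.+1)%N in ub *.
set mn := (Mr * Mt)%N in ub *.
(* Chosen so that 2 f eta <= e/2; the other half of [e] absorbs constants. Adding 1 avoids dividing
   by 0 when j = 0. *)
pose eta := e / (4 * (f%:R + 1)).
have f0 : 0 <= f%:R :> R by [].
have eta0 : 0 < eta by rewrite divr_gt0 // mulr_gt0 //; lra.
have eta_le : 2 * f%:R * eta <= e / 2.
  rewrite /eta mulrA ler_pdivrMr; last by lra.
  by nra.
pose K := kappa * (4 ^+ f * M%:R ^+ mn + 1).
near=> rho.
have [l0 rho1] : 0 <= ln rho /\ 1 < rho by near: rho; exact: near_ln.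
have Kl : K <= expR (e / 2 * ln rho) by near: rho; apply: near_cst_le; lra.
have tl : (2 * mn%:R) * ln rho <= expR (eta * ln rho) by near: rho; exact: near_exp_le.
move=> B mB; set l := ln rho in l0 Kl tl *.
have rho0 : 0 < rho by lra.
pose a := Num.sqrt (rho / M%:R).
have MR : 0 < M%:R :> R by rewrite ltr0n.
have a0 : 0 < a by rewrite sqrtr_gt0 divr_gt0.
pose w := expR ((2^-1 + eta) * l).
have w1 : 1 <= w by rewrite -expR0 ler_expR mulr_ge0 // addr_ge0 // ltW.
pose c := (Num.truncn w).+1.
have /andP[wc cw] := truncn_itv (le_trans ler01 w1).
have cw2 : c%:R <= 2 * w by rewrite /c -natr1; lra.
have c0 : (0 < c)%N by [].
have [S [mS SP PS]] := ub a c (expR (s * l)) B a0 c0 (expR_gt0 _) mB.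
exists S; split; [exact: mS | by move=> x; rewrite chan_detE //; exact: SP |].
apply: le_trans PS _; apply: lee_wpmul2r => //; rewrite lee_fin.
have aw : a <= expR (l / 2).
  rewrite -sqrt_rho // ler_sqrt; last exact: ltW.
  by rewrite ler_pdivrMr // ler_peMr ?ler1n // ltW.
have tail : expR (- (c%:R / (2 * a))) <= expR (- (mn%:R * l)).
  rewrite ler_expR lerN2 ler_pdivlMr; last by rewrite mulr_gt0.
  apply: (@le_trans _ _ w); last by rewrite /c ltW.
  have -> : w = expR (eta * l) * expR (l / 2) by rewrite /w -expRD; congr expR; lra.
  apply: (@le_trans _ _ ((2 * mn%:R * l) * a)); first by rewrite le_eqVlt; apply/orP; left; apply/eqP; ring.
  by apply: ler_pM => //; rewrite ?mulr_ge0 // ltW.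
have a2 : a^-1 ^+ (2 * mn) = M%:R ^+ mn * expR (- (mn%:R * l)).
  rewrite exprM exprVn sqr_sqrtr; last by rewrite divr_ge0 // ltW.
  rewrite invf_div exprMn exprVn; congr (_ * _).
  by rewrite -[in LHS](lnK (x := rho)) ?posrE // -expRM_natl mulr_natl expRN.
have c2 : c%:R ^+ (2 * f) <= 4 ^+ f * expR ((1 + 2 * eta) * f%:R * l).
  rewrite exprM; apply: (@le_trans _ _ ((4 * expR ((1 + 2 * eta) * l)) ^+ f)).
    apply: lerXn2r; rewrite ?nnegrE ?exprn_ge0 // ?mulr_ge0 ?expR_ge0 //.
    apply: (@le_trans _ _ ((2 * w) ^+ 2)).
      by apply: lerXn2r; rewrite ?nnegrE // mulr_ge0 // expR_ge0.
    rewrite exprMn /w [expR _ ^+ 2]expr2 -expRD (_ : 2 ^+ 2 = 4); last by ring.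
    by rewrite le_eqVlt; apply/orP; left; apply/eqP; congr (_ * expR _); lra.
  by rewrite exprMn -expRM_natl -mulrA mulrCA mulr_natl.
rewrite a2; set E := expR (- (mn%:R * l)) in tail *.
have tp : expR (s * l) ^+ p = expR (s * p%:R * l).
  by rewrite -expRM_natl -mulr_natl; congr expR; ring.
rewrite tp; set D := mn%:R - s * p%:R - f%:R.
have bound1 : expR (s * p%:R * l) * c%:R ^+ (2 * f) * (M%:R ^+ mn * E) <=
    4 ^+ f * M%:R ^+ mn * expR ((e / 2 - D) * l).
  apply: (@le_trans _ _ (expR (s * p%:R * l) * (4 ^+ f * expR ((1 + 2 * eta) * f%:R * l)) *
      (M%:R ^+ mn * E))).
    apply: ler_wpM2r; first by rewrite mulr_ge0 ?exprn_ge0 ?expR_ge0.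
    by apply: ler_wpM2l; rewrite ?expR_ge0.
  rewrite (_ : _ * _ = 4 ^+ f * M%:R ^+ mn * (expR (s * p%:R * l) *
    (expR ((1 + 2 * eta) * f%:R * l) * E))); last by ring.
  apply: ler_wpM2l; first by rewrite mulr_ge0 ?exprn_ge0.
  rewrite /E -!expRD ler_expR /D.
  have : 2 * f%:R * eta * l <= e / 2 * l by exact: ler_wpM2r.
  lra.
have D_le : D <= mn%:R by rewrite /D; have := mulr_ge0 s0 (ler0n R p); lra.
have bound2 : expR (- (c%:R / (2 * a))) <= expR ((e / 2 - D) * l).
  apply: le_trans tail _; rewrite /E ler_expR.
  have : D * l <= mn%:R * l by exact: ler_wpM2r.
  have : 0 <= e / 2 * l by rewrite mulr_ge0 //; lra.
  lra.
apply: (@le_trans _ _ (K * expR ((e / 2 - D) * l))).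
  rewrite /K -[leRHS]mulrA; apply: ler_wpM2l => //; rewrite [leRHS]mulrDl mul1r; exact: lerD.
apply: (@le_trans _ _ (expR (e / 2 * l) * expR ((e / 2 - D) * l))).
  by apply: ler_wpM2r => //; exact: expR_ge0.
by rewrite -expRD ler_expR; lra.
Unshelve. all: by end_near. Qed.

(** With N of order rho^(1/2) and q of order rho^((s-j)/2), the determinant is O((N^j q)^2), of
    order rho^s. The count divided by rho^(mn) has exponent j(m+n-j) + (s-j)p - mn, which is - dmt
    s. *)
Lemma outage_lower (s e : R) : 0 < e -> 0 < s -> s <= M%:R ->
  \forall rho \near +oo, forall B : set R, measurable B -> exists S : set T,
    [/\ measurable S,
      forall x, S x -> B (G x) /\ chan_det rho x <= expR (s * ln rho)
    & ((expR (- (dmt M (slope R Mr Mt) s + e) * ln rho))%:E * P (G @^-1` B) <= P S)%E].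
Proof.
move=> e0 s0 sM.
(* The intervals are open on the left: s > j makes q grow with rho, so truncation costs at most a
   factor 2. *)
have [j [js sj]] : exists j : nat, j%:R < s /\ s <= j.+1%:R.
  have /andP[] := truncn_itv (ltW s0); set t := Num.truncn s => h1 h2.
  have [ts|ts|ts] := ltgtP t%:R s.
  - by exists t; rewrite ltW.
  - by move: (lt_le_trans ts h1); rewrite ltxx.
  - move: ts {h1 h2}; case: t => [|t] ts; first by move: s0; rewrite -ts ltxx.
    by exists t; rewrite -ts ltr_nat.
have jM : (j < M)%N by rewrite -(ltr_nat R); apply: lt_le_trans js sM.
have jM' : (j < minn Mr Mt)%N by rewrite minnC.
have jle : (2 * j + 1 <= Mr + Mt)%N by clear -jM'; lia.
have jle' : (j <= Mr + Mt)%N by clear -jM'; lia.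
have [kappa [C [kappa0 C0 lb]]] := gram_det_le_prob_lower hmodel jM'.
rewrite (dmt_line jM (ltW js) sj).
set p := (Mr + Mt - 2 * j - 1)%N in lb *; set f := (j * j.+1)%N.
set mn := (Mr * Mt)%N in lb *; set g := (j * (Mr + Mt - j))%N in lb.
have MR : 0 < M%:R :> R by rewrite ltr0n.
(* k0 <= 1/sqrt M ensures w <= a, hence q <= N; and C k0^2 <= 1 brings the determinant below rho^s
   itself. *)
pose k0 : R := (Num.sqrt (M%:R + C))^-1.
have sMC : 0 < Num.sqrt (M%:R + C) by rewrite sqrtr_gt0 addr_gt0.
have k00 : 0 < k0 by rewrite invr_gt0.
have k02 : k0 ^+ 2 = (M%:R + C)^-1 by rewrite exprVn sqr_sqrtr // ltW // addr_gt0.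
pose K := kappa * ((2 * Num.sqrt M%:R)^-1 ^+ (2 * g) * (k0 / 2) ^+ (2 * p) * M%:R ^+ mn).
have sM0 : 0 < Num.sqrt M%:R :> R by rewrite sqrtr_gt0.
have K0 : 0 < K.
  by rewrite /K !mulr_gt0 ?exprn_gt0 ?divr_gt0 ?invr_gt0 ?mulr_gt0.
have sj0 : 0 < (s - j%:R) / 2 by rewrite divr_gt0 // subr_gt0.
near=> rho.
have [l0 rho1] : 0 <= ln rho /\ 1 < rho by near: rho; exact: near_ln.
have Kl : K^-1 <= expR (e * ln rho) by near: rho; exact: near_cst_le.
have ql : k0^-1 <= expR ((s - j%:R) / 2 * ln rho) by near: rho; exact: near_cst_le.
have Ml : Num.sqrt M%:R <= expR (2^-1 * ln rho).
  by near: rho; apply: near_cst_le; rewrite invr_gt0.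
move=> B mB; set l := ln rho in l0 Kl ql Ml *.
have rho0 : 0 < rho by lra.
pose a := Num.sqrt (rho / M%:R).
have a0 : 0 < a by rewrite sqrtr_gt0 divr_gt0.
have aE : a = expR (l / 2) / Num.sqrt M%:R.
  by rewrite /a sqrtrM ?ltW // sqrtrV ?ltW // sqrt_rho.
have a1 : 1 <= a by rewrite aE ler_pdivlMr // mul1r [l / 2]mulrC.
pose w := k0 * expR ((s - j%:R) / 2 * l).
have w1 : 1 <= w by rewrite /w -ler_pdivrMl // mulr1.
have wa : w <= a.
  rewrite /w aE mulrC; apply: ler_pM; rewrite ?expR_ge0 //; first exact: ltW.
    by rewrite ler_expR [l / 2]mulrC; apply: ler_wpM2r => //; rewrite -natr1 in sj; lra.
  by rewrite /k0 lef_pV2 ?posrE // ler_sqrt ?addr_ge0 ?lerDl // ltW.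
pose N := Num.truncn a; pose q := Num.truncn w.
have q0 : (0 < q)%N by rewrite /q truncn_ge_nat // (le_trans ler01).
have qN : (q <= N)%N by exact: le_truncn.
have Na : N%:R <= a by rewrite truncn_le // ltW.
have qw : q%:R <= w by have := truncn_le w; rewrite (le_trans ler01 w1).
have [S [mS SP PS]] := lb a N q B a0 q0 qN Na a1 mB.
exists S; split; first exact: mS.
  move=> x /SP[Bx det_le]; split => //; rewrite chan_detE //; apply: le_trans det_le _.
  have Nw : N%:R ^+ j * q%:R <= expR (l / 2) ^+ j * w.
    apply: ler_pM; rewrite ?exprn_ge0 //; apply: lerXn2r; rewrite ?nnegrE ?expR_ge0 //.
    apply: le_trans Na _; rewrite aE ler_pdivrMr // ler_peMr ?expR_ge0 //.
    by rewrite -[leLHS]sqrtr1 ler_sqrt // ler1n.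
  apply: (@le_trans _ _ (C * (expR (l / 2) ^+ j * w) ^+ 2)).
    apply: ler_wpM2l; first exact: ltW.
    by apply: lerXn2r; rewrite ?nnegrE ?mulr_ge0 ?exprn_ge0 ?expR_ge0 // ltW.
  have -> : C * (expR (l / 2) ^+ j * w) ^+ 2 = C * k0 ^+ 2 * expR (s * l).
    rewrite /w exprMn [(k0 * _) ^+ 2]exprMn -exprM -!expRM_natl.
    rewrite (_ : s * l = (j * 2)%:R * (l / 2) + 2%:R * ((s - j%:R) / 2 * l)).
      by rewrite expRD; ring.
    by rewrite natrM; field.
  rewrite ger_pMl ?expR_gt0 // k02 ler_pdivrMr ?addr_gt0 // mul1r lerDr; exact: ltW.
apply: le_trans PS; apply: lee_wpmul2r => //; rewrite lee_fin.
have a2 : a^-1 ^+ (2 * mn) = M%:R ^+ mn * expR (- (mn%:R * l)).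
  rewrite exprM exprVn sqr_sqrtr; last by rewrite divr_ge0 // ltW.
  rewrite invf_div exprMn exprVn; congr (_ * _).
  by rewrite -[in LHS](lnK (x := rho)) ?posrE // -expRM_natl mulr_natl expRN.
have N2 : (2 * Num.sqrt M%:R)^-1 ^+ (2 * g) * expR (g%:R * l) <= N%:R ^+ (2 * g).
  have -> : expR (g%:R * l) = expR (l / 2) ^+ (2 * g).
    by rewrite -expRM_natl natrM; congr expR; field.
  rewrite -exprMn; apply: lerXn2r; rewrite ?nnegrE ?mulr_ge0 ?expR_ge0 ?invr_ge0 ?mulr_ge0 ?sqrtr_ge0 //.
  apply: le_trans (truncn_ge_half a1); rewrite aE invfM.
  by rewrite le_eqVlt; apply/orP; left; apply/eqP; ring.
have q2 : (k0 / 2) ^+ (2 * p) * expR ((s - j%:R) * p%:R * l) <= q%:R ^+ (2 * p).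
  have -> : expR ((s - j%:R) * p%:R * l) = expR ((s - j%:R) / 2 * l) ^+ (2 * p).
    by rewrite -expRM_natl natrM; congr expR; field.
  rewrite -exprMn; apply: lerXn2r; rewrite ?nnegrE ?mulr_ge0 ?expR_ge0 ?invr_ge0 ?(ltW k00) //.
  apply: le_trans (truncn_ge_half w1); rewrite /w.
  by rewrite le_eqVlt; apply/orP; left; apply/eqP; ring.
rewrite a2.
apply: (@le_trans _ _ (kappa * ((2 * Num.sqrt M%:R)^-1 ^+ (2 * g) * expR (g%:R * l) *
   ((k0 / 2) ^+ (2 * p) * expR ((s - j%:R) * p%:R * l)) *
   (M%:R ^+ mn * expR (- (mn%:R * l)))))); last first.
  apply: ler_wpM2l; first exact: ltW.
  apply: ler_wpM2r; first by rewrite mulr_ge0 ?exprn_ge0 ?expR_ge0.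
  apply: ler_pM => //; rewrite mulr_ge0 ?expR_ge0 // exprn_ge0 // ?divr_ge0 ?invr_ge0 ?mulr_ge0 //; exact: ltW.
rewrite [leRHS](_ : _ = K * (expR (g%:R * l) * (expR ((s - j%:R) * p%:R * l) * expR (- (mn%:R * l))))); last first.
  by rewrite /K; ring.
rewrite -!expRD.
have -> : g%:R * l + ((s - j%:R) * p%:R * l - mn%:R * l) = - (mn%:R - s * p%:R - f%:R) * l.
  have pE : p%:R = Mr%:R + Mt%:R - 2 * j%:R - 1 :> R.
    by rewrite /p -subnDA natrB // natrD [(2 * j + 1)%:R]natrD [(2 * j)%:R]natrM; ring.
  have gE : g%:R = j%:R * (Mr%:R + Mt%:R - j%:R) :> R.
    by rewrite /g natrM natrB ?natrD.
  by rewrite gE pE /f [(j * j.+1)%:R]natrM -[j.+1%:R]natr1; ring.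
set D := mn%:R - _ - _.
have -> : - (D + e) * l = - (e * l) + - D * l by ring.
rewrite expRD; apply: ler_wpM2r; first exact: expR_ge0.
by rewrite expRN -[K]invrK lef_pV2 ?posrE ?expR_gt0 ?invr_gt0.
Unshelve. all: by end_near. Qed.

End OutageExponent.

(** * Distortion exponent for fixed rates *)

Section IntegralBounds.
Context d (T : measurableType d) (R : realType) (P : probability T R).
Local Open Scope ereal_scope.

(** The integral of a nonnegative function is a supremum over the simple functions below it, so
    monotonicity holds for arbitrary functions. *)
Lemma integralT_mono (f g : T -> \bar R) :
  (forall x, 0 <= f x) -> (forall x, f x <= g x) ->
  \int[P]_x f x <= \int[P]_x g x.
Proof.
move=> f0 fg; have g0 x : 0 <= g x by apply: le_trans (fg x).
rewrite !ge0_integralTE //; apply: ereal_sup_le => _ [h hf <-].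
by exists h => // x; apply: le_trans (fg x).
Qed.

(* On the null event [Gamma < 0] the distortion may be negative, and it is not known to be
   measurable; it is therefore bounded there by [+oo]. *)
Lemma integral_null_infty (Z : set T) : measurable Z -> P Z = 0 ->
  \int[P]_x (+oo * (\1_Z x)%:E) = 0.
Proof.
move=> mZ PZ; rewrite ge0_integralZl //.
- by rewrite integral_indic // setIT [X in _ * X](PZ : P Z = 0) mule0.
- by apply/measurable_EFinP; exact: measurable_indic.
Qed.

Lemma integral_funepos (Z : set T) (f : T -> R) :
  measurable Z -> P Z = 0 -> (forall x, ~ Z x -> (0 <= f x)%R) ->
  \int[P]_x (f x)%:E = \int[P]_x (EFin \o f)^\+ x.
Proof.
move=> mZ PZ f0.
rewrite integralE (_ : \int[P]_x (EFin \o f)^\- x = 0) ?sube0 //.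
apply/eqP; rewrite eq_le integral_ge0 ?andbT; last by move=> x _; exact: funeneg_ge0.
rewrite -(integral_null_infty mZ PZ); apply: integralT_mono => x; first exact: funeneg_ge0.
have [Zx|nZx] := pselect (Z x).
  by rewrite indicE mem_set // mule1 leey.
rewrite indicE memNset // mule0 funenegE ge_max lexx andbT /= lee_fin oppr_le0.
exact: f0.
Qed.

(** The dominating step function is made infinite on [Z], which constrains [f] only off [Z] and
    leaves the integral unchanged. *)
Lemma integral_cover_le (K : Type) (s : seq K) (w : K -> R) (S : K -> set T)
    (Z : set T) (f : T -> R) :
  measurable Z -> P Z = 0 -> (forall k, measurable (S k)) -> (forall k, (0 <= w k)%R) ->
  (forall x, ~ Z x -> (0 <= f x <= \sum_(k <- s) w k * \1_(S k) x)%R) ->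
  0 <= \int[P]_x (f x)%:E <= \sum_(k <- s) (w k)%:E * P (S k).
Proof.
move=> mZ PZ mS w0 fP.
have mw k : measurable_fun setT (fun x => (w k * \1_(S k) x)%:E).
  by apply/measurable_EFinP; apply: measurable_funM => //; exact: measurable_indic.
have f0 x : ~ Z x -> (0 <= f x)%R by move=> /fP /andP[].
rewrite (integral_funepos mZ PZ f0); apply/andP; split.
  by apply: integral_ge0 => x _; exact: funepos_ge0.
pose h x := (\sum_(k <- s) (w k * \1_(S k) x)%:E) + (+oo * (\1_Z x)%:E).
have h0 x : 0 <= \sum_(k <- s) (w k * \1_(S k) x)%:E.
  by apply: sume_ge0 => k _; rewrite lee_fin mulr_ge0.
apply: (@le_trans _ _ (\int[P]_x h x)).
  apply: integralT_mono => x; first exact: funepos_ge0.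
  rewrite /h; have [Zx|nZx] := pselect (Z x).
    by rewrite indicE mem_set // mule1 addey ?leey // gt_eqF // (lt_le_trans _ (h0 x)) // ltNy0.
  rewrite [\1_Z x]indicE memNset // mule0 adde0 funeposE ge_max h0 andbT sumEFin lee_fin.
  by have /andP[] := fP x nZx.
have mZoo : measurable_fun setT (fun x => +oo * (\1_Z x : R)%:E).
  by apply: (@measurable_funeM _ T R setT (fun x => (\1_Z x)%:E) +oo); apply/measurable_EFinP; exact: measurable_indic.
rewrite /h ge0_integralD //; last first.
  exact: emeasurable_sum.
rewrite integral_null_infty // adde0 ge0_integral_sum //; last by move=> k x _; rewrite lee_fin mulr_ge0.
apply: lee_sum => k _; under eq_integral do rewrite EFinM.
rewrite ge0_integralZl // ?lee_fin //.
- by rewrite integral_indic // setIT.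
- by apply/measurable_EFinP; exact: measurable_indic.
Qed.

Lemma integral_ge_on (S : set T) (f : T -> R) (v : R) (Z : set T) :
  measurable Z -> P Z = 0 -> measurable S -> (0 <= v)%R ->
  (forall x, ~ Z x -> (0 <= f x)%R) -> (forall x, ~ Z x -> S x -> (v <= f x)%R) ->
  v%:E * P S <= \int[P]_x (f x)%:E.
Proof.
move=> mZ PZ mS v0 f0 fv.
rewrite (integral_funepos mZ PZ f0); have mSZ : measurable (S `\` Z) by exact: measurableD.
have PSZ : P S <= P (S `\` Z).
  apply: le_trans (_ : P ((S `\` Z) `|` Z) <= _).
    by rewrite le_measure ?inE //; [exact: measurableU | move=> x Sx; have [Zx|nZx] := pselect (Z x); [right|left]].
  by apply: le_trans (measureU2 _ mSZ mZ) _; rewrite [X in _ + X](PZ : P Z = 0) adde0.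
apply: (@le_trans _ _ (v%:E * P (S `\` Z))); first exact: lee_wpmul2l.
have -> : v%:E * P (S `\` Z) = \int[P]_x (v%:E * (\1_(S `\` Z) x : R)%:E).
  rewrite ge0_integralZl // ?lee_fin //; first by rewrite integral_indic // setIT.
  by apply/measurable_EFinP; exact: measurable_indic.
apply: integralT_mono => x; first by rewrite -EFinM lee_fin mulr_ge0.
have [[Sx nZx]|nSZ] := pselect ((S `\` Z) x).
  by rewrite indicE mem_set //= mule1 funeposE le_max /= lee_fin fv.
by rewrite indicE memNset //= mule0 funepos_ge0.
Qed.
End IntegralBounds.

(** * Outage of a layer in terms of the determinant *)

Section Decoding.
Variables (R : realType) (Mr Mt L : nat) (b : R) (r : 'I_L -> R).
Hypotheses (L_gt0 : (0 < L)%N) (b_gt0 : 0 < b) (r_ge0 : forall i, 0 <= r i).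

(* Layers as natural numbers: [rate l] is the rate of the layer numbered [l+1] in the model. *)
Definition rate (l : nat) : R := if insub l is Some i then r i else 0.

Definition cum_exp (l : nat) : R := \sum_(i < l) b / L%:R * rate i.

Lemma rate_ord (i : 'I_L) : rate i = r i.
Proof. by rewrite /rate valK. Qed.

Lemma rate_ge0 l : 0 <= rate l.
Proof. by rewrite /rate; case: insubP. Qed.

Lemma cum_expS l : cum_exp l.+1 = cum_exp l + b / L%:R * rate l.
Proof. by rewrite /cum_exp big_ord_recr. Qed.

Lemma cum_exp_ge0 l : 0 <= cum_exp l.
Proof. by apply: sumr_ge0 => i _; rewrite !mulr_ge0 ?rate_ge0 ?invr_ge0 // ltW. Qed.

Lemma cum_exp_mono k l : (k <= l)%N -> cum_exp k <= cum_exp l.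
Proof.
elim: l => [|l IHl]; first by rewrite leqn0 => /eqP ->.
rewrite leq_eqVlt => /predU1P[->//|]; rewrite ltnS => /IHl h.
by rewrite cum_expS ler_wpDr // mulr_ge0 ?rate_ge0 // divr_ge0 // ltW.
Qed.

Lemma ln2_gt0 : 0 < ln 2 :> R.
Proof. by rewrite ln_gt0 // ltr1n. Qed.

Lemma powR2_log2 (y rho : R) : 2 `^ (y * log2 rho) = expR (y * ln rho).
Proof.
rewrite /powR gt_eqF // /log2; congr expR; field.
by rewrite gt_eqF // ln2_gt0.
Qed.

Lemma cumrateE rho l : (l <= L)%N -> b / L%:R * cumrate r rho l = cum_exp l * log2 rho.
Proof.
move=> lL; rewrite /cumrate /cum_exp -mulr_suml mulrA mulr_sumr; congr (_ * _).
rewrite (big_ord_widen L (fun i => b / L%:R * rate i)) //.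
by apply: eq_bigr => i _; rewrite rate_ord.
Qed.

Lemma lsld_rateE rho l : (l <= L)%N ->
  2 `^ (b / L%:R * cumrate r rho l) = expR (cum_exp l * ln rho).
Proof. by move=> lL; rewrite cumrateE // powR2_log2. Qed.

Lemma outageE rho rs g C l : (l < L)%N ->
  outage b r rho rs g C l.+1 =
  (b / L%:R * C <= log2 ((expR (cum_exp l.+1 * ln rho) + g * rs) /
                         (expR (cum_exp l * ln rho) + g * rs))).
Proof. by move=> lL; rewrite /outage !lsld_rateE //; exact: ltnW. Qed.

(** For B <= A and x >= 0, (A+x)/(B+x) <= A/B: side information only lowers the rate a layer
    needs. *)
Lemma outage_det_le (rho rs g : R) (det : R) l : (l < L)%N -> 1 < rho -> 0 <= g * rs ->
  0 < det -> outage b r rho rs g (log2 det) l.+1 -> det <= expR (rate l * ln rho).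
Proof.
move=> lL rho1 grs det0; rewrite outageE //.
have e0 y : 0 < expR (y * ln rho) := expR_gt0 _.
have LR : 0 < L%:R :> R by rewrite ltr0n.
have b0 := b_gt0; have l2 := ln2_gt0.
have lnr : 0 <= ln rho by rewrite ln_ge0 // ltW.
set A := expR (cum_exp l.+1 * _); set B := expR (cum_exp l * _).
have B0 : 0 < B by exact: expR_gt0.
have BA : B <= A by rewrite ler_expR; apply: ler_wpM2r => //; exact: cum_exp_mono.
have ratio : (A + g * rs) / (B + g * rs) <= expR (b / L%:R * rate l * ln rho).
  have -> : expR (b / L%:R * rate l * ln rho) = A / B.
    by rewrite -expRN -expRD cum_expS; congr expR; ring.
  have Bg0 : 0 < B + g * rs by apply: ltr_wpDr => //; exact: expR_gt0.
  rewrite ler_pdivrMr // mulrAC ler_pdivlMr //.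
  rewrite !(mulrDl, mulrDr) lerD2l [A * _]mulrC; exact: ler_wpM2l.
rewrite /log2 mulrA ler_pM2r ?invr_gt0 // => h.
have : b / L%:R * ln det <= b / L%:R * rate l * ln rho.
  apply: le_trans h _; rewrite -[leRHS]expRK ler_ln ?posrE ?expR_gt0 //.
  by apply: divr_gt0; apply: ltr_wpDr => //; exact: expR_gt0.
rewrite -[leRHS]mulrA ler_pM2l ?divr_gt0 // => h'.
by rewrite -ler_ln ?posrE ?expR_gt0 // expRK.
Qed.

(** When the side term is at most B = rho^(cum_exp l), the ratio is at least A/(2B). The lost factor
    2 is paid for by the gap between [rate l] and [s]. *)
Lemma det_le_outage (rho rs g s : R) (det : R) l : (l < L)%N -> 1 < rho -> 0 <= g * rs ->
  g * rs <= expR (cum_exp l * ln rho) ->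
  0 < det -> det <= expR (s * ln rho) -> ln 2 <= b / L%:R * (rate l - s) * ln rho ->
  outage b r rho rs g (log2 det) l.+1.
Proof.
move=> lL rho1 grs grs_le det0 det_le h2; rewrite outageE //.
have e0 y : 0 < expR (y * ln rho) := expR_gt0 _.
have LR : 0 < L%:R :> R by rewrite ltr0n.
have b0 := b_gt0; have l2 := ln2_gt0.
set A := expR (cum_exp l.+1 * _); set B := expR (cum_exp l * _) in grs_le *.
have ratio : expR (b / L%:R * rate l * ln rho) / 2 <= (A + g * rs) / (B + g * rs).
  have -> : expR (b / L%:R * rate l * ln rho) = A / B.
    by rewrite -expRN -expRD cum_expS; congr expR; ring.
  have Bg0 : 0 < B + g * rs by apply: ltr_wpDr => //; exact: expR_gt0.
  rewrite -mulrA -invfM ler_pdivlMr //.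
  have B0 : 0 < B by exact: expR_gt0.
  have A0 : 0 < A by exact: expR_gt0.
  rewrite mulrAC ler_pdivrMr ?mulr_gt0 //.
  have : A * (B + g * rs) <= A * (B + B) by apply: ler_wpM2l; [exact: ltW | rewrite lerD2l].
  have : 0 <= g * rs * (B * 2) by rewrite mulr_ge0 // mulr_ge0 // ltW.
  lra.
rewrite /log2 mulrA ler_pM2r ?invr_gt0 //.
apply: (@le_trans _ _ (ln (expR (b / L%:R * rate l * ln rho) / 2))); last first.
  by rewrite ler_ln ?posrE ?divr_gt0 ?expR_gt0 //; apply: ltr_wpDr => //; exact: expR_gt0.
rewrite ln_div ?posrE ?expR_gt0 // expRK.
have : b / L%:R * ln det <= b / L%:R * (s * ln rho).
  by rewrite ler_pM2l ?divr_gt0 // -[leRHS]expRK ler_ln ?posrE ?expR_gt0.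
lra.
Qed.

Lemma Ndecoded_leL rho rs g C : (Ndecoded b r rho rs g C <= L)%N.
Proof. by rewrite /Ndecoded; apply/bigmax_leqP => i _; rewrite -ltnS. Qed.

Lemma Ndecoded_outage rho rs g C : (Ndecoded b r rho rs g C < L)%N ->
  outage b r rho rs g C (Ndecoded b r rho rs g C).+1.
Proof.
set N := Ndecoded _ _ _ _ _ _; move=> NL; apply/negPn/negP => nout.
pose Q (l : 'I_L.+1) := [forall j : 'I_L, (j < l)%N ==> ~~ outage b r rho rs g C j.+1].
have Q0 : Q ord0 by apply/forallP => j; rewrite ltn0.
have [i Qi Ni] : exists2 i : 'I_L.+1, Q i & N = i.
  by have [|i Qi Ni] := @eq_bigmax_cond _ Q (@nat_of_ord L.+1);
    [apply/card_gt0P; exists ord0 | exists i].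
have NL' : (N.+1 < L.+1)%N by rewrite ltnS.
have : (N.+1 <= N)%N; last by rewrite ltnn.
rewrite -[X in (X <= _)%N]/(nat_of_ord (Ordinal NL')).
apply: leq_bigmax_cond; apply/forallP => j; apply/implyP; rewrite ltnS leq_eqVlt.
case/predU1P => [->//|jN]; have /forallP/(_ j)/implyP := Qi.
by apply; rewrite -Ni.
Qed.

Lemma Ndecoded_le rho rs g C l : (l < L)%N -> outage b r rho rs g C l.+1 ->
  (Ndecoded b r rho rs g C <= l)%N.
Proof.
move=> lL out; apply/bigmax_leqP => i /forallP /(_ (Ordinal lL)) /implyP /= h.
by rewrite leqNgt; apply/negP => /h; rewrite out.
Qed.

End Decoding.

(** * Matching bounds on the expected distortion *)

Section DistortionExponent.
Variables (R : realType) (d : measure_display) (T : measurableType d).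
Variables (P : probability T R) (Mr Mt : nat).
Variables (Hre Him : 'I_Mr -> 'I_Mt -> T -> R) (G : T -> R).
Hypothesis hmodel : channel_model P Hre Him G.
Local Notation M := (minn Mt Mr).
Local Notation tradeoff := (dmt M (slope R Mr Mt)).
Hypothesis M_gt0 : (0 < M)%N.
Variables (nu : R) (rhos : R -> R).
Hypotheses (nu_ge0 : 0 <= nu) (rhos_pos : forall rho, 0 < rho -> 0 < rhos rho)
  (rhos_lim : (ln (rhos x) / ln x) @[x --> +oo] --> nu).

Lemma rhos_bounds (e : R) : 0 < e -> \forall rho \near +oo,
  expR ((nu - e) * ln rho) <= rhos rho /\ rhos rho <= expR ((nu + e) * ln rho).
Proof.
move=> e0; have /cvgrPdist_le/(_ e e0) lim := rhos_lim.
near=> rho.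
have [l1 rho1] : 1 <= ln rho /\ 1 < rho by near: rho; exact: near_ln.
have : `|nu - ln (rhos rho) / ln rho| <= e by near: rho.
have r0 : 0 < rhos rho by apply: rhos_pos; lra.
have l0 : 0 < ln rho by lra.
rewrite ler_norml => /andP[h1 h2].
have q : ln (rhos rho) / ln rho * ln rho = ln (rhos rho) by rewrite mulfVK // gt_eqF.
split; rewrite -[rhos rho]lnK ?posrE // ler_expR -q; apply: ler_wpM2r; lra.
Unshelve. all: by end_near. Qed.

(* Cut [Gamma] at finitely many powers of [rho], the exponents being spaced finely enough
   that each piece contributes at most [rho^(e - max(nu, y))]. *)
Lemma side_pieces (y e : R) : 0 <= y -> 0 < e -> exists I : nat,
  \forall rho \near +oo, exists (w : nat -> R) (B : nat -> set R),
    [/\ forall i, measurable (B i), forall i, 0 <= w i,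
      forall g : R, 0 <= g -> exists i, [/\ (i < I)%N, B i g &
        (rhos rho * g + expR (y * ln rho))^-1 <= w i]
    & forall i, ((w i)%:E * P (G @^-1` B i) <= (expR ((e - Num.max nu y) * ln rho))%:E)%E].
Proof.
move=> y0 e0; have [ynu|nuy] := ltP y nu; last first.
  exists 1; near=> rho.
  have [l1 rho1] : 1 <= ln rho /\ 1 < rho by near: rho; exact: near_ln.
  have rs0 : 0 < rhos rho by apply: rhos_pos; lra.
  exists (fun=> expR (- (y * ln rho))), (fun=> setT); split => //.
  - move=> g g0; exists 0; split => //; rewrite expRN lef_pV2 ?posrE ?expR_gt0 //.
      by rewrite lerDr mulr_ge0 // ltW.
    by apply: (lt_le_trans (expR_gt0 (y * ln rho))); rewrite lerDr mulr_ge0 // ltW.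
  - move=> i; rewrite preimage_setT probability_setT mule1 lee_fin ler_expR.
    have : 0 <= e * ln rho by apply: mulr_ge0; lra.
    lra.
pose eta := e / 2; have eta0 : 0 < eta by rewrite divr_gt0.
(* Then nu < I' eta: the event that Gamma is below the last threshold has probability at most
   rho^(eta-nu), so the bound 1 on the distortion is enough there. *)
pose I' := (Num.truncn (nu / eta)).+1; exists I'.+1.
near=> rho.
have [l1 rho1] : 1 <= ln rho /\ 1 < rho by near: rho; exact: near_ln.
have [rs_ge _] : expR ((nu - eta) * ln rho) <= rhos rho /\ rhos rho <= expR ((nu + eta) * ln rho).
  by near: rho; exact: rhos_bounds.
have rs0 : 0 < rhos rho by apply: rhos_pos; lra.
set l := ln rho in l1 rs_ge *.
have l0 : 0 <= l by lra.
pose thr (i : nat) : R := expR (- (i%:R * eta * l)).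
pose w i : R := if (i < I')%N then (rhos rho * thr i)^-1 else 1.
pose B (i : nat) : set R := if i is i'.+1 then `[0, thr i']%classic else setT.
have thr0 i : 0 < thr i by exact: expR_gt0.
exists w, B; split.
- by case=> [|i]; [exact: measurableT | exact: measurable_itv].
- by move=> i; rewrite /w; case: ifP => // _; rewrite invr_ge0 mulr_ge0 ?ltW.
- move=> g g0.
  have ey1 : 1 <= expR (y * l) by rewrite -expR0 ler_expR mulr_ge0.
  have [ex|nex] := pselect (exists i, (i < I')%N && (thr i <= g)).
    have [i /andP[iI thr_i] imin] := ex_minnP ex.
    exists i; split; first by rewrite ltnS ltnW.
      case: i iI thr_i imin => [//|i] iI _ imin; rewrite /B /= in_itv /= g0 leNgt.
      apply/negP => h; have := imin i; by rewrite (ltnW iI) (ltW h) ltnn => /(_ isT).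
    rewrite /w iI lef_pV2 ?posrE ?mulr_gt0 //.
      apply: (@le_trans _ _ (rhos rho * g)); first by rewrite ler_pM2l.
      by rewrite lerDl expR_ge0.
    by apply: (lt_le_trans (expR_gt0 (y * ln rho))); rewrite lerDr mulr_ge0 // ltW.
  exists I'; split => //.
    rewrite /B /= in_itv /= g0 leNgt; apply/negP => h; apply: nex.
    by exists (Num.truncn (nu / eta)); rewrite /I' leqnn ltW.
  rewrite /w ltnn invf_le1; first by rewrite (le_trans ey1) // lerDr mulr_ge0 // ltW.
  by apply: (lt_le_trans (expR_gt0 (y * ln rho))); rewrite lerDr mulr_ge0 // ltW.
have thr_le i : (P (G @^-1` B i) <= (expR (eta * l) * thr i)%:E)%E.
  case: i => [|i].
    rewrite /B preimage_setT probability_setT lee_fin /thr !mul0r oppr0 expR0 mulr1.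
    by rewrite -expR0 ler_expR mulr_ge0 // ltW.
  apply: le_trans (G_le hmodel (thr0 i)) _; rewrite lee_fin /thr -expRD ler_expR -natr1.
  by rewrite le_eqVlt; apply/orP; left; apply/eqP; ring.
move=> i.
have w0 : 0 <= w i by rewrite /w; case: ifP => // _; rewrite invr_ge0 mulr_ge0 ?ltW.
have [iI|Ii] := ltnP i I'.
  apply: (@le_trans _ _ ((w i)%:E * (expR (eta * l) * thr i)%:E)%E).
    by apply: lee_wpmul2l; rewrite ?lee_fin.
  rewrite -EFinM lee_fin /w iI.
  have -> : (rhos rho * thr i)^-1 * (expR (eta * l) * thr i) = expR (eta * l) / rhos rho.
    by field; rewrite !gt_eqF.
  rewrite ler_pdivrMr // [leRHS]mulrC.
  apply: (@le_trans _ _ (expR ((nu - eta) * l) * expR ((e - nu) * l))).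
    by rewrite -expRD ler_expR /eta; lra.
  by apply: ler_wpM2r; rewrite ?expR_ge0.
rewrite /w ltnNge Ii mul1e; apply: le_trans (thr_le i) _; rewrite lee_fin -expRD ler_expR.
have nuI : nu <= eta * I'%:R.
  have /andP[_ h] := truncn_itv (divr_ge0 nu_ge0 (ltW eta0)).
  by rewrite -ler_pdivrMl // mulrC ltW.
have II : I'%:R <= i%:R :> R by rewrite ler_nat.
have : eta * I'%:R * l <= eta * i%:R * l by apply: ler_wpM2r => //; apply: ler_wpM2l => //; exact: ltW.
have : nu * l <= eta * I'%:R * l by apply: ler_wpM2r.
have : 0 <= eta * l by rewrite mulr_ge0 // ltW.
rewrite /eta; lra.
Unshelve. all: by end_near. Qed.

Section FixedRates.
Variables (L : nat) (b : R) (r : 'I_L -> R).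
Hypotheses (L_gt0 : (0 < L)%N) (b_gt0 : 0 < b) (r_ge0 : forall i, 0 <= r i).
Local Notation Y := (cum_exp b r).
Local Notation dist rho x :=
  (lsld_distortion b r rho (rhos rho) (G x) (chanH Hre Him x)).

Lemma chan_det_gt0 rho x : 0 < rho -> 0 < chan_det Hre Him rho x.
Proof.
move=> rho0; rewrite chan_detE //.
have := gram_det_ge1 (Complex (Num.sqrt (rho / M%:R)) 0 *: chanH Hre Him x).
have f0 : 0 < Mr`!%:R :> R by rewrite ltr0n fact_gt0.
by move=> h; rewrite -(pmulr_rgt0 _ f0); apply: lt_le_trans h.
Qed.

Lemma distE rho x (N := Ndecoded b r rho (rhos rho) (G x) (logdet rho (chanH Hre Him x))) :
  dist rho x = (rhos rho * G x + expR (Y N * ln rho))^-1.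
Proof. by rewrite /lsld_distortion /Dd lsld_rateE // Ndecoded_leL. Qed.

Lemma sum_ge_term (K : eqType) (s : seq K) (F : K -> R) k :
  k \in s -> (forall i, 0 <= F i) -> F k <= \sum_(i <- s) F i.
Proof. by move=> ks F0; rewrite (big_rem k) //= lerDl; exact: sumr_ge0. Qed.

(** The distortion is dominated by a sum over pairs of a number [l] of decoded layers and a piece of
    Gamma, each pair restricted to the outage of layer l+1. Of e = 4e', one e' goes to the outage
    bound, one to the piece and two to the number of pairs. *)
Lemma distortion_upper (E e : R) : 0 < e -> E <= Num.max nu (Y L) ->
  (forall l, (l < L)%N -> E <= Num.max nu (Y l) + tradeoff (rate r l)) ->
  \forall rho \near +oo,
    (0 <= \int[P]_x (dist rho x)%:E <= (expR ((e - E) * ln rho))%:E)%E.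
Proof.
move=> e0 EL El; pose e' := e / 4; have e'0 : 0 < e' by rewrite divr_gt0.
have /boolp.choice[I IP] (l : 'I_L.+1) := side_pieces (cum_exp_ge0 b_gt0 r_ge0 l) e'0.
pose s := [seq (l, i) | l <- enum 'I_L.+1, i <- iota 0 (I l)].
(* At [l = L] everything is decoded and there is no outage factor. *)
pose delta (l : nat) : R := if (l < L)%N then tradeoff (rate r l) else 0.
near=> rho.
have [l1 rho1] : 1 <= ln rho /\ 1 < rho by near: rho; exact: near_ln.
have pieces : forall l : 'I_L.+1, exists (w : nat -> R) (B : nat -> set R),
    [/\ forall i, measurable (B i), forall i, 0 <= w i,
      forall g : R, 0 <= g -> exists i, [/\ (i < I l)%N, B i g &
        (rhos rho * g + expR (Y l * ln rho))^-1 <= w i]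
    & forall i, ((w i)%:E * P (G @^-1` B i) <=
        (expR ((e' - Num.max nu (Y l)) * ln rho))%:E)%E].
  by near: rho; apply: filter_forall => l; exact: IP.
have outs : forall l : 'I_L, forall B : set R, measurable B -> exists S : set T,
    [/\ measurable S,
      forall x, chan_det Hre Him rho x <= expR (rate r l * ln rho) -> B (G x) -> S x
    & (P S <= (expR ((e' - tradeoff (rate r l)) * ln rho))%:E * P (G @^-1` B))%E].
  near: rho; apply: filter_forall => l.
  exact: (outage_upper hmodel M_gt0 e'0 (rate_ge0 r_ge0 l)).
have sl : (size s)%:R <= expR (2 * e' * ln rho).
  by near: rho; apply: near_cst_le; rewrite mulr_gt0.
have rs0 : 0 < rhos rho by apply: rhos_pos; lra.
have l0 : 0 <= ln rho by lra.
have [w /boolp.choice[B wB]] := boolp.choice pieces.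
have exS (k : 'I_L.+1 * nat) : exists S : set T, [/\ measurable S,
    forall x, ((k.1 < L)%N -> chan_det Hre Him rho x <= expR (rate r k.1 * ln rho)) ->
      B k.1 k.2 (G x) -> S x
    & (P S <= (expR ((e' - delta k.1) * ln rho))%:E * P (G @^-1` B k.1 k.2))%E].
  have [mB _ _ _] := wB k.1; rewrite /delta.
  have [kL|kL] := ltnP k.1 L.
    have [S [mS SP PS]] := outs (Ordinal kL) _ (mB k.2).
    by exists S; split => // x h; apply: SP; exact: h.
  exists (G @^-1` B k.1 k.2); split => //; first exact: (measurable_preG hmodel).
  rewrite subr0 -[leLHS]mul1e; apply: lee_wpmul2r => //.
  by rewrite lee_fin -expR0 ler_expR mulr_ge0 // ltW.
have [S SP] := boolp.choice exS.
have mZ : measurable (G @^-1` [set x | x < 0]).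
  apply: (measurable_preG hmodel); rewrite (_ : mkset _ = `]-oo, 0[%classic) //.
have mS k : measurable (S k) by have [] := SP k.
have w_ge0 k : 0 <= w k.1 k.2 by have [_ w0 _ _] := wB k.1; exact: w0.
have cover x : ~ (G @^-1` [set x | x < 0]) x ->
    0 <= dist rho x <= \sum_(k <- s) w k.1 k.2 * \1_(S k) x.
  move=> /= /negP; rewrite -leNgt => Gx; rewrite distE; set N := Ndecoded _ _ _ _ _ _.
  apply/andP; split.
    by rewrite invr_ge0 addr_ge0 ?expR_ge0 // mulr_ge0 // ltW.
  have NL : (N < L.+1)%N by rewrite ltnS Ndecoded_leL.
  have [_ w0 wcov _] := wB (Ordinal NL).
  have [i [iI Bi wi]] := wcov _ Gx.
  apply: le_trans wi _.
  have ks : (Ordinal NL, i) \in s.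
    apply/allpairsPdep; exists (Ordinal NL), i; split => //; first by rewrite mem_enum.
    by rewrite mem_iota.
  have term0 k : 0 <= w k.1 k.2 * \1_(S k) x.
    by apply: mulr_ge0 => //; have [_ w0' _ _] := wB k.1; exact: w0'.
  apply: le_trans (sum_ge_term ks term0) => /=.
  have -> : \1_(S (Ordinal NL, i)) x = 1 :> R.
    rewrite indicE mem_set //; have [_ Sin _] := SP (Ordinal NL, i).
    apply: Sin => //= NL'.
    apply: (outage_det_le L_gt0 b_gt0 r_ge0 NL' rho1 (rs := rhos rho) (g := G x)).
    + by rewrite mulr_ge0 // ltW.
    + by apply: chan_det_gt0; lra.
    + exact: Ndecoded_outage.
  by rewrite mulr1.
have /andP[h1 h2] := integral_cover_le mZ (G_neg hmodel) mS w_ge0 cover.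
apply/andP; split => //; apply: le_trans h2 _.
apply: le_trans (lee_sum_cst _ (x := (expR ((2 * e' - E) * ln rho))%:E) _ _) _.
- by rewrite lee_fin expR_ge0.
- move=> k; have [_ _ PS] := SP k; have [_ w0 _ wP] := wB k.1.
  apply: (@le_trans _ _ ((w k.1 k.2)%:E * ((expR ((e' - delta k.1) * ln rho))%:E *
      P (G @^-1` B k.1 k.2)))%E).
    by apply: lee_wpmul2l; rewrite ?lee_fin.
  rewrite muleCA.
  apply: (@le_trans _ _ ((expR ((e' - delta k.1) * ln rho))%:E *
     (expR ((e' - Num.max nu (Y k.1)) * ln rho))%:E)%E).
    by apply: lee_wpmul2l; rewrite ?lee_fin ?expR_ge0.
  rewrite -EFinM -expRD lee_fin ler_expR -mulrDl; apply: ler_wpM2r => //.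
  rewrite /delta; case: (ltnP k.1 L) => kL; first by have := El _ kL; lra.
  have -> : nat_of_ord k.1 = L by apply/eqP; rewrite eqn_leq kL -ltnS ltn_ord.
  lra.
rewrite -EFinM lee_fin; apply: (@le_trans _ _ (expR (2 * e' * ln rho) * expR ((2 * e' - E) * ln rho))).
  by apply: ler_wpM2r; rewrite ?expR_ge0.
by rewrite -expRD ler_expR /e'; lra.
Unshelve. all: by end_near. Qed.

Lemma measurable_G_neg : measurable (G @^-1` [set x : R | x < 0]).
Proof.
by apply: (measurable_preG hmodel); rewrite (_ : mkset _ = `]-oo, 0[%classic).
Qed.

Lemma dist_ge rho x l : 1 < rho -> ~ G x < 0 ->
  (Ndecoded b r rho (rhos rho) (G x) (logdet rho (chanH Hre Him x)) <= l)%N ->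
  (rhos rho * G x + expR (Y l * ln rho))^-1 <= dist rho x.
Proof.
move=> rho1 /negP; rewrite -leNgt => Gx Nl; rewrite distE.
have rho0 : 0 < rho by lra.
have g0 : 0 <= rhos rho * G x by rewrite mulr_ge0 // ltW // rhos_pos.
have lnr : 0 <= ln rho by rewrite ln_ge0 // ltW.
rewrite lef_pV2 ?posrE; try by apply: ltr_wpDl => //; exact: expR_gt0.
by rewrite lerD2l ler_expR; apply: ler_wpM2r => //; apply: cum_exp_mono.
Qed.

Lemma dist_ge0 rho x : 1 < rho -> ~ G x < 0 -> 0 <= dist rho x.
Proof.
move=> rho1 /negP; rewrite -leNgt => Gx; rewrite distE invr_ge0 addr_ge0 ?expR_ge0 //.
by rewrite mulr_ge0 // ltW // rhos_pos //; lra.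
Qed.

(** On Gamma in [0, 1], of probability at least 1/2, the distortion is at least 1/(rhos + rho^(Y L))
    whatever is decoded. *)
Lemma distortion_lower_full (e : R) : 0 < e ->
  \forall rho \near +oo,
    ((expR (- (Num.max nu (Y L) + e) * ln rho))%:E <= \int[P]_x (dist rho x)%:E)%E.
Proof.
move=> e0; have e20 : 0 < e / 2 by rewrite divr_gt0.
near=> rho.
have [l1 rho1] : 1 <= ln rho /\ 1 < rho by near: rho; exact: near_ln.
have rho0 : 0 < rho by lra.
have [_ rs_le] : expR ((nu - e / 2) * ln rho) <= rhos rho /\
    rhos rho <= expR ((nu + e / 2) * ln rho) by near: rho; exact: rhos_bounds.
have k4 : 4 <= expR (e / 2 * ln rho) by near: rho; exact: near_cst_le.
have rs0 : 0 < rhos rho by apply: rhos_pos.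
set l := ln rho in l1 rs_le k4 *; have l0 : 0 <= l by lra.
set m := Num.max nu (Y L).
have e2l : 0 <= e / 2 * l by apply: mulr_ge0; lra.
have num : nu * l <= m * l by apply: ler_wpM2r => //; rewrite le_max lexx.
have Ym : Y L * l <= m * l by apply: ler_wpM2r => //; rewrite le_max lexx orbT.
have den_le : rhos rho + expR (Y L * l) <= 2 * expR ((m + e / 2) * l).
  have h1 : expR ((nu + e / 2) * l) <= expR ((m + e / 2) * l) by rewrite ler_expR; lra.
  have h2 : expR (Y L * l) <= expR ((m + e / 2) * l) by rewrite ler_expR; lra.
  lra.
have den0 : 0 < rhos rho + expR (Y L * l) by rewrite addr_gt0 ?expR_gt0.
have mS : measurable (G @^-1` `[0%R, 1]%classic) by exact: (measurable_preG hmodel).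
apply: (le_trans _ (@integral_ge_on _ T R P (G @^-1` `[0%R, 1]%classic) (fun x => dist rho x)
  (rhos rho + expR (Y L * l))^-1 _ measurable_G_neg (G_neg hmodel) mS _ _ _)).
- apply: (@le_trans _ _ (((rhos rho + expR (Y L * l))^-1)%:E * (1 / 2)%:E)%E); last first.
    by apply: lee_wpmul2l; [rewrite lee_fin invr_ge0 ltW | exact: (G_ge hmodel)].
  rewrite -EFinM lee_fin mul1r -invfM mulNr expRN lef_pV2 ?posrE ?expR_gt0 ?mulr_gt0 //.
  apply: (@le_trans _ _ (2 * expR ((m + e / 2) * l) * 2)); first by rewrite ler_pM2r.
  have -> : expR ((m + e) * l) = expR ((m + e / 2) * l) * expR (e / 2 * l).
    by rewrite -expRD; congr expR; field.
  have := expR_gt0 ((m + e / 2) * l); nra.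
- by rewrite invr_ge0 ltW.
- by move=> x; exact: dist_ge0.
- move=> x Gx; rewrite /= in_itv /= => /andP[G0 G1].
  apply: le_trans (dist_ge rho1 Gx (Ndecoded_leL _ _ _ _ _ _)).
  rewrite lef_pV2 ?posrE //; last by apply: ltr_wpDl; [rewrite mulr_ge0 // ltW | exact: expR_gt0].
  by rewrite lerD2r ler_piMr // ltW.
Unshelve. all: by end_near. Qed.

(** Restrict to Gamma so small that rhos * Gamma <= rho^(Y l): this has exponent m - Y l with m =
    max(nu, Y l). A low determinant then forces outage and a distortion of order rho^(-Y l), so the
    exponents add up to m + dmt. *)
Lemma distortion_lower_outage (l : nat) (e : R) : (l < L)%N -> 0 < rate r l -> 0 < e ->
  \forall rho \near +oo,
    ((expR (- (Num.max nu (Y l) + tradeoff (rate r l) + e) * ln rho))%:E <=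
     \int[P]_x (dist rho x)%:E)%E.
Proof.
move=> lL rl0 e0; pose e' := e / 4; have e'0 : 0 < e' by rewrite divr_gt0.
have psi0 j : (j < M)%N -> 0 < slope R Mr Mt j by exact: slope_gt0.
have LR : 0 < L%:R :> R by rewrite ltr0n.
(* A target slightly below the rate, as [det_le_outage] needs a gap; by the Lipschitz bound [dmt]
   grows by at most e'. A rate above M is replaced by M, where [dmt] vanishes. *)
have [s [s0 sM sr sd]] : exists s, [/\ 0 < s, s <= M%:R, s < rate r l &
    tradeoff s <= tradeoff (rate r l) + e'].
  have [rM|Mr'] := leP (rate r l) M%:R; last first.
    exists M%:R; rewrite ltr0n M_gt0 lexx Mr'; split => //.
    by rewrite dmt_top // addr_ge0 ?dmt_ge0 // ltW.
  pose Psi : R := \sum_(j < M) slope R Mr Mt j.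
  have Psi0 : 0 <= Psi by apply: sumr_ge0 => j _; rewrite ltW // psi0.
  have t0 : 0 < e' / (Psi + 1) by rewrite divr_gt0 //; lra.
  pose t := Num.min (rate r l / 2) (e' / (Psi + 1)).
  have t_gt0 : 0 < t by rewrite lt_min t0 andbT divr_gt0.
  have t_le : t <= rate r l / 2 by rewrite ge_min lexx.
  have t_le' : t <= e' / (Psi + 1) by rewrite ge_min lexx orbT.
  exists (rate r l - t); split; try lra.
  have le : rate r l - t <= rate r l by lra.
  have := dmt_lip psi0 le; rewrite subKr -/Psi.
  have : Psi * t <= e'.
    rewrite ler_pdivlMr in t_le'; last by lra.
    by nra.
  lra.
have gap0 : 0 < b / L%:R * (rate r l - s) by rewrite !mulr_gt0 ?invr_gt0 // subr_gt0.
have e2 : 0 < e' / 2 by rewrite divr_gt0.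
near=> rho.
have [l1 rho1] : 1 <= ln rho /\ 1 < rho by near: rho; exact: near_ln.
have rho0 : 0 < rho by lra.
have [lgap _] : ln 2 / (b / L%:R * (rate r l - s)) <= ln rho /\ 1 < rho.
  by near: rho; exact: near_ln.
have [_ rs_le] : expR ((nu - e') * ln rho) <= rhos rho /\
    rhos rho <= expR ((nu + e') * ln rho) by near: rho; exact: rhos_bounds.
have outs : forall B : set R, measurable B -> exists S : set T,
    [/\ measurable S,
      forall x, S x -> B (G x) /\ chan_det Hre Him rho x <= expR (s * ln rho)
    & ((expR (- (tradeoff s + e') * ln rho))%:E * P (G @^-1` B) <= P S)%E].
  by near: rho; exact: (outage_lower hmodel M_gt0 e'0 s0 sM).
have k4 : 4 <= expR (e' * ln rho) by near: rho; exact: near_cst_le.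
have rs0 : 0 < rhos rho by apply: rhos_pos.
rewrite ler_pdivrMr // mulrC in lgap.
set z := ln rho in l1 lgap rs_le outs k4 *; have z0 : 0 <= z by lra.
set m := Num.max nu (Y l).
have num : nu * z <= m * z by apply: ler_wpM2r => //; rewrite le_max lexx.
have Ym : Y l * z <= m * z by apply: ler_wpM2r => //; rewrite le_max lexx orbT.
have e'z : 0 <= e' * z by apply: mulr_ge0; lra.
(* The extra e' compensates for rhos being known only up to rho^(e'). *)
pose t := expR (- (m - Y l + e') * z).
have t0 : 0 < t by exact: expR_gt0.
have t1 : t <= 1 by rewrite -expR0 ler_expR; lra.
have [S [mS SP PS]] := outs `[0, t]%classic (measurable_itv _).
have rst : rhos rho * t <= expR (Y l * z).
  apply: (@le_trans _ _ (expR ((nu + e') * z) * t)); first by rewrite ler_pM2r.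
  by rewrite /t -expRD ler_expR; lra.
apply: (le_trans _ (@integral_ge_on _ T R P S (fun x => dist rho x)
  (2 * expR (Y l * z))^-1 _ measurable_G_neg (G_neg hmodel) mS _ _ _)).
- apply: (@le_trans _ _ (((2 * expR (Y l * z))^-1)%:E *
     ((expR (- (tradeoff s + e') * z))%:E * (t / 2)%:E))%E); last first.
    apply: lee_wpmul2l; first by rewrite lee_fin invr_ge0 mulr_ge0 ?expR_ge0.
    apply: le_trans PS; apply: lee_wpmul2l; first by rewrite lee_fin expR_ge0.
    exact: (G_ge hmodel).
  rewrite -!EFinM lee_fin.
  have -> : (2 * expR (Y l * z))^-1 * (expR (- (tradeoff s + e') * z) * (t / 2)) =
     (expR (- (m + tradeoff s + 2 * e') * z)) / 4.
    rewrite /t.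
    rewrite (_ : - (m + tradeoff s + 2 * e') * z =
      - (Y l * z) + (- (tradeoff s + e') * z + - (m - Y l + e') * z)); last by ring.
    by rewrite !expRD [expR (- (Y l * z))]expRN; field; rewrite gt_eqF // expR_gt0.
  rewrite ler_pdivlMr //.
  apply: (@le_trans _ _ (expR (- (m + tradeoff (rate r l) + e) * z) * expR (e' * z))).
    by apply: ler_wpM2l; rewrite ?expR_ge0.
  rewrite -expRD ler_expR.
  have : tradeoff s * z <= (tradeoff (rate r l) + e') * z by apply: ler_wpM2r.
  rewrite /e'; lra.
- by rewrite invr_ge0 mulr_ge0 ?expR_ge0.
- by move=> x; exact: dist_ge0.
- move=> x Gx Sx; have [] := SP x Sx; rewrite /= in_itv /= => /andP[G0 Gt] det_le.
  have grs : G x * rhos rho <= expR (Y l * z).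
    by apply: le_trans rst; rewrite mulrC ler_pM2l.
  have out := det_le_outage L_gt0 b_gt0 lL rho1 (mulr_ge0 G0 (ltW rs0)) grs
    (chan_det_gt0 x rho0) det_le lgap.
  apply: le_trans (dist_ge rho1 Gx (Ndecoded_le lL out)).
  rewrite lef_pV2 ?posrE ?mulr_gt0 ?expR_gt0 //; last first.
    by apply: ltr_wpDl; [rewrite mulr_ge0 // ltW | exact: expR_gt0].
  by rewrite mulrC in grs; lra.
Unshelve. all: by end_near. Qed.

End FixedRates.
End DistortionExponent.

Lemma log2_ratio (R : realType) (x y : R) : - log2 x / log2 y = - (ln x / ln y).
Proof.
by rewrite mulNr /log2 invf_div mulrA divfK // gt_eqF // ln2_gt0.
Qed.

Lemma dist_exponent_le (R : realType) (f : R -> R) (D A : R) :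
  has_dist_exponent f D ->
  (forall e, 0 < e -> \forall rho \near +oo, expR (- (A + e) * ln rho) <= f rho) -> D <= A.
Proof.
move=> fD lb; rewrite leNgt; apply/negP => AD.
pose e := (D - A) / 3; have e0 : 0 < e by rewrite divr_gt0 // subr_gt0.
have /cvgrPdist_le/(_ e e0) lim := fD.
suff : \forall rho \near +oo : set_system R, False by move=> /filter_ex[].
near=> rho.
have [l1 _] : 1 <= ln rho /\ 1 < rho by near: rho; exact: near_ln.
have : `|D - (- log2 (f rho) / log2 rho)| <= e by near: rho.
have fge : expR (- (A + e) * ln rho) <= f rho by near: rho; exact: lb.
have f0 : 0 < f rho by apply: lt_le_trans fge; exact: expR_gt0.
have : - (A + e) * ln rho <= ln (f rho) by rewrite -[leLHS]expRK ler_ln ?posrE ?expR_gt0.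
rewrite log2_ratio -ler_pdivlMr; last by lra.
rewrite ler_norml => h /andP[h1 h2]; move: h2; rewrite /e in h *; lra.
Unshelve. all: by end_near. Qed.

Lemma dist_exponent_eq (R : realType) (f : R -> R) (A : R) :
  (forall e, 0 < e -> \forall rho \near +oo, expR (- (A + e) * ln rho) <= f rho) ->
  (forall e, 0 < e -> \forall rho \near +oo, f rho <= expR ((e - A) * ln rho)) ->
  has_dist_exponent f A.
Proof.
move=> lb ub; apply/cvgrPdist_le => e e0; near=> rho.
have [l1 _] : 1 <= ln rho /\ 1 < rho by near: rho; exact: near_ln.
have fge : expR (- (A + e) * ln rho) <= f rho by near: rho; exact: lb.
have fle : f rho <= expR ((e - A) * ln rho) by near: rho; exact: ub.
have f0 : 0 < f rho by apply: lt_le_trans fge; exact: expR_gt0.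
have : - (A + e) * ln rho <= ln (f rho) by rewrite -[leLHS]expRK ler_ln ?posrE ?expR_gt0.
have : ln (f rho) <= (e - A) * ln rho by rewrite -[leRHS]expRK ler_ln ?posrE ?expR_gt0.
have l0 : 0 < ln rho by lra.
rewrite log2_ratio -(ler_pdivrMr _ _ l0) -(ler_pdivlMr _ _ l0).
by rewrite ler_norml => h1 h2; apply/andP; split; lra.
Unshelve. all: by end_near. Qed.

(** * Infinitely many layers *)

Section LayerLimit.
Variables (R : realType) (d : measure_display) (T : measurableType d).
Variables (P : probability T R) (Mr Mt : nat).
Variables (Hre Him : 'I_Mr -> 'I_Mt -> T -> R) (G : T -> R).
Hypothesis hmodel : channel_model P Hre Him G.
Local Notation M := (minn Mt Mr).
Local Notation tradeoff := (dmt M (slope R Mr Mt)).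
Hypothesis M_gt0 : (0 < M)%N.
Variables (b nu : R) (rhos : R -> R).
Hypotheses (b_gt0 : 0 < b) (nu_ge0 : 0 <= nu)
  (rhos_pos : forall rho, 0 < rho -> 0 < rhos rho)
  (rhos_lim : (ln (rhos x) / ln x) @[x --> +oo] --> nu).

Lemma lsld_ED_le (L : nat) (r : 'I_L -> R) (E e : R) : (0 < L)%N -> (forall i, 0 <= r i) ->
  0 < e -> E <= Num.max nu (cum_exp b r L) ->
  (forall l, (l < L)%N -> E <= Num.max nu (cum_exp b r l) + tradeoff (rate r l)) ->
  \forall rho \near +oo, lsld_ED P Hre Him G b r rhos rho <= expR ((e - E) * ln rho).
Proof.
move=> L0 r0 e0 EL El.
apply: filterS (distortion_upper hmodel M_gt0 nu_ge0 rhos_pos rhos_lim L0 b_gt0 r0 e0 EL El).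
move=> rho /andP[h1 h2]; rewrite /lsld_ED -lee_fin fineK //.
by rewrite ge0_fin_numE //; apply: le_lt_trans h2 (ltry _).
Qed.

(** [fine] sends an infinite integral to 0, so finiteness must be known before a lower bound passes
    through it; [distortion_upper] with E = 0 supplies it. *)
Lemma lsld_ED_ge (L : nat) (r : 'I_L -> R) (B : R -> R) : (0 < L)%N -> (forall i, 0 <= r i) ->
  (\forall rho \near +oo, ((expR (B rho))%:E <= \int[P]_x (lsld_distortion b r rho (rhos rho)
     (G x) (chanH Hre Him x))%:E)%E) ->
  \forall rho \near +oo, expR (B rho) <= lsld_ED P Hre Him G b r rhos rho.
Proof.
move=> L0 r0 lb.
have E0 : 0 <= Num.max nu (cum_exp b r L) by rewrite le_max nu_ge0.
have psi0 j : (j < M)%N -> 0 < slope R Mr Mt j by exact: slope_gt0.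
have El l : (l < L)%N -> 0 <= Num.max nu (cum_exp b r l) + tradeoff (rate r l).
  by move=> _; rewrite addr_ge0 ?dmt_ge0 // le_max nu_ge0.
have ub := distortion_upper hmodel M_gt0 nu_ge0 rhos_pos rhos_lim L0 b_gt0 r0 ltr01 E0 El.
apply: filterS2 lb ub => rho h /andP[h1 h2]; rewrite /lsld_ED -lee_fin fineK //.
by rewrite ge0_fin_numE //; apply: le_lt_trans h2 (ltry _).
Qed.

(** Every choice of rates falls under one of the two lower bounds on the expected distortion. Only
    an inequality on [b] is asked, so that [r0 = M] covers the low-bandwidth range. *)
Lemma Delta_L_le (L : nat) (r0 : R) : (0 < L)%N -> 0 < r0 -> r0 <= M%:R ->
  b <= nu / r0 + dmt_time M (slope R Mr Mt) r0 ->
  (Delta_L P Hre Him G b rhos L <= (nu + tradeoff r0)%:E)%E.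
Proof.
move=> L0 r00 r0M bU.
have psi0 j : (j < M)%N -> 0 < slope R Mr Mt j by exact: slope_gt0.
have [g gP] := rate_exists psi0 nu_ge0 r00 r0M.
apply: ge_ereal_sup => _ [r [D [-> r_ge0 fD]]]; rewrite lee_fin.
have [h|[l [lL rl h]]] := euler_converse psi0 b_gt0 nu_ge0 r00 r0M gP L0 (rate_ge0 r_ge0) bU.
  apply: le_trans h; apply: dist_exponent_le fD _ => e e0.
  apply: lsld_ED_ge => //.
  exact: (distortion_lower_full hmodel rhos_pos rhos_lim b_gt0 r_ge0).
apply: le_trans h; apply: dist_exponent_le fD _ => e e0.
apply: lsld_ED_ge => //.
exact: (distortion_lower_outage hmodel M_gt0 rhos_pos rhos_lim L0 b_gt0 r_ge0).
Qed.

(** When the term for full decoding is the smallest, the upper and lower estimates agree. The limit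
    then exists, as it must for the rates to enter the supremum. *)
Lemma Delta_L_ge_of_rates (L : nat) (r : 'I_L -> R) : (0 < L)%N -> (forall i, 0 <= r i) ->
  (forall l, (l < L)%N -> Num.max nu (cum_exp b r L) <=
     Num.max nu (cum_exp b r l) + tradeoff (rate r l)) ->
  ((Num.max nu (cum_exp b r L))%:E <= Delta_L P Hre Him G b rhos L)%E.
Proof.
move=> L0 r_ge0 h; apply: ereal_sup_ubound; exists r, (Num.max nu (cum_exp b r L)).
split => //; apply: dist_exponent_eq => e e0.
  apply: lsld_ED_ge => //.
  exact: (distortion_lower_full hmodel rhos_pos rhos_lim b_gt0 r_ge0).
exact: lsld_ED_le.
Qed.

Lemma Delta_L_ge (L : nat) (r0 : R) : (0 < L)%N -> 0 < r0 -> r0 <= M%:R ->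
  nu / r0 + dmt_time M (slope R Mr Mt) r0 = b ->
  ((nu + tradeoff r0 - b * M%:R ^+ 2 / r0 / L%:R)%:E <= Delta_L P Hre Him G b rhos L)%E.
Proof.
move=> L0 r00 r0M bU.
have psi0 j : (j < M)%N -> 0 < slope R Mr Mt j by exact: slope_gt0.
have [g gP] := rate_exists psi0 nu_ge0 r00 r0M.
have [r [rP YL YLge]] := euler_achieve psi0 b_gt0 nu_ge0 r00 r0M gP L0 bU.
pose rL (i : 'I_L) := r i.
have rateE l : (l < L)%N -> rate rL l = r l.
  by move=> lL; rewrite -[l]/(nat_of_ord (Ordinal lL)) rate_ord.
have cumE l : (l <= L)%N -> cum_exp b rL l = \sum_(i < l) b / L%:R * r i.
  move=> lL; apply: eq_bigr => i _; rewrite rateE //; exact: leq_trans lL.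
have rL0 i : 0 <= rL i by have [h _] := rP i (ltn_ord i); apply: le_trans h; exact: ltW.
have := @Delta_L_ge_of_rates L rL L0 rL0; rewrite (cumE L) //.
set YL' := \sum_(i < L) _ in YL YLge *.
move=> h; apply: le_trans (h _); last first.
  move=> l lL; rewrite rateE // cumE ?(ltnW lL) //; have [_ ->] := rP l lL.
  by rewrite ge_max YL andbT lerDl dmt_ge0.
rewrite lee_fin le_max; apply/orP; right; lra.
Qed.

Lemma Delta_L_ge_nu (L : nat) : (0 < L)%N -> (nu%:E <= Delta_L P Hre Him G b rhos L)%E.
Proof.
move=> L0; pose r (i : 'I_L) : R := 0.
have rate0 l : rate r l = 0 by rewrite /rate; case: insubP.
have cum0 l : cum_exp b r l = 0 by rewrite /cum_exp big1 // => i _; rewrite rate0 mulr0.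
have psi0 j : (j < M)%N -> 0 < slope R Mr Mt j by exact: slope_gt0.
have := @Delta_L_ge_of_rates L r L0 (fun=> lexx 0); rewrite cum0 (max_idPl nu_ge0); apply.
by move=> l _; rewrite cum0 (max_idPl nu_ge0) lerDl dmt_ge0.
Qed.

End LayerLimit.

Theorem theorem4 (R : realType) (Mt Mr : nat) (hMt : (1 <= Mt)%N) (hMr : (1 <= Mr)%N)
  (b nu : R) (hb : 0 < b) (hnu : 0 <= nu)
  (rhos : R -> R) (hrhos_pos : forall rho, 0 < rho -> 0 < rhos rho)
  (hrhos : (ln (rhos x) / ln x) @[x --> +oo] --> nu)
  (d : measure_display) (T : measurableType d) (P : probability T R)
  (Hre Him : 'I_Mr -> 'I_Mt -> T -> R) (G : T -> R)
  (hmodel : channel_model P Hre Him G) :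
  (b <= nu / (minn Mt Mr)%:R ->
     Delta_L P Hre Him G b rhos L.+1 @[L --> \oo] --> nu%:E) /\
  (forall k : nat, (1 <= k <= minn Mt Mr)%N ->
     cK R (maxn Mt Mr) (minn Mt Mr) k.-1 + nu / MK R (minn Mt Mr) k < b ->
     ((k < minn Mt Mr)%N ->
        b <= cK R (maxn Mt Mr) (minn Mt Mr) k + nu / (MK R (minn Mt Mr) k - 1)) ->
     Delta_L P Hre Him G b rhos L.+1 @[L --> \oo] -->
       (Delta_region (maxn Mt Mr) (minn Mt Mr) b nu k)%:E).
Proof.
have M_gt0 : (0 < minn Mt Mr)%N by rewrite leq_min hMt.
have MR : 0 < (minn Mt Mr)%:R :> R by rewrite ltr0n.
split=> [bnu|[//|k] /andP[_ kM] cb bc].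
  rewrite (_ : (fun L => _) = cst nu%:E); first exact: cvg_cst.
  apply/funext => L; apply/eqP; rewrite eq_le Delta_L_ge_nu // andbT.
  (* At [r0 = M] both [dmt] and [dmt_time] vanish, so the converse reads Delta_L <= nu for every
     number of layers. *)
  have := @Delta_L_le _ _ _ _ _ _ _ _ _ hmodel M_gt0 _ _ _ hb hnu hrhos_pos hrhos L.+1
    (minn Mt Mr)%:R (ltn0Sn L) MR (lexx _).
  by rewrite dmt_time_top // addr0 dmt_top // addr0; apply.
have max_ge : (minn Mt Mr <= maxn Mt Mr)%N by rewrite geq_min !leq_max leqnn.
have [r0 [r00 r0M rE ->]] := region_rate max_ge hb hnu kM cb bc.
have slopeE : (fun j => (maxn Mt Mr + minn Mt Mr - 2 * j - 1)%:R) = slope R Mr Mt.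
  by apply/funext => j; rewrite /slope [(maxn _ _ + _)%N]addnC addn_min_max [(Mt + Mr)%N]addnC.
rewrite slopeE in rE *; set D := nu + _.
have lower L := @Delta_L_ge _ _ _ _ _ _ _ _ _ hmodel M_gt0 _ _ _ hb hnu hrhos_pos hrhos L.+1
  r0 (ltn0Sn L) r00 r0M rE.
have upper L : (Delta_L P Hre Him G b rhos L.+1 <= D%:E)%E.
  by apply: (@Delta_L_le _ _ _ _ _ _ _ _ _ hmodel M_gt0 _ _ _ hb hnu hrhos_pos hrhos); rewrite ?rE.
apply: (squeeze_cvge (f := fun L => (D - b * (minn Mt Mr)%:R ^+ 2 / r0 / L.+1%:R)%:E)
  (h := cst D%:E)).
- by apply: nearW => L; rewrite /= lower upper.
- apply: cvg_EFin; first by apply: nearW.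
  rewrite -[X in _ --> X]subr0 -[X in _ --> _ - X](mulr0 (b * (minn Mt Mr)%:R ^+ 2 / r0)).
  by apply: cvgB; [exact: cvg_cst | apply: cvgMr; exact: cvg_harmonic].
- exact: cvg_cst.
Qed.
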